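(* Let $\mathcal{H}$ be a Hardy field and let $f_1,\ldots,f_k\in\mathcal{H}$ satisfy, for each $i$: $\log(t)\log_4(t)\prec f_i(t)$ and there exists $j\in\mathbb{N}$ with $t^{j-1}\prec f_i(t)\prec t^j$. Assume also $f_1(t)\prec\frac{t}{\log_2(t)}$ and $\frac{f_{i+1}(t)}{f_i(t)}\succ 1$ for all $i=1,\ldots,k-1$. Then the natural density of $\{n\in\mathbb{N}:\gcd(n,\lfloor f_1(n)\rfloor,\ldots,\lfloor f_k(n)\rfloor)=1\}$ exists and equals $\frac{1}{\zeta(k+1)}$.
   Context: A Hardy field is a subfield of the ring of germs at $\infty$ of real-valued functions on $[1,\infty)$ that is closed under differentiation; a function belongs to $\mathcal{H}$ if its germ does. $\log_n$ denotes the $n$-fold iterated logarithm. We write $f(t)\prec g(t)$ (equivalently $g\succ f$) if $g(t)/f(t)\to\infty$ as $t\to\infty$. $\zeta$ is the Riemann zeta function. *)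

(* Defs.v *)
From HB Require Import structures.
From mathcomp Require Import all_boot all_order all_algebra.
From mathcomp Require Import all_classical all_reals all_analysis.

Set Implicit Arguments.
Unset Strict Implicit.
Unset Printing Implicit Defensive.

Import Order.TTheory GRing.Theory Num.Theory.
Import numFieldNormedType.Exports.

Local Open Scope classical_set_scope.
Local Open Scope ring_scope.

(* Equality of germs at infinity.  A germ does not depend on the values of a
   function outside [1, +oo[, so functions are taken to be total. *)
Definition germ_eq (R : realType) (f g : R -> R) : Prop :=
  \forall t \near +oo_R, f t = g t.

(* A set of germs at infinity is represented by the set of all the functions
   whose germ it contains, i.e. by a set H of functions that is saturated for
   [germ_eq]; thus [H f] reads "the germ of f belongs to H".  The other fields
   say that this set of germs is a subfield of the ring of germs that is closed
   under differentiation.  Inverses are inverses in the ring of germs.  In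
   [hardy_deriv], the value of [derive1 f] where f is not derivable is irrelevant,
   as f is required to be derivable near infinity. *)
Record hardy_field (R : realType) (H : set (R -> R)) : Prop := HardyField {
  hardy_germ : forall f g, germ_eq f g -> H f -> H g ;
  hardy_one : H (fun=> 1) ;
  hardy_sub : forall f g, H f -> H g -> H (fun t => f t - g t) ;
  hardy_mul : forall f g, H f -> H g -> H (fun t => f t * g t) ;
  hardy_inv : forall f, H f -> ~ germ_eq f (fun=> 0) ->
    exists2 g, H g & germ_eq (fun t => f t * g t) (fun=> 1) ;
  hardy_deriv : forall f, H f ->
    (\forall t \near +oo_R, derivable f t 1) /\ H (derive1 f)
}.

(* [f] grows strictly slower than [g]. *)
Definition growth_lt (R : realType) (f g : R -> R) : Prop :=
  g t / f t @[t --> +oo_R] --> +oo_R.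

Definition iter_log (R : realType) (n : nat) (t : R) : R := iter n (@ln R) t.

(* Only meaningful for real s > 1, where the series converges. *)
Definition zeta (R : realType) (s : R) : R :=
  limn (fun N => \sum_(1 <= n < N.+1) (n%:R : R) `^ (- s)).

(* The natural density of [set n | P n] (with n >= 1) exists and equals d. *)
Definition has_natural_density (R : realType) (P : pred nat) (d : R) : Prop :=
  (count P (index_iota 1 N.+1))%:R / N%:R @[N --> \oo] --> d.

Definition gcd_floors (R : realType) (k : nat) (f : 'I_k -> R -> R) (n : nat) :
    nat :=
  gcdn n (\big[gcdn/0%N]_(i < k) `|Num.floor (f i n%:R)|%N).

(* Main.v *)
(** For every modulus [m] the functions [f_i (m n) / m] are jointly equidistributed
    modulo 1: a nonzero integer combination of the [f_i] lies between [t^j] and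
    [t^(j+1)] in growth, and its [j+1]-st derivative [w] decreases to 0 with
    [t w -> oo] if [j = 0] (Fejer's criterion applies) and [t^2 w -> oo] otherwise,
    because the reciprocal of the previous derivative would otherwise grow too
    fast.  For [j >= 1] van der Corput differencing reduces to second differences,
    for which the Kusmin-Landau inequality is applied on each turn.  Shifts
    [f (t + h)] need not lie in the Hardy field, so the differencing is done on the
    finite differences of the sampled sequence, which the mean value theorem
    controls through [w].  Hence [m] divides the gcd with density [m^-(k+1)], and
    sieving by the primes up to [D] gives [prod_(p <= D) (1 - p^-(k+1))].

    The n for which a prime [p > D] divides both [n] and [floor (f_1 n)] have small
    upper density: [floor f_1] takes each value on an interval of length at most
    [1 / f_1'(N)], so at most [1 / (p f_1'(N)) + 1] of the n on which it equals a
    given multiple of [p] are multiples of [p].  Summing over [p], the terms [+ 1]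
    cost [f_1(N) log log N = o(N)], and the others are controlled by the prime
    divisors of the product of the values of [floor f_1] on [[eps N, N]]; here
    [log log log log N = o(N f_1'(N))] suffices. *)

Require Import Defs.
From mathcomp Require Import all_boot all_order all_algebra.
From mathcomp Require Import all_classical all_reals all_analysis.
From mathcomp Require Import ring lra zify.

Set Implicit Arguments.
Unset Strict Implicit.
Unset Printing Implicit Defensive.

Import Order.TTheory GRing.Theory Num.Theory.
Import numFieldNormedType.Exports.

Local Open Scope classical_set_scope.
Local Open Scope ring_scope.

(** * Exponential sums with monotone differences *)

(** The Hardy field need not contain the real constants, the identity or the logarithm. Inside it a
    germ is compared only with other members, integers and reciprocals of integers; comparisons with
    powers of [t] and with [ln t] go through the mean value theorem.

    Exponential sums are kept real: cosines with an arbitrary phase replace complex exponentials.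

    The fourth logarithm arises as follows. With [s = N f_1'(N)] one has [f_1(N) <= 2 s log N], so
    the product of the [O(s)] integers between [f_1(eps N)] and [f_1(N)] has [O(s log (s log N))]
    binary digits. This also bounds the number [L] of its prime divisors, whose reciprocals sum to
    about [log log L]; that is [o(s)] once [log log log log N = o(s)]. The same inequality turns the
    lower bound on [f_1] into this lower bound on [s].

    The sieve is stated for an abstract functional and run twice: on densities, and on partial sums
    of zeta, where it yields the Euler product with an error term. *)

Ltac nlia := repeat match goal with
  | H : context [@Order.le] |- _ => clear H
  | H : context [@Order.lt] |- _ => clear H
  | H : forall _, _ |- _ => clear H
  end; lia.

Section CosineSums.
Variable R : realType.
Implicit Types (X : nat -> R) (a b n : nat).

Lemma cosD2pi_int (x : R) (m : int) : cos (x + m%:~R * (2 * pi)) = cos x.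
Proof.
have h k : cos (x + k%:R * (2 * pi)) = cos x.
  rewrite (_ : k%:R * (2 * pi) = (pi *+ 2) *+ k); last first.
    by rewrite -[RHS]mulr_natl -[pi *+ 2]mulr_natl mulrA.
  exact: (periodicn (@cosD2pi R)).
have h' k : cos (x - k%:R * (2 * pi)) = cos x.
  have := periodicn (@cosD2pi R) k (x - k%:R * (2 * pi)).
  rewrite (_ : x - _ + _ = x) => [->//|].
  by rewrite -[X in _ + X]mulr_natl -[pi *+ 2]mulr_natl; ring.
case: m => m; first exact: h.
by rewrite NegzE mulrNz mulNr; exact: h'.
Qed.

(** Allows the slopes of a phase to be moved by a multiple of [2 pi] into [[0, 2 pi]]. *)
Lemma cos_shift_linear X (m : int) n :
  cos (X n - m%:~R * (2 * pi) * n%:R) = cos (X n).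
Proof.
rewrite (_ : X n - _ = X n + (- m * n%:Z)%:~R * (2 * pi)); first exact: cosD2pi_int.
by rewrite intrM intrN -pmulrn; ring.
Qed.

(** By the mean value theorem [sin x = x cos c], and [cos c = 1 - 2 sin (c / 2) ^ 2 >= 1 - c ^ 2 / 2
    >= 1 / 2]. *)
Lemma sin_ge_half (x : R) : 0 <= x <= 1 -> x / 2 <= sin x.
Proof.
move=> /andP[x0 x1].
have [|] := leP x 0 => [x0'|xpos].
  by rewrite (le_anti (introT andP (conj x0' x0))) sin0 mul0r.
have der (y : R) : is_derive y 1 (@sin R) (cos y) by exact: is_derive_sin.
have [|c] := MVT xpos (fun y _ => der y).
  by apply: continuous_subspaceT => ?; exact: continuous_sin.
rewrite in_itv/= sin0 !subr0 => /andP[c0 cx] ->.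
rewrite mulrC ler_wpM2r//.
have cc : cos c = 1 - 2 * sin (c / 2) ^+ 2.
  rewrite [in LHS](_ : c = (c / 2) *+ 2); last by rewrite -mulr_natr; field.
  by rewrite cos_mulr2n sin2cos2; ring.
have sc : 0 <= sin (c / 2) <= c / 2.
  apply/andP; split.
    by apply: ltW; apply: sin2_gt0; lra.
  have c2 : 0 < c / 2 by lra.
  have [|d] := MVT c2 (fun y _ => der y).
    by apply: continuous_subspaceT => ?; exact: continuous_sin.
  rewrite in_itv/= sin0 !subr0 => _ ->.
  by rewrite ler_piMl ?cos_le1//; lra.
rewrite cc; nra.
Qed.

Lemma abel_monotone_bound (c s : nat -> R) a b (K : R) : (a < b)%N ->
  (forall n, (a <= n < b)%N -> `|c n| <= K) ->
  (forall n, `|s n| <= 1) ->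
  (forall n, (a <= n)%N -> (n.+1 < b)%N -> c n.+1 <= c n) ->
  `|\sum_(a <= n < b) c n * (s n.+1 - s n)| <= 4 * K.
Proof.
move=> ab cK s1 cdec.
have key b' : (a < b' <= b)%N ->
    `|\sum_(a <= n < b') c n * (s n.+1 - s n) - c b'.-1 * s b'| <=
    K + (c a - c b'.-1).
  elim: b' => // b' IH /andP[ab' b'b].
  rewrite big_nat_recr//=.
  have [ba|ba] := eqVneq b' a.
    rewrite ba big_geq// add0r subrr addr0.
    rewrite (_ : _ - _ = - (c a * s a)); last by ring.
    rewrite normrN normrM; apply: le_trans (cK a _); last by lia.
    by rewrite ler_piMr.
  have ab'' : (a < b')%N by lia.
  have cb : c b' <= c b'.-1 by have := cdec b'.-1; rewrite prednK; [apply; lia|lia].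
  rewrite (_ : _ + _ - _ = (\sum_(a <= n < b') c n * (s n.+1 - s n) - c b'.-1 * s b')
     + (c b'.-1 - c b') * s b'); last by ring.
  apply: le_trans (ler_normD _ _) _.
  have h1 := IH ltac:(lia).
  have h2 : `|(c b'.-1 - c b') * s b'| <= c b'.-1 - c b'.
    by rewrite normrM ger0_norm ?subr_ge0// ler_piMr// subr_ge0.
  lra.
have := key b; rewrite ab leqnn => /(_ isT) h.
have ca := cK a ltac:(lia); have cb := cK b.-1 ltac:(lia).
have csb : `|c b.-1 * s b| <= K by rewrite normrM; apply: le_trans cb; rewrite ler_piMr.
move: ca cb csb h; rewrite !ler_norml; lra.
Qed.

(** Real part of [e^(ix) = (e^(i(x+t)) - e^(ix)) / (e^(it) - 1)], where [1 / (e^(it) - 1) = - 1/2 -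
    (i/2) cot (t/2)]. *)
Lemma cos_cot_identity (x t : R) : sin (t / 2) != 0 ->
  cos x = (cos x - cos (x + t)) / 2 +
          cos (t / 2) / sin (t / 2) / 2 * (sin (x + t) - sin x).
Proof.
move=> st; have := cos2Dsin2 (t / 2).
have et : t = (t / 2) *+ 2 by rewrite -mulr_natr; field.
rewrite [X in cos (x + X)]et [X in sin (x + X)]et cosD sinD cos_mulr2n sin_mulr2n.
move: st; set S := sin (t / 2); set C := cos (t / 2); set a := cos x; set b := sin x.
move=> S0 E.
have -> : a = a * (C ^+ 2 + S ^+ 2) by rewrite E mulr1.
have E2 : C ^+ 2 = 1 - S ^+ 2 by rewrite -E; ring.
rewrite -(mulr_natl (C ^+ 2) 2) -(mulr_natl (C * S) 2).
transitivity (((a - (a * (2 * C ^+ 2 - 1) - b * (2 * (C * S)))) / 2 +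
   C / S / 2 * (b * (2 * C ^+ 2 - 1) + a * (2 * (C * S)) - b))); last first.
  by rewrite E !mulr1.
rewrite (_ : b * (2 * C ^+ 2 - 1) + a * (2 * (C * S)) - b
  = - 2 * b * S ^+ 2 + a * (2 * (C * S))); last by rewrite E2; ring.
rewrite (_ : a - (a * (2 * C ^+ 2 - 1) - b * (2 * (C * S)))
  = 2 * a * S ^+ 2 + 2 * b * C * S); last by rewrite E2; ring.
by field.
Qed.

Lemma sin_ge_al (al u : R) : 0 <= al -> al <= u <= pi - al -> sin al <= sin u.
Proof.
move=> al0 /andP[alu upi].
rewrite -subr_ge0 (_ : sin u - sin al =
   2 * (cos ((u + al) / 2) * sin ((u - al) / 2))); last first.
  rewrite [in sin u](_ : u = (u + al) / 2 + (u - al) / 2); last by field.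
  rewrite [in sin al](_ : al = (u + al) / 2 - (u - al) / 2); last by field.
  by rewrite sinD sinB; ring.
have pi2 := pi_ge2 R.
rewrite mulr_ge0// mulr_ge0//.
  by apply: cos_ge0_pihalf; apply/andP; split; lra.
by apply: sin_ge0_pi; apply/andP; split; lra.
Qed.

Lemma cot_nincr (al t t' : R) : 0 < al <= 1 ->
  2 * al <= t -> t <= t' -> t' <= 2 * pi - 2 * al ->
  cos (t' / 2) / sin (t' / 2) <= cos (t / 2) / sin (t / 2).
Proof.
move=> /andP[al0 al1] h1 h2 h3.
have pi2 := pi_ge2 R.
have st : 0 < sin (t / 2) by apply: sin_gt0_pi; apply/andP; split; lra.
have st' : 0 < sin (t' / 2) by apply: sin_gt0_pi; apply/andP; split; lra.
rewrite -subr_ge0 (_ : _ - _ = sin (t' / 2 - t / 2) / (sin (t / 2) * sin (t' / 2))); last first.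
  by rewrite sinB; field; rewrite !gt_eqF.
rewrite divr_ge0//; last by rewrite mulr_ge0 ?ltW.
by apply: sin_ge0_pi; apply/andP; split; lra.
Qed.

(** When [t] is the slope in [cos_cot_identity], the first part telescopes to at most 1. The weights
    [cot / 2] of the second decrease because the slopes increase, and are at most [1 / al] because
    [sin al >= al / 2]; Abel summation gives [4 / al]. *)
Lemma kusmin_landau X a b (al : R) : 0 < al <= 1 ->
  (forall n, (a <= n < b)%N -> 2 * al <= X n.+1 - X n <= 2 * pi - 2 * al) ->
  (forall n, (a <= n)%N -> (n.+1 < b)%N -> X n.+1 - X n <= X n.+2 - X n.+1) ->
  `|\sum_(a <= n < b) cos (X n)| <= 5 / al.
Proof.
move=> al01 Xal Xmon; have /andP[al0 al1] := al01.
have [ba|ab] := leqP b a.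
  by rewrite big_geq// normr0 divr_ge0// ltW.
have sal : 0 < sin al by have := sin_ge_half (x := al); rewrite al1 ltW//= => /(_ isT); lra.
pose c n := cos ((X n.+1 - X n) / 2) / sin ((X n.+1 - X n) / 2) / 2.
have sn n : (a <= n < b)%N -> sin al <= sin ((X n.+1 - X n) / 2).
  by move=> /Xal /andP[? ?]; apply: sin_ge_al; [exact: ltW|apply/andP; split; lra].
have -> : \sum_(a <= n < b) cos (X n) = (cos (X a) - cos (X b)) / 2 +
    \sum_(a <= n < b) c n * (sin (X n.+1) - sin (X n)).
  transitivity (\sum_(a <= n < b) ((cos (X n) - cos (X n.+1)) / 2 +
     c n * (sin (X n.+1) - sin (X n)))).
    apply: eq_big_nat => n nab.
    have := @cos_cot_identity (X n) (X n.+1 - X n).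
    rewrite (_ : X n + (X n.+1 - X n) = X n.+1); last by ring.
    by move=> <- //; rewrite gt_eqF//; apply: lt_le_trans sal _; exact: sn.
  rewrite big_split/=; congr (_ + _).
  rewrite -mulr_suml; congr (_ / 2).
  rewrite -[in RHS](opprB (cos (X b))) -(telescope_sumr (fun n => cos (X n)) (ltnW ab)).
  by rewrite -sumrN; apply: eq_bigr => i _; rewrite opprB.
have B1 : `|(cos (X a) - cos (X b)) / 2| <= 1.
  have := cos_max (X a); have := cos_max (X b).
  by rewrite !ler_norml; lra.
have B2 : `|\sum_(a <= n < b) c n * (sin (X n.+1) - sin (X n))| <= 4 * (1 / al).
  apply: (@abel_monotone_bound c (fun n => sin (X n))) => //.
  - move=> n nab; rewrite /c !normrM.
    have s0 := sn _ nab.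
    have s1 : al / 2 <= sin ((X n.+1 - X n) / 2).
      by apply: le_trans s0; apply: sin_ge_half; rewrite al1 ltW.
    rewrite !normfV !(@ger0_norm _ 2)// (@gtr0_norm _ (sin _)); last by lra.
    apply: (@le_trans _ _ (1 / sin ((X n.+1 - X n) / 2) / 2)).
      rewrite ler_wpM2r// ler_wpM2r ?cos_max// invr_ge0; lra.
    rewrite mul1r -invfM div1r lef_pV2 ?posrE; lra.
  - by move=> n; exact: sin_max.
  - move=> n an nb; rewrite /c ler_wpM2r//.
    have /andP[? ?] := Xal n ltac:(lia); have /andP[? ?] := Xal n.+1 ltac:(lia).
    by apply: (cot_nincr al01); [|exact: Xmon|].
have B3 : 1 <= 1 / al by rewrite ler_pdivlMr// mul1r.
by apply: le_trans (ler_normD _ _) _; lra.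
Qed.

(** The reflection [2 pi n - X n] has the same cosines and replaces each slope by its complement to
    [2 pi]. *)
Lemma kusmin_landau_decr X a b (al : R) : 0 < al <= 1 ->
  (forall n, (a <= n < b)%N -> 2 * al <= X n.+1 - X n <= 2 * pi - 2 * al) ->
  (forall n, (a <= n)%N -> (n.+1 < b)%N -> X n.+2 - X n.+1 <= X n.+1 - X n) ->
  `|\sum_(a <= n < b) cos (X n)| <= 5 / al.
Proof.
move=> al01 Xal Xmon.
pose Y n := - (X n - 1%:~R * (2 * pi) * n%:R).
have YX n : Y n.+1 - Y n = 2 * pi - (X n.+1 - X n) by rewrite /Y -natr1; ring.
have -> : \sum_(a <= n < b) cos (X n) = \sum_(a <= n < b) cos (Y n).
  by apply: eq_bigr => n _; rewrite /Y cosN cos_shift_linear.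
apply: kusmin_landau => // n.
  by move=> /Xal; rewrite YX; lra.
by move=> an nb; have := Xmon _ an nb; rewrite !YX; lra.
Qed.

Lemma monotone_split (P : pred nat) a b : (a <= b)%N ->
  (forall n, (a <= n)%N -> (n.+1 < b)%N -> P n -> P n.+1) ->
  exists c, [/\ (a <= c <= b)%N, forall n, (a <= n < c)%N -> ~~ P n &
    forall n, (c <= n < b)%N -> P n].
Proof.
elim: b => [|b IH] ab Pm.
  by exists 0%N; split; [lia|move=> n; lia|move=> n; lia].
have [ab'|ab'] := eqVneq a b.+1.
  by exists a; split; [lia|move=> n; lia|move=> n; lia].
have [||c [c1 c2 c3]] := IH; first by lia.
  by move=> n an nb; apply: Pm; lia.
have [Pb|Pb] := boolP (P b).
  exists c; split; [lia|done|] => n /andP[cn]; rewrite ltnS leq_eqVlt => /orP[/eqP->//|nb].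
  by apply: c3; rewrite cn.
have [cb|cb] := eqVneq c b; last first.
  have : P b by have := Pm b.-1; rewrite prednK; [apply; [lia|lia|apply: c3; lia]|lia].
  by rewrite (negbTE Pb).
exists b.+1; split; [lia| |move=> n; lia].
move=> n /andP[an]; rewrite ltnS leq_eqVlt => /orP[/eqP->//|nb].
by apply: c2; rewrite an cb.
Qed.

Lemma slope_count (T : nat -> R) a c (lam u w : R) : 0 < lam -> 0 <= w ->
  (forall n, (a <= n)%N -> (n.+1 < c)%N -> lam <= T n.+1 - T n) ->
  (forall n, (a <= n < c)%N -> u <= T n <= u + w) ->
  (c - a)%:R <= w / lam + 1.
Proof.
move=> l0 w0 Tl Tu.
have [ca|ac] := leqP c a.
  rewrite (_ : (c - a)%N = 0%N); last by lia.
  by rewrite addr_ge0// divr_ge0// ltW.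
have key m : (a + m < c)%N -> T a + m%:R * lam <= T (a + m)%N.
  elim: m => [|m IH] am; first by rewrite addn0 mul0r addr0.
  have h1 := IH ltac:(lia); have h2 := Tl (a + m)%N ltac:(lia) ltac:(lia).
  by rewrite addnS -natr1; lra.
have h := key (c - a).-1 ltac:(lia).
have /andP[h1 _] := Tu a ltac:(lia).
have /andP[_ h2] := Tu (a + (c - a).-1)%N ltac:(lia).
rewrite (_ : (c - a)%:R = (c - a).-1%:R + 1); last by rewrite natr1 prednK; [|lia].
by rewrite lerD2r ler_pdivlMr//; lra.
Qed.

Lemma cos_sum_trivial X a b : `|\sum_(a <= n < b) cos (X n)| <= (b - a)%:R.
Proof.
apply: le_trans (ler_norm_sum _ _ _) _.
by rewrite -sumr_const_nat ler_sum// => i _; exact: cos_max.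
Qed.

(** Slopes within [2 d] of either end of the turn occur at most [2 d / d ^ 2 + 1] times and are
    bounded trivially; on the others Kusmin-Landau gives [5 / d]. The width [2 d] balances the two
    contributions. *)
Lemma cos_sum_one_turn X a c (m : int) (d : R) : 0 < d <= 1 ->
  (forall n, (a <= n < c)%N ->
    m%:~R * (2 * pi) <= X n.+1 - X n < (m + 1)%:~R * (2 * pi)) ->
  (forall n, (a <= n)%N -> (n.+1 < c)%N ->
    d ^+ 2 <= (X n.+2 - X n.+1) - (X n.+1 - X n)) ->
  `|\sum_(a <= n < c) cos (X n)| <= 11 / d.
Proof.
move=> d01 Tm Ty; have /andP[d0 d1] := d01.
have dd : 0 < d ^+ 2 by rewrite exprn_gt0.
have [ca|/ltnW ac] := leqP c a.
  by rewrite big_geq// normr0 divr_ge0// ltW.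
have piR := pi_ge2 R.
have Tmon n : (a <= n)%N -> (n.+1 < c)%N -> X n.+1 - X n <= X n.+2 - X n.+1.
  by move=> an nc; have := Ty n an nc; lra.
set M := m%:~R * (2 * pi) in Tm.
have EM : (m + 1)%:~R * (2 * pi) = M + 2 * pi :> R by rewrite intrD /M; ring.
rewrite EM in Tm.
have [|c1 [c1b c1l c1r]] := @monotone_split (fun n => M + 2 * d <= X n.+1 - X n) a c ac.
  by move=> n an nc h; have := Tmon n an nc; lra.
have [||c2 [c2b c2l c2r]] := @monotone_split (fun n => M + 2 * pi - 2 * d < X n.+1 - X n) c1 c.
- by lia.
- by move=> n an nc h; have := Tmon n ltac:(lia) nc; lra.
rewrite (@big_cat_nat _ _ _ c1)/=; [|lia|lia].
rewrite [X in _ + X](@big_cat_nat _ _ _ c2)/=; [|lia|lia].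
have w0 : 0 <= 2 * d by lra.
have B1 : `|\sum_(a <= n < c1) cos (X n)| <= 2 / d + 1.
  apply: le_trans (cos_sum_trivial _ _ _) _.
  rewrite (_ : 2 / d = 2 * d / d ^+ 2); last by field; rewrite gt_eqF.
  apply: (@slope_count (fun n => X n.+1 - X n) a c1 (d ^+ 2) M) => //.
    by move=> n an nc; apply: Ty; lia.
  move=> n nac; have := Tm n ltac:(lia); have := c1l n nac; rewrite -ltNge; lra.
have B3 : `|\sum_(c2 <= n < c) cos (X n)| <= 2 / d + 1.
  apply: le_trans (cos_sum_trivial _ _ _) _.
  rewrite (_ : 2 / d = 2 * d / d ^+ 2); last by field; rewrite gt_eqF.
  apply: (@slope_count (fun n => X n.+1 - X n) c2 c (d ^+ 2) (M + 2 * pi - 2 * d)) => //.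
    by move=> n an nc; apply: Ty; lia.
  move=> n nac; have := Tm n ltac:(lia); have := c2r n nac; lra.
have B2 : `|\sum_(c1 <= n < c2) cos (X n)| <= 5 / d.
  pose Y n := X n - m%:~R * (2 * pi) * n%:R.
  have YX n : Y n.+1 - Y n = X n.+1 - X n - M by rewrite /Y /M -natr1; ring.
  rewrite (_ : \sum_(c1 <= n < c2) cos (X n) = \sum_(c1 <= n < c2) cos (Y n)); last first.
    by apply: eq_bigr => n _; rewrite /Y cos_shift_linear.
  apply: kusmin_landau => // n.
    move=> nc; rewrite YX; have := c1r n ltac:(lia); have := c2l n nc; rewrite -leNgt; lra.
  by move=> an nb; have := Tmon n ltac:(lia) ltac:(lia); rewrite !YX; lra.
apply: le_trans (ler_normD _ _) _.
have := ler_normD (\sum_(c1 <= n < c2) cos (X n)) (\sum_(c2 <= n < c) cos (X n)).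
have B4 : 1 <= 1 / d by rewrite ler_pdivlMr// mul1r.
lra.
Qed.

(** The slope climbs by at least [2 pi - 1 >= 1] between [c] and [d], in steps of at most [y c]. *)
Lemma block_length X (y : nat -> R) c d (M : R) :
  (forall n, y n = (X n.+2 - X n.+1) - (X n.+1 - X n)) ->
  (forall n, (c <= n)%N -> y n <= y c) -> (c <= d)%N ->
  X c.+1 - X c <= M + 1 -> M + 2 * pi <= X d.+1 - X d ->
  1 <= (d - c)%:R * y c.
Proof.
move=> yE ymon cd h1 h2.
have key k : X (c + k).+1 - X (c + k)%N - (X c.+1 - X c) <= k%:R * y c.
  elim: k => [|k IH]; first by rewrite addn0 subrr mul0r.
  have := ymon (c + k)%N (leq_addr _ _).
  by rewrite [y (c + k)%N]yE addnS -natr1; lra.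
have := key (d - c)%N; rewrite (subnKC cd).
by have := pi_ge2 R; lra.
Qed.

Lemma block_charge (s D eta : R) : 0 < s -> 0 <= D -> 1 <= D * s ^+ 2 ->
  11 * s <= eta -> 11 / s <= eta * D.
Proof.
move=> s0 D0 one e1; rewrite ler_pdivrMr//.
apply: (@le_trans _ _ (11 * s * D * s)); last by rewrite ler_pM2r// ler_wpM2r.
by rewrite (_ : 11 * s * D * s = 11 * (D * s ^+ 2)); [lra|ring].
Qed.

(* The n with [X n.+1 - X n] in [[2 pi m, 2 pi (m + 1)[] form a block, whose sum
   is [O(1 / sqrt y)] for y the last second difference; it is charged to the
   next block, whose length is at least [1 / y]. *)
Lemma cos_sum_turns X n0 b (eta : R) (y : nat -> R) :
  (forall n, y n = (X n.+2 - X n.+1) - (X n.+1 - X n)) ->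
  (forall n, (n0 <= n)%N -> 0 < y n <= 1) ->
  (forall n, (n0 <= n)%N -> y n.+1 <= y n) ->
  (forall n, (n0 <= n)%N -> 11 * Num.sqrt (y n) <= eta) ->
  forall k a c (m : int), (b - a < k)%N -> (n0 <= a)%N -> (a <= c <= b)%N ->
  (c = a -> a = b) ->
  (forall n, (a <= n < c)%N ->
    m%:~R * (2 * pi) <= X n.+1 - X n < (m + 1)%:~R * (2 * pi)) ->
  (forall n, (c <= n < b)%N -> (m + 1)%:~R * (2 * pi) <= X n.+1 - X n) ->
  `|\sum_(a <= n < b) cos (X n)| <= eta * (b - c)%:R + 22 / Num.sqrt (y b).
Proof.
move=> yE y01 ydec yeta.
have y0 n : (n0 <= n)%N -> 0 < y n by move=> /y01/andP[].
have ymon n n' : (n0 <= n)%N -> (n <= n')%N -> y n' <= y n.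
  move=> nn; elim: n' => [|n' IH]; first by rewrite leqn0 => /eqP->.
  rewrite leq_eqVlt => /orP[/eqP->//|nn'].
  by apply: le_trans (ydec _ _) (IH _); nlia.
have sq n : (n0 <= n)%N -> 0 < Num.sqrt (y n) <= 1.
  move=> nn; have /andP[h1 h2] := y01 n nn; rewrite sqrtr_gt0 h1/=.
  by rewrite -[leRHS]sqrtr1 ler_wsqrtr.
have eta0 : 0 <= eta.
  by apply: le_trans (yeta n0 _) => //; rewrite mulr_ge0// sqrtr_ge0.
have piR := pi_ge2 R.
have piece a c m : (n0 <= a)%N -> (a <= c)%N ->
  (forall n, (a <= n < c)%N ->
    m%:~R * (2 * pi) <= X n.+1 - X n < (m + 1)%:~R * (2 * pi)) ->
  `|\sum_(a <= n < c) cos (X n)| <= 11 / Num.sqrt (y c).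
  move=> na ac; move=> h; apply: cos_sum_one_turn h _; first by apply: sq; nlia.
  move=> n an nc; rewrite sqr_sqrtr; last by apply/ltW/y0; nlia.
  by rewrite -yE; apply: ymon; nlia.
have inv_mon n n' : (n0 <= n)%N -> (n <= n')%N ->
    1 / Num.sqrt (y n) <= 1 / Num.sqrt (y n').
  move=> h1 h2; have /andP[? ?] := sq n h1; have /andP[? ?] := sq n' (leq_trans h1 h2).
  by rewrite !div1r lef_pV2 ?posrE// ler_wsqrtr// ymon.
(* Induction on a bound for [b - a]. The block [[a, c[] is paid for by the length of the next one,
   [[c, d[], which pays for no other block; only the last two blocks stay unpaid, and they give
   [22 / sqrt (y b)]. *)
elim=> [|k IH] a c m; first by nlia.
move=> ka na acb cab Tm Tc.
have pa := piece a c m na ltac:(nlia) Tm.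
have inv0 : 0 <= 1 / Num.sqrt (y b).
  by have /andP[? _] := sq b ltac:(nlia); rewrite divr_ge0// ltW.
have [cb|cb] := eqVneq c b.
  by rewrite cb in pa *; rewrite subnn mulr0 add0r; lra.
have {}cb : (c < b)%N by nlia.
have {cab} ac : (a < c)%N.
  by rewrite ltn_neqAle; apply/andP; split; [apply/eqP => e; have := cab (esym e); nlia|nlia].
pose m' := Num.floor ((X c.+1 - X c) / (2 * pi)).
have pi2 : 0 < 2 * pi :> R by lra.
have m'l : m'%:~R * (2 * pi) <= X c.+1 - X c.
  by rewrite -ler_pdivlMr// floor_le_tmp.
have m'r : X c.+1 - X c < (m' + 1)%:~R * (2 * pi).
  by rewrite -ltr_pdivrMr// floorD1_gt.
have mm' : (m + 1 <= m')%R.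
  by rewrite /m' floor_ge_int ler_pdivlMr//; apply: Tc; nlia.
have Tmon n n' : (n0 <= n)%N -> (n <= n')%N -> X n.+1 - X n <= X n'.+1 - X n'.
  move=> nn; elim: n' => [|n' IH']; first by rewrite leqn0 => /eqP->.
  rewrite leq_eqVlt => /orP[/eqP->//|nn'].
  have := IH' nn'; have := y0 n' ltac:(nlia); rewrite yE; lra.
have [|n nc nb h|d [db dl dr]] :=
    @monotone_split (fun n => (m' + 1)%:~R * (2 * pi) <= X n.+1 - X n) c b.
- by nlia.
- by apply: le_trans h _; apply: Tmon; nlia.
have cd : (c < d)%N.
  rewrite ltn_neqAle; apply/andP; split; last by nlia.
  by apply/eqP => e; have := dr c ltac:(nlia); lra.
have Tm' n : (c <= n < d)%N ->
    m'%:~R * (2 * pi) <= X n.+1 - X n < (m' + 1)%:~R * (2 * pi).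
  move=> nn; rewrite ltNge dl// andbT.
  by apply: le_trans m'l _; apply: Tmon; nlia.
rewrite (@big_cat_nat _ _ _ c)/=; [|lia|lia].
apply: le_trans (ler_normD _ _) _.
have [db'|db'] := eqVneq d b.
  subst d; have := piece c b m' ltac:(nlia) ltac:(nlia) Tm'.
  have := inv_mon c b ltac:(nlia) ltac:(nlia).
  have : 0 <= eta * (b - c)%:R by rewrite mulr_ge0.
  lra.
have h := IH c d m' ltac:(nlia) ltac:(nlia) ltac:(nlia) ltac:(nlia) Tm' dr.
suff : 11 / Num.sqrt (y c) <= eta * (d - c)%:R.
  have -> : (b - c)%:R = (d - c)%:R + (b - d)%:R :> R by rewrite -natrD; congr _%:R; nlia.
  by lra.
have /andP[s0 s1] := sq c ltac:(nlia).
have e1 := yeta c ltac:(nlia).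
apply: block_charge => //.
rewrite sqr_sqrtr; last by apply/ltW/y0; nlia.
have h1 := dr d ltac:(nlia).
(* The slope at [c.-1] is still in turn [m] and [y <= 1], so the slope at [c] exceeds the end of
   that turn by at most 1, whereas the slope at [d] exceeds it by at least [2 pi]. *)
have /andP[_ h2] := Tm c.-1 ltac:(nlia).
have := y01 c.-1 ltac:(nlia); rewrite yE.
rewrite (ltn_predK ac) in h2 *.
move=> /andP[_ h3].
have h4 : (m + 1)%:~R * (2 * pi) + 2 * pi <= (m' + 1)%:~R * (2 * pi) :> R.
  rewrite (_ : _ + _ = (m + 1 + 1)%:~R * (2 * pi)); last by rewrite !intrD; ring.
  by rewrite ler_wpM2r ?(ltW pi2)// ler_int lerD2r.
apply: (block_length yE (M := (m + 1)%:~R * (2 * pi))).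
- by move=> n cn; apply: ymon => //; nlia.
- exact: ltnW.
- by clear -h2 h3; lra.
- by apply: le_trans h4 _.
Qed.

End CosineSums.

(** * Averages of cosines: Fejer's criterion and van der Corput differencing *)

Section WeylSums.
Variable R : realType.
Implicit Types (X : nat -> R).

Definition dif X n := X n.+1 - X n.

Definition cos_avg0 X := forall eps : R, 0 < eps ->
  \forall N \near \oo, `|\sum_(0 <= n < N) cos (X n)| <= eps * N%:R.

(* The weight is [n] at order 1 (Fejer's criterion) and [n ^ 2] at order [>= 2]. *)
Definition vdc_class (p j : nat) X :=
  [/\ \forall n \near \oo, 0 < iter j dif X n /\ iter j dif X n.+1 <= iter j dif X n,
      (forall eps : R, 0 < eps -> \forall n \near \oo, iter j dif X n <= eps) &
      (forall M : R, \forall n \near \oo, M <= n%:R ^+ p * iter j dif X n)].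

Lemma nearP_nat (P : nat -> Prop) : (\forall n \near \oo, P n) ->
  exists n0, forall n, (n0 <= n)%N -> P n.
Proof. by move=> [n0 _ h]; exists n0 => n; exact: h. Qed.

Lemma near_natP (P : nat -> Prop) n0 : (forall n, (n0 <= n)%N -> P n) ->
  \forall n \near \oo, P n.
Proof. by move=> h; exists n0. Qed.

Lemma near_natr_ge (A : R) : \forall n \near \oo, A <= n%:R.
Proof.
apply: (@near_natP _ (Num.truncn `|A|).+1) => n An.
apply: le_trans (ler_norm _) _; apply: ltW.
apply: (lt_le_trans (truncnS_gt _)); by rewrite ler_nat.
Qed.

Lemma cos_avg0_tail X n0 : (forall eps : R, 0 < eps ->
   \forall N \near \oo, `|\sum_(n0 <= n < N) cos (X n)| <= eps * N%:R) -> cos_avg0 X.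
Proof.
move=> h eps eps0; have e2 : 0 < eps / 2 by lra.
near=> N.
have n0N : (n0 <= N)%N by near: N; exact: nbhs_infty_ge.
rewrite (@big_cat_nat _ _ _ n0)//=; apply: le_trans (ler_normD _ _) _.
have h1 := cos_sum_trivial X 0 n0; rewrite subn0 in h1.
have h2 : `|\sum_(n0 <= n < N) cos (X n)| <= eps / 2 * N%:R by near: N; exact: h.
have h3 : n0%:R / (eps / 2) <= N%:R by near: N; exact: near_natr_ge.
rewrite ler_pdivrMr// in h3; lra.
Unshelve. all: by end_near. Qed.

(** Up to [N] all slopes lie between the slope [s] at [N] and 1, so Kusmin-Landau with [al = s / 2]
    bounds the sum by [10 / s], which is [o(N)] because [N s -> oo]. *)
Lemma fejer_criterion X : vdc_class 1 1 X -> cos_avg0 X.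
Proof.
move=> [/nearP_nat[n1 h1] /(_ 1 ltr01)/nearP_nat[n2 h2] h3].
set n0 := maxn n1 n2.
have ydec n : (n0 <= n)%N -> X n.+2 - X n.+1 <= X n.+1 - X n.
  by move=> nn; have [] := h1 n ltac:(lia).
have y0 n : (n0 <= n)%N -> 0 < X n.+1 - X n <= 1.
  move=> nn; have [+ _] := h1 n ltac:(lia); have := h2 n ltac:(lia).
  by rewrite /= /dif => -> ->.
have ymon n n' : (n0 <= n)%N -> (n <= n')%N -> X n'.+1 - X n' <= X n.+1 - X n.
  move=> nn; elim: n' => [|n' IH]; first by rewrite leqn0 => /eqP->.
  rewrite leq_eqVlt => /orP[/eqP->//|nn'].
  by apply: le_trans (ydec _ _) (IH _); nlia.
apply: (@cos_avg0_tail X n0) => eps eps0.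
have pi2 := pi_ge2 R.
near=> N.
have n0N : (n0 <= N)%N by near: N; exact: nbhs_infty_ge.
have hM : 10 / eps <= N%:R ^+ 1 * iter 1 dif X N by near: N; exact: h3.
have /andP[yN0 yN1] := y0 N n0N.
set s := X N.+1 - X N in yN0 yN1.
have {}hM : 10 / eps <= N%:R * s by move: hM; rewrite expr1.
rewrite ler_pdivrMr// in hM.
apply: le_trans (_ : 5 / (s / 2) <= _).
  apply: kusmin_landau_decr.
  - by apply/andP; split; lra.
  - move=> n /andP[n0n nN]; have /andP[? ?] := y0 n n0n.
    by have := ymon n N n0n (ltnW nN); rewrite -/s => ?; apply/andP; split; lra.
  - by move=> n n0n _; exact: ydec.
rewrite (_ : 5 / (s / 2) = 10 / s); last by field; rewrite gt_eqF.
by rewrite ler_pdivrMr//; lra.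
Unshelve. all: by end_near. Qed.

(** In the bound of [cos_sum_turns], [eta] can be made small because the second differences tend to
    0, and the last term is [o(N)] because [N ^ 2 y N -> oo]. *)
Lemma second_difference_criterion X : vdc_class 2 2 X -> cos_avg0 X.
Proof.
move=> [/nearP_nat[n1 h1] h2 h3].
pose y n := iter 2 dif X n.
have yE n : y n = (X n.+2 - X n.+1) - (X n.+1 - X n) by [].
have [n2 h2'] := nearP_nat (h2 1 ltr01).
suff Hs (eta : R) : 0 < eta -> exists n0 : nat, forall N, (n0 <= N)%N ->
    `|\sum_(n0 <= n < N) cos (X n)| <= eta * N%:R + 22 / Num.sqrt (y N).
  move=> eps eps0.
  have [|n0 hn0] := Hs (eps / 4); first by lra.
  near=> N.
  have n0N : (n0 <= N)%N by near: N; exact: nbhs_infty_ge.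
  have yN0 : 0 < y N by have [] := h1 N; [near: N; exact: nbhs_infty_ge|].
  rewrite (@big_cat_nat _ _ _ n0)//=; apply: le_trans (ler_normD _ _) _.
  have t1 := cos_sum_trivial X 0 n0; rewrite subn0 in t1.
  have t2 := hn0 N n0N.
  have t3 : n0%:R / (eps / 4) <= N%:R by near: N; exact: near_natr_ge.
  have t4 : (22 / (eps / 4)) ^+ 2 <= N%:R ^+ 2 * y N by near: N; exact: h3.
  have s0 : 0 < Num.sqrt (y N) by rewrite sqrtr_gt0.
  have e4 : 0 < eps / 4 by lra.
  rewrite ler_pdivrMr// in t3.
  have t5 : 22 / (eps / 4) <= N%:R * Num.sqrt (y N).
    have p1 : 0 <= 22 / (eps / 4) by rewrite divr_ge0// ltW.
    have p2 : 0 <= N%:R * Num.sqrt (y N) by rewrite mulr_ge0// ltW.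
    have q : (22 / (eps / 4)) ^+ 2 <= (N%:R * Num.sqrt (y N)) ^+ 2.
      by rewrite [leRHS]exprMn sqr_sqrtr// ltW.
    by move: q; rewrite ler_pXn2r.
  have t6 : 22 / Num.sqrt (y N) <= eps / 4 * N%:R.
    by rewrite ler_pdivrMr//; rewrite ler_pdivrMr// in t5; lra.
  have t7 : 0 <= eps * N%:R by rewrite mulr_ge0// ltW.
  lra.
move=> eta0.
have [|n3 h3'] := nearP_nat (h2 ((eta / 11) ^+ 2) _); first by rewrite exprn_gt0// divr_gt0.
pose n0 := maxn n1 (maxn n2 n3).
have c1 n : (n0 <= n)%N -> 0 < y n <= 1.
  by move=> nn; have [-> _] := h1 n ltac:(nlia); apply: h2'; nlia.
have c2 n : (n0 <= n)%N -> y n.+1 <= y n by move=> nn; have [] := h1 n ltac:(nlia).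
have c3 n : (n0 <= n)%N -> 11 * Num.sqrt (y n) <= eta.
  move=> nn; rewrite mulrC -ler_pdivlMr//.
  have := h3' n ltac:(nlia); rewrite -/(y n) => h.
  rewrite -[leRHS]ger0_norm ?divr_ge0 ?(ltW eta0)// -sqrtr_sqr.
  by rewrite ler_wsqrtr.
exists n0 => N n0N.
have pi2 : 0 < 2 * pi :> R by have := pi_ge2 R; lra.
pose m := Num.floor ((X n0.+1 - X n0) / (2 * pi)).
have Tmon n n' : (n0 <= n)%N -> (n <= n')%N -> X n.+1 - X n <= X n'.+1 - X n'.
  move=> nn; elim: n' => [|n' IH']; first by rewrite leqn0 => /eqP->.
  rewrite leq_eqVlt => /orP[/eqP->//|nn'].
  by have := IH' nn'; have /andP[+ _] := c1 n' ltac:(nlia); rewrite yE; lra.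
have ml : m%:~R * (2 * pi) <= X n0.+1 - X n0 by rewrite -ler_pdivlMr// floor_le_tmp.
have mr : X n0.+1 - X n0 < (m + 1)%:~R * (2 * pi) by rewrite -ltr_pdivrMr// floorD1_gt.
have [|c [cb cl cr]] :=
    @monotone_split (fun n => (m + 1)%:~R * (2 * pi) <= X n.+1 - X n) n0 N n0N.
  by move=> n nn nN h; apply: le_trans h _; apply: Tmon; nlia.
apply: le_trans (cos_sum_turns yE c1 c2 c3 (ltnSn _) (leqnn n0) cb _ _ cr) _.
- move=> cn0; have [//|Nn0] := eqVneq n0 N.
  by have := cr n0 ltac:(nlia); rewrite leNgt mr.
- move=> n nc; rewrite ltNge cl// andbT.
  by apply: le_trans ml _; apply: Tmon; nlia.
- by rewrite lerD2r ler_wpM2l ?(ltW eta0)// ler_nat leq_subr.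
Unshelve. all: by end_near. Qed.

Lemma sum_shift_diff (F : nat -> R) (K : R) h N : (forall n, `|F n| <= K) ->
  `|\sum_(0 <= n < N) F (n + h)%N - \sum_(0 <= n < N) F n| <= 2 * K * h%:R.
Proof.
move=> FK; elim: h => [|h IH].
  under eq_bigr do rewrite addn0.
  by rewrite subrr normr0 mulr0.
have -> : \sum_(0 <= n < N) F (n + h.+1)%N =
    \sum_(0 <= n < N) F (n + h)%N + (F (N + h)%N - F h).
  rewrite -[F h]/(F (0 + h)%N) -(telescope_sumr (fun n => F (n + h)%N) (leq0n N)) -big_split/=.
  by apply: eq_bigr => n _; rewrite addnS addSn; ring.
have h1 := FK (N + h)%N; have h2 := FK h.
rewrite -natr1; move: IH h1 h2; rewrite !ler_norml; lra.
Qed.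

Lemma sum_sqr_le (F : nat -> R) N :
  (\sum_(0 <= n < N) F n) ^+ 2 <= N%:R * \sum_(0 <= n < N) F n ^+ 2.
Proof.
elim: N => [|N IH]; first by rewrite !big_geq// expr0n mul0r.
have [->|N0] := eqVneq N 0%N; first by rewrite !big_nat1 mul1r.
rewrite !big_nat_recr//=.
set S := \sum_(0 <= n < N) F n in IH *; set T := \sum_(0 <= n < N) _ in IH *.
have Np : 0 < N%:R :> R by rewrite ltr0n lt0n.
rewrite -natr1.
have : 0 <= (S - N%:R * F N) ^+ 2 / N%:R by rewrite divr_ge0 ?sqr_ge0// ltW.
rewrite (_ : _ / _ = S ^+ 2 / N%:R - 2 * S * F N + N%:R * F N ^+ 2); last by field; rewrite gt_eqF.
have : S ^+ 2 / N%:R <= T by rewrite ler_pdivrMr// mulrC.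
nra.
Qed.

(** With [Q = K |S| - 2 K ^ 2] the left side is the signed square [Q |Q|], so that no lower bound on
    [|S|] is assumed. Averaging over [K] shifts costs [2 K ^ 2]; after Cauchy-Schwarz, the squares
    of the sine sums are added so that the squares open into cosines of differences. *)
Lemma vdc_inequality X (K N : nat) :
  (K%:R * `|\sum_(0 <= n < N) cos (X n)| - 2 * K%:R ^+ 2) *
  `|K%:R * `|\sum_(0 <= n < N) cos (X n)| - 2 * K%:R ^+ 2| <=
  N%:R * \sum_(h < K) \sum_(h' < K) \sum_(0 <= n < N) cos (X (n + h)%N - X (n + h')%N).
Proof.
set S := \sum_(0 <= n < N) cos (X n).
pose A n := \sum_(h < K) cos (X (n + h)%N).
pose B n := \sum_(h < K) sin (X (n + h)%N).
have -> : \sum_(h < K) \sum_(h' < K) \sum_(0 <= n < N) cos (X (n + h)%N - X (n + h')%N)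
    = \sum_(0 <= n < N) (A n ^+ 2 + B n ^+ 2).
  under eq_bigr do rewrite exchange_big.
  rewrite exchange_big; apply: eq_bigr => n _.
  rewrite /A /B !expr2 !mulr_suml -big_split; apply: eq_bigr => h _ /=.
  rewrite !mulr_sumr -big_split; apply: eq_bigr => h' _ /=.
  exact: cosB.
have hA : `|\sum_(0 <= n < N) A n - K%:R * S| <= 2 * K%:R ^+ 2.
  rewrite /A exchange_big/= mulr_natl -[K in S *+ K]card_ord -sumr_const -sumrB.
  apply: le_trans (ler_norm_sum _ _ _) _.
  apply: (@le_trans _ _ (\sum_(h < K) 2 * K%:R)).
    apply: ler_sum => h _.
    apply: le_trans (@sum_shift_diff (fun n => cos (X n)) 1 h N _) _.
      by move=> n; exact: cos_max.
    by rewrite mulr1 ler_wpM2l// ler_nat ltnW.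
  by rewrite sumr_const card_ord -mulr_natr expr2; lra.
set T := \sum_(0 <= n < N) A n in hA.
have TT : T ^+ 2 <= N%:R * \sum_(0 <= n < N) (A n ^+ 2 + B n ^+ 2).
  apply: le_trans (sum_sqr_le _ _) _.
  rewrite ler_wpM2l// ler_sum// => n _.
  by rewrite lerDl sqr_ge0.
apply: le_trans TT.
have KS : K%:R * `|S| - 2 * K%:R ^+ 2 <= `|T|.
  rewrite -[K%:R * `|S|](_ : `|K%:R * S| = _); last by rewrite normrM normr_nat.
  have : `|K%:R * S| <= `|T| + `|T - K%:R * S|.
    rewrite -[X in `|X| <= _](_ : T - (T - K%:R * S) = _); last by ring.
    exact: ler_normB.
  lra.
set Q := K%:R * `|S| - 2 * K%:R ^+ 2 in KS *.
rewrite -(real_normK (num_real T)) expr2.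
have [Q0|Q0] := leP 0 Q; last first.
  apply: le_trans (_ : 0 <= _); last by rewrite mulr_ge0.
  by rewrite mulr_le0_ge0// ltW.
by rewrite (ger0_norm Q0) ler_pM.
Qed.

Lemma sum_const_ord (x : R) K : \sum_(h < K) x = K%:R * x.
Proof. by rewrite sumr_const card_ord mulr_natl. Qed.

Lemma vdc_principle X :
  (forall h h' : nat, (h < h')%N -> cos_avg0 (fun n => X (n + h')%N - X (n + h)%N)) ->
  cos_avg0 X.
Proof.
move=> hX eps eps0.
have [K hK] := nearP_nat (near_natr_ge (8 / eps ^+ 2)).
have K1 : exists K : nat, (0 < K)%N /\ 8 / eps ^+ 2 <= K%:R.
  by exists (maxn K 1); split; [lia|apply: hK; lia].
move: K1 => {K hK}[K [K0 hK]].
have Kp : 0 < K%:R :> R by rewrite ltr0n.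
have e2 : 0 < eps ^+ 2 by rewrite exprn_gt0.
(* If [|S| > eps N], the left side of [vdc_inequality] is at least [(K eps N / 2) ^ 2], while the
   diagonal and off-diagonal terms bound the right side by [(K N) ^ 2 (1 / K + eta)], with [1 / K +
   eta <= 3 eps ^ 2 / 16 < eps ^ 2 / 4]. *)
pose eta := eps ^+ 2 / 16.
have eta0 : 0 < eta by rewrite divr_gt0.
have off (h h' : 'I_K) : \forall N \near \oo, h != h' ->
    \sum_(0 <= n < N) cos (X (n + h)%N - X (n + h')%N) <= eta * N%:R.
  have [hh|hh|hh] := ltngtP h h'.
  - have := hX h h' hh eta eta0; apply: filterS => N /(le_trans (ler_norm _)) + _.
    by under eq_bigr do rewrite -cosN opprB.
  - have := hX h' h hh eta eta0; apply: filterS => N /(le_trans (ler_norm _)) + _ //.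
  - by apply: filterE => N; move/val_inj : hh => ->; rewrite eqxx.
have offall : \forall N \near \oo, forall h h' : 'I_K, h != h' ->
    \sum_(0 <= n < N) cos (X (n + h)%N - X (n + h')%N) <= eta * N%:R.
  by apply: filter_forall => h; apply: filter_forall => h'; exact: off.
near=> N.
have hoff : forall h h' : 'I_K, h != h' ->
    \sum_(0 <= n < N) cos (X (n + h)%N - X (n + h')%N) <= eta * N%:R.
  by near: N; exact: offall.
have hN : 4 * K%:R / eps <= N%:R by near: N; exact: near_natr_ge.
have Np : 1 <= N%:R :> R by near: N; exact: near_natr_ge.
have := vdc_inequality X K N.
set S := `|\sum_(0 <= n < N) cos (X n)|.
have -> : N%:R * \sum_(h < K) \sum_(h' < K) \sum_(0 <= n < N) cos (X (n + h)%N - X (n + h')%N)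
  = N%:R * \sum_(h < K) (N%:R + \sum_(h' < K | h' != h)
      \sum_(0 <= n < N) cos (X (n + h)%N - X (n + h')%N)).
  congr (_ * _); apply: eq_bigr => h _.
  rewrite (bigD1 h)//=; congr (_ + _).
  under eq_bigr do rewrite subrr cos0.
  by rewrite sumr_const_nat subn0.
have B : \sum_(h < K) (N%:R + \sum_(h' < K | h' != h)
      \sum_(0 <= n < N) cos (X (n + h)%N - X (n + h')%N))
  <= K%:R * (N%:R + K%:R * (eta * N%:R)).
  rewrite -sum_const_ord ler_sum// => h _.
  rewrite lerD2l.
  apply: (@le_trans _ _ (\sum_(h' < K | h' != h) eta * N%:R)).
    by apply: ler_sum => h' hh; apply: hoff; rewrite eq_sym.
  rewrite -sum_const_ord [leRHS](bigD1 h)//= lerDr mulr_ge0//; exact: ltW.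
move=> V.
have {}V : (K%:R * S - 2 * K%:R ^+ 2) * `|K%:R * S - 2 * K%:R ^+ 2| <=
   N%:R * (K%:R * (N%:R + K%:R * (eta * N%:R))).
  by apply: le_trans V _; rewrite ler_wpM2l.
rewrite leNgt; apply/negP => hS.
have Q : K%:R * eps * N%:R / 2 <= K%:R * S - 2 * K%:R ^+ 2.
  rewrite ler_pdivrMr// in hN.
  have : K%:R * (eps * N%:R) <= K%:R * S by rewrite ler_wpM2l ?ltW.
  have : K%:R * (4 * K%:R) <= K%:R * (N%:R * eps) by rewrite ler_pM2l.
  rewrite expr2; lra.
have Q0 : 0 <= K%:R * eps * N%:R / 2 by rewrite divr_ge0// mulr_ge0// mulr_ge0// ltW.
have {V} : (K%:R * eps * N%:R / 2) ^+ 2 <= N%:R * (K%:R * (N%:R + K%:R * (eta * N%:R))).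
  apply: le_trans V; rewrite ger0_norm; last by lra.
  by rewrite expr2 ler_pM.
rewrite (_ : N%:R * _ = (K%:R * N%:R) ^+ 2 * (1 / K%:R + eta)); last first.
  by field; rewrite gt_eqF.
rewrite (_ : _ ^+ 2 = (K%:R * N%:R) ^+ 2 * (eps ^+ 2 / 4)); last by field.
rewrite ler_pM2l; last by rewrite exprn_gt0// mulr_gt0//; lra.
suff : 1 / K%:R <= eps ^+ 2 / 8 by rewrite /eta; lra.
rewrite ler_pdivrMr// in hK; rewrite ler_pdivrMr//; lra.
Unshelve. all: by end_near. Qed.

Lemma iter_difB X Y j n :
  iter j dif (fun n => X n - Y n) n = iter j dif X n - iter j dif Y n.
Proof.
elim: j X Y n => // j IH X Y n; rewrite !iterSr -IH.
by congr (iter j dif _ n); apply/funext => m; rewrite /dif; ring.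
Qed.

Lemma iter_dif_shift X j h n :
  iter j dif (fun n => X (n + h)%N) n = iter j dif X (n + h)%N.
Proof. by elim: j n => // j IH n; rewrite /= /dif !IH addSn. Qed.

(** The [j]-th difference of [X (n + h') - X (n + h)] is a sum of [h' - h] values of the
    [(j + 1)]-st difference of [X], so all three conditions pass on, with the same weight
    [n ^ p]. *)
Lemma vdc_class_shift X p j h h' : (0 < p)%N -> (h < h')%N -> vdc_class p j.+1 X ->
  vdc_class p j (fun n => X (n + h')%N - X (n + h)%N).
Proof.
move=> p0 hh [/nearP_nat[n1 h1] h2 h3].
pose y n := iter j.+1 dif X n.
have E n : iter j dif (fun n => X (n + h')%N - X (n + h)%N) n
    = \sum_(h <= s < h') y (n + s)%N.
  rewrite iter_difB !iter_dif_shift.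
  rewrite -(telescope_sumr (fun s => iter j dif X (n + s)%N))//; last by lia.
  by apply: eq_bigr => s _; rewrite /y iterS /dif addnS.
have ymon n n' : (n1 <= n)%N -> (n <= n')%N -> y n' <= y n.
  move=> nn; elim: n' => [|n' IH]; first by rewrite leqn0 => /eqP->.
  rewrite leq_eqVlt => /orP[/eqP->//|nn'].
  by apply: le_trans (IH _); [have [] := h1 n' ltac:(nlia)|nlia].
have y0 n : (n1 <= n)%N -> 0 < y n by move=> /h1[].
have low n : (n1 <= n)%N -> y (n + h)%N <= \sum_(h <= s < h') y (n + s)%N.
  move=> nn; rewrite big_ltn// lerDl sumr_ge0// => s _.
  by apply/ltW/y0; nlia.
split.
- apply: (near_natP (n0 := n1)) => n nn; rewrite !E; split.
    by apply: lt_le_trans (low n nn); apply: y0; nlia.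
  by apply: ler_sum_nat => s _; apply: ymon; nlia.
- move=> eps eps0.
  have e' : 0 < eps / (h' - h)%:R by rewrite divr_gt0// ltr0n subn_gt0.
  have [n2 h2'] := nearP_nat (h2 _ e').
  apply: (near_natP (n0 := n2)) => n nn; rewrite E.
  apply: (@le_trans _ _ (\sum_(h <= s < h') (eps / (h' - h)%:R))).
    by apply: ler_sum_nat => s _; apply: h2'; nlia.
  by rewrite sumr_const_nat -[X in X <= _]mulr_natr divfK// pnatr_eq0 -lt0n subn_gt0.
- move=> M; have [n3 h3'] := nearP_nat (h3 (2 ^+ p * `|M|)).
  apply: (near_natP (n0 := maxn n1 (maxn n3 (maxn h 1)))) => n nn; rewrite E.
  have a1 := h3' (n + h)%N ltac:(nlia); rewrite -/(y _) in a1.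
  have a2 := low n ltac:(nlia).
  have a3 := y0 (n + h)%N ltac:(nlia).
  have a4 : (n + h)%:R ^+ p <= 2 ^+ p * n%:R ^+ p :> R.
    rewrite -exprMn; apply: lerXn2r; rewrite ?nnegrE ?mulr_ge0//.
    by rewrite -natrM ler_nat; nlia.
  have a5 : 2 ^+ p * `|M| <= 2 ^+ p * (n%:R ^+ p * y (n + h)%N).
    by apply: le_trans a1 _; rewrite mulrA ler_wpM2r// ltW.
  rewrite ler_pM2l in a5; last by rewrite exprn_gt0.
  apply: le_trans (ler_norm _) _; apply: le_trans a5 _.
  by rewrite ler_wpM2l// exprn_ge0.
Qed.

Lemma vdc_class_cos_avg0 X j : vdc_class 2 j.+2 X -> cos_avg0 X.
Proof.
elim: j X => [|j IH] X hX; first exact: second_difference_criterion.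
by apply: vdc_principle => h h' hh; apply: IH; apply: vdc_class_shift.
Qed.

End WeylSums.

(** * Hardy fields *)

Definition der (R : realType) (phi : R -> R) : R -> R := derive1 phi.

Section HardyGrowth.
Variable R : realType.
Implicit Types (g phi psi u w : R -> R).

Lemma near_pinftyP (P : R -> Prop) : (\forall t \near +oo_R, P t) ->
  exists2 A : R, 1 <= A & forall t, A <= t -> P t.
Proof.
move=> [A [_ h]]; exists (Num.max 1 (A + 1)); first by rewrite le_max lexx.
by move=> t; rewrite ge_max => /andP[_ At]; apply: h; lra.
Qed.

Lemma near_pinfty_ge (A : R) : \forall t \near +oo_R, A <= t.
Proof. by apply: nbhs_pinfty_ge; exact: num_real. Qed.

Lemma pinftyP_near (P : R -> Prop) (A : R) : (forall t, A <= t -> P t) ->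
  \forall t \near +oo_R, P t.
Proof. by move=> h; apply: filterS (near_pinfty_ge A). Qed.

Lemma growth_ltP phi psi : growth_lt phi psi <->
  forall A : R, \forall t \near +oo_R, A <= psi t / phi t.
Proof. by split => [/cvgryPge//|h]; exact/cvgryPge. Qed.

Lemma derive1_is_derive phi t : derivable phi t 1 -> is_derive t 1 phi (der phi t).
Proof. by move=> h; rewrite /der derive1E; exact: derivableP. Qed.

Lemma is_derive_powS (c : R) r (t : R) :
  is_derive t (1 : R) (fun t : R => c * t ^+ r.+1) (c * r.+1%:R * t ^+ r).
Proof.
have := @is_deriveZ R R^o R^o _ c t 1 _ (@is_deriveX R R^o id r.+1 t 1 1 (is_derive_id _ _)).
rewrite exprfctE => h; apply: is_derive_eq h _.
by rewrite /= /GRing.scale/= mulr1 mulrA.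
Qed.

Lemma is_derive_mvt phi dphi (A s t : R) : A <= s -> s < t ->
  (forall x, A <= x -> is_derive x 1 phi (dphi x)) ->
  exists2 c, s < c < t & phi t - phi s = dphi c * (t - s).
Proof.
move=> As st h.
have [||c] := @MVT R phi dphi s t st.
- by move=> x; rewrite in_itv/= => /andP[sx xt]; apply: h; lra.
- apply: derivable_within_continuous => x; rewrite in_itv/= => /andP[sx xt].
  by have := h x (le_trans As sx) => -[].
- by rewrite in_itv/= => cst E; exists c.
Qed.

Lemma is_derive_compare_itv phi dphi psi dpsi (s t : R) : s <= t ->
  (forall x, s <= x <= t -> is_derive x (1 : R) phi (dphi x)) ->
  (forall x, s <= x <= t -> is_derive x (1 : R) psi (dpsi x)) ->
  (forall x, s <= x <= t -> dphi x <= dpsi x) ->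
  phi t - phi s <= psi t - psi s.
Proof.
rewrite le_eqVlt => /orP[/eqP-> *|st h1 h2 h3]; first by rewrite !subrr.
have d x : s <= x <= t -> is_derive x (1 : R) (psi \- phi) (dpsi x - dphi x).
  by move=> xs; exact: is_deriveB (h2 x xs) (h1 x xs).
have [||c] := @MVT R (psi \- phi) (fun x => dpsi x - dphi x) s t st.
- by move=> x; rewrite in_itv/= => /andP[? ?]; apply: d; rewrite !ltW.
- apply: derivable_within_continuous => x; rewrite in_itv/= => xs.
  by have := d x xs => -[].
rewrite in_itv/= => /andP[sc ct] E.
rewrite -subr_ge0 (_ : _ - _ = (psi \- phi) t - (psi \- phi) s); last by rewrite /=; ring.
by rewrite E mulr_ge0 ?subr_ge0 ?(ltW st)//; apply: h3; rewrite !ltW.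
Qed.

Lemma is_derive_compare phi dphi psi dpsi (A : R) :
  (forall x, A <= x -> is_derive x 1 phi (dphi x)) ->
  (forall x, A <= x -> is_derive x 1 psi (dpsi x)) ->
  (forall x, A <= x -> dphi x <= dpsi x) ->
  forall s t, A <= s -> s <= t -> phi t - phi s <= psi t - psi s.
Proof.
move=> h1 h2 h3 s t As st.
apply: is_derive_compare_itv st _ _ _ => x /andP[/(le_trans As) Ax _]; first exact: h1.
  exact: h2.
exact: h3.
Qed.

Lemma near_pow_ge (c M : R) r : 0 < c -> \forall t \near +oo_R, M <= c * t ^+ r.+1.
Proof.
move=> c0; near=> t.
have t1 : 1 <= t by near: t; exact: near_pinfty_ge.
have tM : `|M| / c <= t by near: t; exact: near_pinfty_ge.
apply: le_trans (ler_norm _) _; rewrite mulrC -ler_pdivrMr//.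
apply: le_trans tM _; rewrite exprS ler_peMr ?exprn_ege1//; lra.
Unshelve. all: by end_near. Qed.

(** When the bound is integrated, half of the leading coefficient absorbs the constant of
    integration. *)
Lemma deriv_lower phi (c : R) (r : nat) : 0 < c ->
  (\forall t \near +oo_R, derivable phi t 1) ->
  (\forall t \near +oo_R, c * t ^+ r <= der phi t) ->
  exists2 c', 0 < c' & \forall t \near +oo_R, c' * t ^+ r.+1 <= phi t.
Proof.
move=> c0 d h.
have [A A1 hA] := near_pinftyP (filterI d h).
pose b := c / r.+1%:R; have b0 : 0 < b by rewrite divr_gt0.
exists (b / 2); first by rewrite divr_gt0.
have b20 : 0 < b / 2 by lra.
near=> t.
have At : A <= t by near: t; exact: near_pinfty_ge.
have := @is_derive_compare (fun t => b * t ^+ r.+1) (fun t => b * r.+1%:R * t ^+ r)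
   phi (der phi) A _ _ _ A t (lexx _) At.
move=> /(_ _ _ _)H; have {H} : b * t ^+ r.+1 - b * A ^+ r.+1 <= phi t - phi A.
  apply: H.
  - by move=> x _; exact: is_derive_powS.
  - by move=> x /hA[dx _]; exact: derive1_is_derive.
  - by move=> x /hA[_]; rewrite /b divfK// pnatr_eq0.
have : b * A ^+ r.+1 - phi A <= b / 2 * t ^+ r.+1 by near: t; exact: near_pow_ge.
lra.
Unshelve. all: by end_near. Qed.

Lemma deriv_upper phi (c : R) (r : nat) : 0 < c ->
  (\forall t \near +oo_R, derivable phi t 1) ->
  (\forall t \near +oo_R, der phi t <= c * t ^+ r) ->
  \forall t \near +oo_R, phi t <= 2 * c * t ^+ r.+1.
Proof.
move=> c0 d h.
have [A A1 hA] := near_pinftyP (filterI d h).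
pose b := c / r.+1%:R; have b0 : 0 < b by rewrite divr_gt0.
have bc : b <= c by rewrite ler_pdivrMr// ler_peMr ?(ltW c0)// ler1n.
near=> t.
have At : A <= t by near: t; exact: near_pinfty_ge.
have := @is_derive_compare phi (der phi) (fun t => b * t ^+ r.+1) (fun t => b * r.+1%:R * t ^+ r)
   A _ _ _ A t (lexx _) At.
move=> /(_ _ _ _)H; have {H} : phi t - phi A <= b * t ^+ r.+1 - b * A ^+ r.+1.
  apply: H.
  - by move=> x /hA[dx _]; exact: derive1_is_derive.
  - by move=> x _; exact: is_derive_powS.
  - by move=> x /hA[_]; rewrite /b divfK// pnatr_eq0.
have : phi A <= c * t ^+ r.+1 by near: t; exact: near_pow_ge.
have : 0 <= b * A ^+ r.+1 by rewrite mulr_ge0 ?exprn_ge0//; lra.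
have : b * t ^+ r.+1 <= c * t ^+ r.+1 by rewrite ler_wpM2r// exprn_ge0//; lra.
lra.
Unshelve. all: by end_near. Qed.

Variables (H : set (R -> R)) (hH : hardy_field H).

Lemma hardy_cst0 : H (fun=> 0).
Proof.
have := hardy_sub hH (hardy_one hH) (hardy_one hH).
by rewrite (_ : (fun=> _) = (fun=> 0))//; apply/funext => t; rewrite subrr.
Qed.

Lemma hardy_opp phi : H phi -> H (fun t => - phi t).
Proof.
move=> /(hardy_sub hH hardy_cst0).
by rewrite (_ : (fun t => 0 - phi t) = (fun t => - phi t))//; apply/funext => t; rewrite sub0r.
Qed.

Lemma hardy_add phi psi : H phi -> H psi -> H (fun t => phi t + psi t).
Proof.
move=> h1 /hardy_opp /(hardy_sub hH h1).
rewrite (_ : (fun t => phi t - - psi t) = (fun t => phi t + psi t))//.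
by apply/funext => t; rewrite opprK.
Qed.

Lemma hardy_natr n : H (fun=> n%:R).
Proof.
elim: n => [|n IH]; first exact: hardy_cst0.
have := hardy_add IH (hardy_one hH).
by rewrite (_ : (fun=> _ + _) = (fun=> n.+1%:R))//; apply/funext => t; rewrite natr1.
Qed.

Lemma hardy_intr (m : int) : H (fun=> m%:~R).
Proof.
case: m => n; first exact: hardy_natr.
have := hardy_opp (hardy_natr n.+1).
by rewrite (_ : (fun=> - _) = (fun=> (Negz n)%:~R))//; apply/funext => t; rewrite NegzE mulrNz.
Qed.

Lemma germ_eq_cst (a b : R) : germ_eq (fun=> a) (fun=> b) -> a = b.
Proof. by move=> /near_pinftyP[A _] /(_ A (lexx _)). Qed.

Lemma hardy_natV n : H (fun=> n.+1%:R^-1).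
Proof.
have [|g Hg E] := hardy_inv hH (hardy_natr n.+1).
  by move=> /germ_eq_cst/eqP; rewrite pnatr_eq0.
apply: (hardy_germ hH _ Hg); apply: filterS E => t /(congr1 (fun x => n.+1%:R^-1 * x)).
by rewrite mulr1 mulrA mulVf ?mul1r// pnatr_eq0.
Qed.

Lemma hardy_derivable phi : H phi -> \forall t \near +oo_R, derivable phi t 1.
Proof. by move=> /(hardy_deriv hH)[]. Qed.

Lemma hardy_derive1 phi : H phi -> H (der phi).
Proof. by move=> /(hardy_deriv hH)[]. Qed.

Lemma hardy_iter_derive phi r : H phi -> H (iter r (@der R) phi).
Proof. by elim: r => //= r IH /IH /hardy_derive1. Qed.

(** A nonzero germ is invertible, hence has no zeros near infinity, and the intermediate value
    theorem then fixes its sign. *)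
Lemma hardy_sign phi : H phi -> [\/ \forall t \near +oo_R, phi t = 0,
  \forall t \near +oo_R, 0 < phi t | \forall t \near +oo_R, phi t < 0].
Proof.
move=> Hphi; have [E|nE] := pselect (germ_eq phi (fun=> 0)); first by constructor 1.
have [g Hg E] := hardy_inv hH Hphi nE.
have [A A1 hA] := near_pinftyP (filterI (hardy_derivable Hphi) E).
have nz t : A <= t -> phi t != 0.
  move=> /hA[_ e]; apply/eqP => p0.
  by move: e; rewrite p0 mul0r => /esym/eqP; rewrite oner_eq0.
have ivt t : A <= t -> Num.min (phi A) (phi t) <= 0 <= Num.max (phi A) (phi t) -> False.
  move=> At h; have [|c] := IVT At _ h.
    apply: derivable_within_continuous => x; rewrite in_itv/= => /andP[Ax _].
    by have [] := hA x Ax.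
  by rewrite in_itv/= => /andP[Ac _] /eqP; rewrite (negbTE (nz c Ac)).
have [pA|pA|pA] := ltgtP 0 (phi A).
- constructor 2; apply: (pinftyP_near (A := A)) => t At.
  rewrite ltNge; apply/negP => h; apply: (ivt t At).
  by rewrite ge_min le_max h (ltW pA) orbT.
- constructor 3; apply: (pinftyP_near (A := A)) => t At.
  rewrite ltNge; apply/negP => h; apply: (ivt t At).
  by rewrite ge_min le_max h (ltW pA) orbT.
- by have := nz A (lexx _); rewrite -pA eqxx.
Qed.

Lemma hardy_cmp phi psi : H phi -> H psi ->
  (\forall t \near +oo_R, phi t < psi t) \/ (\forall t \near +oo_R, psi t <= phi t).
Proof.
move=> h1 h2; have [] := hardy_sign (hardy_sub hH h1 h2) => h.
- by right; apply: filterS h => t /eqP; rewrite subr_eq0 => /eqP->.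
- by right; apply: filterS h => t; rewrite subr_gt0 => /ltW.
- by left; apply: filterS h => t; rewrite subr_lt0.
Qed.

(* If [f >= c] fails eventually for every positive constant of [H], then
   [limsup f <= 0]; only rational constants are known to be in [H]. *)
Lemma hardy_small phi : H phi ->
  (forall c : R, 0 < c -> ~ \forall t \near +oo_R, c <= phi t) ->
  forall eps : R, 0 < eps -> \forall t \near +oo_R, phi t <= eps.
Proof.
move=> Hphi h eps eps0.
pose n := Num.truncn eps^-1.
have hn : n.+1%:R^-1 <= eps.
  rewrite -[leRHS]invrK lef_pV2 ?posrE ?invr_gt0//.
  by apply: ltW; exact: truncnS_gt.
have [h1|h1] := hardy_cmp Hphi (hardy_natV n).
  by apply: filterS h1 => t /ltW/le_trans; apply.
by exfalso; apply: h h1; rewrite invr_gt0.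
Qed.

(** Counterpart of [hardy_small], with integers as the test constants. *)
Lemma hardy_large phi : H phi ->
  (forall c : R, 0 < c -> ~ \forall t \near +oo_R, phi t <= c) ->
  forall M : R, \forall t \near +oo_R, M <= phi t.
Proof.
move=> Hphi h M; pose n := (Num.truncn M).+1.
have Mn : M <= n%:R by apply: ltW; exact: truncnS_gt.
have [h1|h1] := hardy_cmp Hphi (hardy_natr n).
  by exfalso; apply: (h n%:R) => //; apply: filterS h1 => t /ltW.
by apply: filterS h1 => t; exact: le_trans.
Qed.

Lemma hardy_iter_lower phi (c : R) r : H phi -> 0 < c ->
  (\forall t \near +oo_R, c <= iter r (@der R) phi t) ->
  exists2 c', 0 < c' & \forall t \near +oo_R, c' * t ^+ r <= phi t.
Proof.
elim: r phi => [|r IH] phi Hphi c0.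
  by exists c => //; under eq_near do rewrite expr0 mulr1.
rewrite iterSr => /(IH _ (hardy_derive1 Hphi) c0)[c' c'0 h].
exact: deriv_lower c'0 (hardy_derivable Hphi) h.
Qed.

Lemma hardy_iter_upper phi (c : R) r : H phi -> 0 < c ->
  (\forall t \near +oo_R, iter r (@der R) phi t <= c) ->
  \forall t \near +oo_R, phi t <= 2 ^+ r * c * t ^+ r.
Proof.
elim: r phi => [|r IH] phi Hphi c0.
  by move=> h; apply: filterS h => t /=; rewrite expr0 mulr1 mul1r.
rewrite iterSr => /(IH _ (hardy_derive1 Hphi) c0).
move=> /(deriv_upper (mulr_gt0 (exprn_gt0 r (ltr0Sn R 1)) c0) (hardy_derivable Hphi)).
by under eq_near do rewrite mulrA -exprS.
Qed.

(** Otherwise the derivative is eventually positive and [phi] stays above some [phi A > 0]. *)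
Lemma hardy_nonincr phi : H phi -> (\forall t \near +oo_R, 0 < phi t) ->
  (forall eps : R, 0 < eps -> \forall t \near +oo_R, phi t <= eps) ->
  \forall t \near +oo_R, der phi t <= 0.
Proof.
move=> Hphi p0 ps.
have [h|h] := hardy_cmp (hardy_derive1 Hphi) hardy_cst0; first by apply: filterS h => t /ltW.
have [A A1 hA] := near_pinftyP (filterI p0 (filterI h (hardy_derivable Hphi))).
have pA : 0 < phi A by have [] := hA A (lexx _).
have e2 : 0 < phi A / 2 by lra.
have [B B1 hB] := near_pinftyP (ps _ e2).
set t := Num.max A B; have At : A <= t by rewrite le_max lexx.
have := @is_derive_compare (cst 0) (cst 0) phi (der phi) A _ _ _ A t (lexx _) At.
move=> /(_ _ _ _)K; have {K} : cst 0 t - cst 0 A <= phi t - phi A.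
  apply: K => //; first by move=> x /hA[_ [_ dx]]; exact: derive1_is_derive.
  by move=> x /hA[_ [? _]].
have := hB t; rewrite le_max lexx orbT => /(_ isT); rewrite /=; lra.
Qed.

Lemma hardy_inv_pos phi : H phi -> (\forall t \near +oo_R, 0 < phi t) ->
  exists2 v, H v & \forall t \near +oo_R, 0 < v t /\ v t = (phi t)^-1.
Proof.
move=> Hphi p0.
have [|v Hv E] := hardy_inv hH Hphi.
  move=> e; have [A A1 /(_ A (lexx _))[p e0]] := near_pinftyP (filterI p0 e).
  by rewrite e0 ltxx in p.
exists v => //; apply: filterS (filterI p0 E) => t [p e].
have -> : v t = (phi t)^-1.
  by rewrite -[LHS]mul1r -(mulVf (lt0r_neq0 p)) -mulrA e mulr1.
by rewrite invr_gt0.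
Qed.

(* [Psi] is a primitive of [t ^- p]; the reciprocal [v] of [u'] satisfies
   [v^(p) <= c] eventually for every [c], otherwise [u' = O(Psi')]. *)
Lemma hardy_deriv_lower u (p : nat) (Psi : R -> R) : H u ->
  (forall t : R, 1 <= t -> is_derive t (1 : R) Psi (t ^- p)) ->
  (\forall t \near +oo_R, - 2^-1 <= Psi t) ->
  (forall C : R, \forall t \near +oo_R, C * Psi t + C <= u t) ->
  (\forall t \near +oo_R, 0 < der u t) ->
  forall M : R, \forall t \near +oo_R, M <= t ^+ p * der u t.
Proof.
move=> Hu dPsi Psi0 uPsi u0 M.
have [v Hv vE] := hardy_inv_pos (hardy_derive1 Hu) u0.
have small (eps : R) : 0 < eps -> \forall t \near +oo_R, iter p (@der R) v t <= eps.
  apply: hardy_small; first exact: hardy_iter_derive.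
  move=> c c0 /(hardy_iter_lower Hv c0)[c' c'0 low].
  have [A A1 hA] := near_pinftyP (filterI vE (filterI low (filterI u0 (hardy_derivable Hu)))).
  have cmp t : A <= t -> u t - u A <= c'^-1 * Psi t - c'^-1 * Psi A.
    move=> At.
    apply: (@is_derive_compare u (der u) (fun t => c'^-1 * Psi t)
      (fun t => c'^-1 * t ^- p) A) => //.
    - by move=> x /hA[_ [_ [_ dx]]]; exact: derive1_is_derive.
    - by move=> x Ax; apply: is_deriveZ; apply: dPsi; exact: le_trans Ax.
    - move=> x Ax; have [[v0 ve] [lo [up _]]] := hA x Ax.
      have xp : 0 < x ^+ p by rewrite exprn_gt0//; lra.
      rewrite -invfM -[leLHS]invrK -ve lef_pV2 ?posrE// ?mulr_gt0//.
  (* Here [u <= a (Psi + 1) + (b - a)]. As [Psi + 1 >= 1 / 2], this contradicts [u >= C (Psi + 1)]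
     for [C = a + 2 |b - a| + 2]. *)
  pose a := c'^-1; pose b := u A - a * Psi A.
  have [B B1 hB] := near_pinftyP (filterI Psi0 (uPsi (a + 2 * `|b - a| + 2))).
  pose t := Num.max A B.
  have [|h1 h2] := hB t _; first by rewrite le_max lexx orbT.
  have h3 := cmp t; rewrite le_max lexx in h3; have {}h3 := h3 isT.
  have h4 : u t <= a * Psi t + b by move: h3; rewrite -/a /b; lra.
  have h5 : (2 * `|b - a| + 2) * 2^-1 <= (2 * `|b - a| + 2) * (Psi t + 1).
    by apply: ler_wpM2l; [rewrite addr_ge0// mulr_ge0|lra].
  have := ler_norm (b - a); lra.
pose eps := (2 ^+ p * (`|M| + 1))^-1.
have M0 : 0 < `|M| + 1 by rewrite ltr_wpDl.
have p20 : 0 < 2 ^+ p :> R by rewrite exprn_gt0.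
have eps0 : 0 < eps by rewrite invr_gt0 mulr_gt0.
have up := hardy_iter_upper Hv eps0 (small eps eps0).
near=> t.
have [v0 ve] : 0 < v t /\ v t = (der u t)^-1 by near: t.
have vu : v t <= 2 ^+ p * eps * t ^+ p by near: t.
have u0' : 0 < der u t by near: t.
have e : 2 ^+ p * eps = (`|M| + 1)^-1 by rewrite /eps invfM mulrA mulfV ?mul1r// gt_eqF.
apply: le_trans (ler_norm _) _; apply: (@le_trans _ _ (`|M| + 1)); first by rewrite lerDl.
rewrite e ve mulrC ler_pdivlMr// in vu.
by rewrite mulrC ler_pdivrMr// in vu.
Unshelve. all: by end_near. Qed.

(** Used with [Psi = ln], [p = 1] and with [Psi = - 1 / t], [p = 2]. The bounds by [C * Psi t + C]
    say that [g^(j)] dominates [ln t] in the first case, and only that it tends to infinity in the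
    second. Then [w > 0], or [g^(j)] would be bounded above, and [w -> 0], or [g] would eventually
    exceed a fixed multiple of [t ^ j.+1]. *)
Lemma hardy_top_derivative g j p (Psi : R -> R) : H g ->
  (forall c : R, 0 < c -> \forall t \near +oo_R, g t <= c * t ^+ j.+1) ->
  (forall t : R, 1 <= t -> is_derive t (1 : R) Psi (t ^- p)) ->
  (\forall t \near +oo_R, - 2^-1 <= Psi t) ->
  (forall C : R, \forall t \near +oo_R, C * Psi t + C <= iter j (@der R) g t) ->
  let w := iter j.+1 (@der R) g in
  [/\ \forall t \near +oo_R, 0 < w t, \forall t \near +oo_R, der w t <= 0,
      (forall eps : R, 0 < eps -> \forall t \near +oo_R, w t <= eps) &
      (forall M : R, \forall t \near +oo_R, M <= t ^+ p * w t)].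
Proof.
move=> Hg up dPsi Psi0 uPsi w.
pose u := iter j (@der R) g.
have Hu : H u by exact: hardy_iter_derive.
have Hw : H w by exact: hardy_iter_derive.
have uoo (M : R) : \forall t \near +oo_R, M <= u t.
  apply: filterS (filterI Psi0 (uPsi (2 * `|M|))) => t [p0 pu].
  have : 2 * `|M| * 2^-1 <= 2 * `|M| * (Psi t + 1) by rewrite ler_wpM2l// ?mulr_ge0//; lra.
  have := ler_norm M; rewrite -/(u t) in pu; lra.
have ws (eps : R) : 0 < eps -> \forall t \near +oo_R, w t <= eps.
  apply: hardy_small => // c c0 /(hardy_iter_lower Hg c0)[c' c'0 low].
  have c2 : 0 < c' / 2 by lra.
  have [A A1 hA] := near_pinftyP (filterI low (up _ c2)).
  have [l1 l2] := hA A (lexx _).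
  have : 0 < c' * A ^+ j.+1 by rewrite mulr_gt0// exprn_gt0//; lra.
  lra.
have w0 : \forall t \near +oo_R, 0 < w t.
  have [h|h] := hardy_cmp hardy_cst0 Hw => //.
  have [A A1 hA] := near_pinftyP (filterI h (hardy_derivable Hu)).
  have [B B1 hB] := near_pinftyP (uoo (u A + 1)).
  pose t := Num.max A B; have At : A <= t by rewrite le_max lexx.
  have := @is_derive_compare u (der u) (cst 0) (cst 0) A _ _ _ A t (lexx _) At.
  move=> /(_ _ _)K; have {K} : u t - u A <= cst 0 t - cst 0 A :> R.
    apply: K => //; first by move=> x /hA[_ dx]; exact: derive1_is_derive.
    by move=> x /hA[].
  have := hB t; rewrite le_max lexx orbT => /(_ isT); rewrite /=; lra.
split=> //; first exact: hardy_nonincr.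
exact: (hardy_deriv_lower Hu dPsi Psi0 uPsi).
Qed.

End HardyGrowth.

(** * Finite differences of sampled functions *)

Section FiniteDifferences.
Variable R : realType.
Implicit Types (g : R -> R).

Definition fdif (d : R) g t := g (t + d) - g t.

Lemma is_derive_translate (g : R -> R) (d x dg : R) :
  is_derive (x + d) (1 : R) g dg -> is_derive x (1 : R) (fun t => g (t + d)) dg.
Proof.
move=> h.
have sh : is_derive x (1 : R) (fun t : R => t + d) 1.
  have := @is_deriveD R R^o R^o id (cst d) x 1 1 0 (is_derive_id _ _) (is_derive_cst _ _ _).
  by rewrite addr0.
by have := @is_derive1_comp R g (fun t => t + d) x dg 1 h sh; rewrite mulr1.
Qed.

Lemma iter_fdif_mvt (F : nat -> R -> R) (A d : R) j : 0 < d ->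
  (forall r x, (r < j)%N -> A <= x -> is_derive x (1 : R) (F r) (F r.+1 x)) ->
  forall t, A <= t -> exists2 xi, t <= xi <= t + j%:R * d &
    iter j (fdif d) (F 0%N) t = d ^+ j * F j xi.
Proof.
move=> d0; elim: j F => [|j IH] F dF t At.
  by exists t; rewrite ?mul0r ?addr0 ?lexx// expr0 mul1r.
rewrite iterSr.
have [|xi /andP[x1 x2] E] := IH (fun r => fdif d (F r)) _ t At.
  move=> r x rj Ax; rewrite /fdif.
  apply: (@is_deriveB R R^o R^o (fun t => F r (t + d)) (F r)).
    by apply: is_derive_translate; apply: dF; [lia|lra].
  by apply: dF => //; lia.
rewrite {}E /fdif.
have [|||xi' /andP[y1 y2] E] := @is_derive_mvt R (F j) (F j.+1) A xi (xi + d).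
- by lra.
- by lra.
- by move=> x; apply: dF.
exists xi'; first by rewrite -natr1; apply/andP; split; lra.
by rewrite E addrAC subrr add0r exprS; ring.
Qed.

Lemma iter_dif_fdif g d j n :
  iter j (@dif R) (fun n => g (d * n%:R)) n = iter j (fdif d) g (d * n%:R).
Proof.
elim: j g n => // j IH g n; rewrite !iterSr -IH.
congr (iter j _ _ n); apply/funext => m.
by rewrite /dif /fdif -natr1 mulrDr mulr1.
Qed.

Lemma iter_dif_affine (X : nat -> R) (s b : R) j n :
  iter j.+1 (@dif R) (fun n => s * X n + b) n = s * iter j.+1 (@dif R) X n.
Proof.
have sc (Y : nat -> R) i m : iter i (@dif R) (fun n => s * Y n) m = s * iter i (@dif R) Y m.
  elim: i m => // i IH m; rewrite /= /dif !IH; ring.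
rewrite !iterSr -sc; congr (iter j _ _ n); apply/funext => m.
by rewrite /dif; ring.
Qed.

Lemma near_nat_pinfty (P : R -> Prop) (d : R) : 0 < d -> (\forall t \near +oo_R, P t) ->
  \forall n \near \oo, forall x, d * n%:R <= x -> P x.
Proof.
move=> d0 /near_pinftyP[A A1 hA].
apply: filterS (near_natr_ge (A / d)) => n; rewrite ler_pdivrMr// mulrC => h x hx.
by apply: hA; exact: le_trans hx.
Qed.

(** Differences of order [j + 1] and [j + 2] of the samples are, up to a positive factor, values of
    [w] and of [der w] at intermediate points: the former give sign, smallness and growth, the
    latter monotonicity. The intermediate point is at most [2 d n], hence the factor [(2 d) ^ p] in
    the last part. *)
Lemma sample_vdc_class g j p (d s b : R) : 0 < d -> 0 < s ->
  (forall r, \forall t \near +oo_R, derivable (iter r (@der R) g) t 1) ->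
  let w := iter j.+1 (@der R) g in
  (\forall t \near +oo_R, 0 < w t) -> (\forall t \near +oo_R, der w t <= 0) ->
  (forall eps : R, 0 < eps -> \forall t \near +oo_R, w t <= eps) ->
  (forall M : R, \forall t \near +oo_R, M <= t ^+ p * w t) ->
  vdc_class p j.+1 (fun n => s * g (d * n%:R) + b).
Proof.
move=> d0 s0 dg w w0 dw we wM.
have [A A1 hA] : exists2 A : R, 1 <= A & forall t, A <= t ->
    forall r : 'I_j.+2, derivable (iter r (@der R) g) t 1.
  by apply: near_pinftyP; apply: filter_forall => r; exact: dg.
have mvt i n : (i <= j.+2)%N -> A <= d * n%:R -> exists2 xi,
    d * n%:R <= xi <= d * n%:R + i%:R * d &
    iter i (@dif R) (fun n => g (d * n%:R)) n = d ^+ i * iter i (@der R) g xi.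
  move=> ij An; rewrite iter_dif_fdif.
  apply: (@iter_fdif_mvt (fun r => iter r (@der R) g) A d i) => // r x ri Ax.
  apply: derive1_is_derive; exact: (hA x Ax (Ordinal (leq_trans ri ij))).
have nearA := near_nat_pinfty d0 (near_pinfty_ge A).
have sd0 : 0 < s * d ^+ j.+1 by rewrite mulr_gt0// exprn_gt0.
split.
- near=> n.
  have An : A <= d * n%:R.
    have h : forall x, d * n%:R <= x -> A <= x by near: n; exact: nearA.
    exact: h.
  have p0 : forall x, d * n%:R <= x -> 0 < w x by near: n; exact: near_nat_pinfty.
  have p1 : forall x, d * n%:R <= x -> der w x <= 0 by near: n; exact: near_nat_pinfty.
  split.
    rewrite iter_dif_affine; have [xi /andP[x1 x2] ->] := mvt j.+1 n (leqnSn _) An.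
    by rewrite mulrA mulr_gt0// p0.
  rewrite -subr_le0.
  rewrite -[_ - _]/(iter j.+2 (@dif R) (fun n => s * g (d * n%:R) + b) n).
  rewrite iter_dif_affine; have [xi /andP[x1 x2] ->] := mvt j.+2 n (leqnn _) An.
  by rewrite mulrA mulr_ge0_le0// ?p1// mulr_ge0 ?exprn_ge0// ltW.
- move=> eps eps0; have e' : 0 < eps / (s * d ^+ j.+1) by rewrite divr_gt0.
  near=> n.
  have An : A <= d * n%:R.
    have h : forall x, d * n%:R <= x -> A <= x by near: n; exact: nearA.
    exact: h.
  have p0 : forall x, d * n%:R <= x -> w x <= eps / (s * d ^+ j.+1).
    by near: n; apply: near_nat_pinfty => //; exact: we.
  rewrite iter_dif_affine; have [xi /andP[x1 x2] ->] := mvt j.+1 n (leqnSn _) An.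
  by rewrite mulrA mulrC -ler_pdivlMr//; exact: p0.
- move=> M; pose M' := `|M| / (s * d ^+ j.+1) * (2 * d) ^+ p.
  have d2p : 0 < (2 * d) ^+ p by rewrite exprn_gt0// mulr_gt0.
  near=> n.
  have An : A <= d * n%:R.
    have h : forall x, d * n%:R <= x -> A <= x by near: n; exact: nearA.
    exact: h.
  have p0 : forall x, d * n%:R <= x -> 0 < w x by near: n; exact: near_nat_pinfty.
  have pM : forall x, d * n%:R <= x -> M' <= x ^+ p * w x.
    by near: n; apply: near_nat_pinfty => //; exact: wM.
  have nj : (j.+1 <= n)%N by near: n; exact: nbhs_infty_ge.
  rewrite iter_dif_affine; have [xi /andP[x1 x2] ->] := mvt j.+1 n (leqnSn _) An.
  have xi0 : 0 < xi by lra.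
  have x3 : xi <= 2 * d * n%:R.
    apply: le_trans x2 _.
    have : j.+1%:R * d <= n%:R * d by rewrite ler_pM2r// ler_nat.
    lra.
  have x4 : xi ^+ p <= (2 * d) ^+ p * n%:R ^+ p.
    by rewrite -exprMn lerXn2r// nnegrE; [exact: ltW|rewrite !mulr_ge0//; exact: ltW].
  have x5 : M' <= (2 * d) ^+ p * n%:R ^+ p * w xi.
    by apply: le_trans (pM xi x1) _; rewrite ler_pM2r// p0.
  rewrite /M' mulrC -mulrA ler_pM2l// ler_pdivrMr// in x5.
  apply: le_trans (ler_norm _) _; apply: le_trans x5 _.
  by rewrite le_eqVlt; apply/orP; left; apply/eqP; rewrite -/w; ring.
Unshelve. all: by end_near. Qed.

End FiniteDifferences.

(** * Cosine averages along integer combinations *)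

Section HardyCosineAverages.
Variable R : realType.

Lemma near_ln_ge (M : R) : \forall t \near +oo_R, M <= ln t.
Proof.
apply: filterS (near_pinfty_ge (expR M)) => t h.
by rewrite -[leLHS]expRK ler_ln ?posrE ?expR_gt0//; apply: lt_le_trans h; exact: expR_gt0.
Qed.

Lemma is_derive_opp_inv (t : R) : 1 <= t ->
  is_derive t (1 : R) (fun t : R => - t^-1) (t ^- 2).
Proof.
move=> t1; have t0 : id t != 0 by rewrite /= gt_eqF//; lra.
have h := @is_deriveV R id t 1 1 t0 (is_derive_id _ _).
have := @is_deriveN R R^o R^o (fun y : R => y^-1) t 1 _ h.
by move=> h2; apply: is_derive_eq h2 _; rewrite /GRing.scale/= mulr1 opprK.
Qed.

Variables (H : set (R -> R)) (hH : hardy_field H).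

Lemma hardy_cos_avg0 (g : R -> R) j (d s b : R) : H g -> 0 < d -> 0 < s ->
  (forall C : R, \forall t \near +oo_R, C * t ^+ j <= g t) ->
  (forall c : R, 0 < c -> \forall t \near +oo_R, g t <= c * t ^+ j.+1) ->
  (forall C : R, \forall t \near +oo_R, C * ln t <= g t) ->
  cos_avg0 (fun n => s * g (d * n%:R) + b).
Proof.
move=> Hg d0 s0 low up gln.
have dg r : \forall t \near +oo_R, derivable (iter r (@der R) g) t 1.
  by apply: (hardy_derivable hH); exact: hardy_iter_derive.
case: j low up => [|j] low up.
  apply: fejer_criterion.
  have [|||w0 dw we wM] := hardy_top_derivative hH (j := 0) (p := 1) (Psi := @ln R) Hg up.
  - by move=> t t1; rewrite expr1; apply: is_derive1_ln; lra.
  - exact: near_ln_ge.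
  - move=> C; apply: filterS (filterI (near_ln_ge `|C|) (gln (`|C| + 1))) => t [h1 h2].
    have : C * ln t <= `|C| * ln t by rewrite ler_wpM2r ?ler_norm//; apply: le_trans h1.
    have := ler_norm C; rewrite /=; lra.
  - exact: sample_vdc_class.
apply: (@vdc_class_cos_avg0 _ _ j).
have [|||w0 dw we wM] := hardy_top_derivative hH (j := j.+1) (p := 2)
  (Psi := fun t => - t^-1) Hg up.
- exact: is_derive_opp_inv.
- apply: filterS (near_pinfty_ge 2) => t t2.
  by rewrite lerN2 lef_pV2 ?posrE//; lra.
- move=> C.
  (* If this derivative stayed bounded above, [g] would be at most a multiple of [t ^ j.+1], against
     [low]. *)
  have : \forall t \near +oo_R, `|C| <= iter j.+1 (@der R) g t.
    apply: (hardy_large hH); first exact: (hardy_iter_derive hH).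
    move=> c c0 /(hardy_iter_upper hH Hg c0) h.
    have [A A1 hA] := near_pinftyP (filterI h (low (2 ^+ j.+1 * c + 1))).
    have [] := hA A (lexx _).
    have : 0 < A ^+ j.+1 by rewrite exprn_gt0//; lra.
    lra.
  move=> h; apply: filterS (filterI h (near_pinfty_ge 1)) => t [h1 h2].
  apply: le_trans h1; rewrite (_ : _ + C = C * (1 - t^-1)); last by ring.
  have i0 : 0 <= t^-1 by rewrite invr_ge0; lra.
  have i1 : t^-1 <= 1 by rewrite invf_le1//; lra.
  apply: (@le_trans _ _ (`|C| * (1 - t^-1))); first by rewrite ler_wpM2r ?ler_norm//; lra.
  by rewrite ler_piMr//; lra.
- exact: sample_vdc_class.
Qed.

Lemma hardy_sum (I : Type) (r : seq I) (F : I -> R -> R) : (forall i, H (F i)) ->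
  H (fun t => \sum_(i <- r) F i t).
Proof.
move=> HF; elim: r => [|i r IH].
  by rewrite (_ : (fun t => _) = (fun=> 0)); [exact: hardy_cst0|apply/funext => t; rewrite big_nil].
rewrite (_ : (fun t => _) = (fun t => F i t + \sum_(i <- r) F i t)); last first.
  by apply/funext => t; rewrite big_cons.
exact: hardy_add.
Qed.

Variables (k : nat) (f : 'I_k -> R -> R).
Hypothesis hf : forall i, H (f i).
Hypothesis fpos : forall i, \forall t \near +oo_R, 0 < f i t.
Hypothesis fln : forall i (C : R), \forall t \near +oo_R, C * ln t <= f i t.
Hypothesis fpow : forall i, exists j : nat,
  (forall C : R, \forall t \near +oo_R, C * t ^+ j <= f i t) /\
  (forall c : R, 0 < c -> \forall t \near +oo_R, f i t <= c * t ^+ j.+1).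
Hypothesis fsucc : forall i i' : 'I_k, i' = i.+1 :> nat ->
  forall M : R, \forall t \near +oo_R, M * f i t <= f i' t.

Lemma dominated (i i' : 'I_k) : (i < i')%N ->
  forall M : R, \forall t \near +oo_R, M * f i t <= f i' t.
Proof.
move=> ii'; have [m hm] : exists m, (i' - i)%N = m.+1 by exists (i' - i).-1; lia.
elim: m i' hm {ii'} => [|m IH] i' hm M; first by apply: fsucc; lia.
have lt' : (i'.-1 < k)%N by have := ltn_ord i'; lia.
pose i1 := Ordinal lt'.
have h1 : \forall t \near +oo_R, M * f i t <= f i1 t by apply: IH => /=; lia.
have h2 : \forall t \near +oo_R, 1 * f i1 t <= f i' t by apply: fsucc => /=; lia.
by apply: filterS (filterI h1 h2) => t []; rewrite mul1r; exact: le_trans.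
Qed.

(** The last function with a nonzero coefficient governs the sum [g]: each other term is at most
    [f I / (2 (k + 1))], so all of them together make at most half of [f I], while [a I >= 1] since
    it is a positive integer. Thus [g] inherits the growth of [f I]. *)
Lemma combination_cos_avg0_pos (a : 'I_k -> int) (I : 'I_k) (d s b : R) :
  0 < d -> 0 < s -> 0 < a I -> (forall i : 'I_k, (I < i)%N -> a i = 0) ->
  cos_avg0 (fun n => s * (\sum_i (a i)%:~R * f i (d * n%:R)) + b).
Proof.
move=> d0 s0 aI ai0.
pose g t := \sum_i (a i)%:~R * f i t.
have Hg : H g.
  apply: (@hardy_sum _ _ (fun i t => (a i)%:~R * f i t)) => i.
  by apply: (hardy_mul hH) => //; exact: hardy_intr.
pose A : R := \sum_(i < k) `|(a i)%:~R|.
have A0 : 0 <= A by exact: sumr_ge0.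
have aA i : `|(a i)%:~R| <= A.
  by rewrite /A (bigD1 i)//= lerDl sumr_ge0.
have K0 : 0 < 2 * (k%:R + 1) * (A + 1) :> R by rewrite !mulr_gt0// ltr_wpDl.
have cmp : \forall t \near +oo_R, 2^-1 * f I t <= g t /\ g t <= (A + 1) * f I t.
  have h : \forall t \near +oo_R, forall i : 'I_k, 0 < f i t /\
      (i != I -> `|(a i)%:~R * f i t| <= (2 * (k%:R + 1))^-1 * f I t).
    apply: filter_forall => i.
    have [iI|iI] := ltnP i I; last first.
      apply: filterS (filterI (fpos i) (fpos I)) => t [p pI]; split=> // ni.
      rewrite ai0 ?mul0r ?normr0; last first.
        by rewrite ltn_neqAle iI andbT; apply: contraNneq ni => e; apply/eqP/val_inj.
      by rewrite mulr_ge0 ?(ltW pI)// invr_ge0 mulr_ge0// addr_ge0.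
    apply: filterS (filterI (fpos i) (dominated iI (2 * (k%:R + 1) * (A + 1)))) => t [p pI].
    split=> // _; rewrite normrM (gtr0_norm p) mulrC [leRHS]mulrC ler_pdivlMr; last first.
      by rewrite mulr_gt0// ltr_wpDl.
    apply: le_trans pI.
    have : f i t * `|(a i)%:~R| <= f i t * (A + 1).
      by rewrite ler_pM2l//; apply: le_trans (aA i) _; rewrite lerDl.
    have c0 : 0 <= 2 * (k%:R + 1) :> R by rewrite mulr_ge0// addr_ge0.
    move=> /(ler_wpM2r c0)/le_trans; apply; rewrite le_eqVlt; apply/orP; left; apply/eqP; ring.
  apply: filterS h => t h.
  have fI : 0 < f I t by have [] := h I.
  rewrite /g (bigD1 I)//=.
  set rest := \sum_(i < k | i != I) _.
  have : `|rest| <= 2^-1 * f I t.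
    apply: le_trans (ler_norm_sum _ _ _) _.
    apply: (@le_trans _ _ (\sum_(i < k | i != I) (2 * (k%:R + 1))^-1 * f I t)).
      by apply: ler_sum => i iI; have [_ /(_ iI)] := h i.
    rewrite sumr_const -[leLHS]mulr_natl.
    apply: (@le_trans _ _ (k%:R * ((2 * (k%:R + 1))^-1 * f I t))).
      rewrite ler_wpM2r ?mulr_ge0 ?invr_ge0 ?mulr_ge0 ?addr_ge0 ?(ltW fI)//.
      by rewrite ler_nat; apply: leq_trans (max_card _) _; rewrite card_ord.
    rewrite mulrA ler_pM2r// invfM mulrCA ler_piMr//.
    by rewrite ler_pdivrMr ?mul1r ?lerDl// ltr_wpDl.
  have aI1 : 1 <= (a I)%:~R :> R by rewrite (ler_int R 1).
  have : 1 * f I t <= (a I)%:~R * f I t by rewrite ler_pM2r.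
  have : (a I)%:~R * f I t <= A * f I t.
    by rewrite ler_pM2r//; apply: le_trans (aA I); exact: ler_norm.
  rewrite ler_norml; lra.
have [j [low up]] := fpow I.
apply: (@hardy_cos_avg0 g j) => //.
- move=> C; apply: filterS (filterI cmp (low (2 * C))) => t [[? ?] ?]; lra.
- move=> c c0; have c1 : 0 < c / (A + 1) by rewrite divr_gt0// ltr_wpDl.
  apply: filterS (filterI cmp (up _ c1)) => t [[_ h1] h2]; apply: le_trans h1 _.
  by rewrite mulrC -ler_pdivlMr ?ltr_wpDl// mulrAC.
- move=> C; apply: filterS (filterI cmp (fln I (2 * C))) => t [[? ?] ?]; lra.
Qed.

Lemma combination_cos_avg0 (a : 'I_k -> int) (d s b : R) :
  0 < d -> 0 < s -> (exists i, a i != 0) ->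
  cos_avg0 (fun n => s * (\sum_i (a i)%:~R * f i (d * n%:R)) + b).
Proof.
move=> d0 s0 [i0 ai0].
pose I := [arg max_(i > i0 | a i != 0) (i : nat)]%N.
have [aI maxI] : a I != 0 /\ forall i : 'I_k, (I < i)%N -> a i = 0.
  rewrite /I; case: arg_maxnP => // i ai h; split=> // i' ii'.
  by apply/eqP; apply: contraTT ii' => /h; rewrite -leqNgt.
have [p|n|e] := ltgtP 0 (a I).
- exact: combination_cos_avg0_pos p maxI.
- have h := @combination_cos_avg0_pos (fun i => - a i) I d s (- b) d0 s0.
  rewrite oppr_gt0 in h; have {}h := h n.
  have {}h := h _; move=> eps eps0; apply: filterS (h _ eps eps0).
    move=> N; set S1 := \sum_(_ <= n < _) _; set S2 := \sum_(_ <= n < _) _.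
    rewrite (_ : S1 = S2)//; apply: eq_bigr => m _; rewrite -cosN; congr cos.
    under eq_bigr do rewrite intrN mulNr.
    by rewrite sumrN; ring.
  by move=> i /maxI ->; rewrite oppr0.
- by rewrite -e eqxx in aI.
Qed.

End HardyCosineAverages.

(** * Joint equidistribution of residues *)

Section Averages.
Variable R : realType.
Implicit Types (u v : nat -> R).

Definition avg_to u (l : R) := forall eps : R, 0 < eps ->
  \forall N \near \oo, `|\sum_(0 <= n < N) u n - l * N%:R| <= eps * N%:R.

Lemma avg_to_cst (l : R) : avg_to (fun=> l) l.
Proof.
move=> eps eps0; apply: filterE => N.
have -> : \sum_(0 <= n < N) l = l * N%:R by rewrite sumr_const_nat subn0 mulr_natr.
by rewrite subrr normr0 mulr_ge0// ltW.
Qed.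

Lemma avg_to_add u v l m : avg_to u l -> avg_to v m -> avg_to (fun n => u n + v n) (l + m).
Proof.
move=> hu hv eps eps0; have e2 : 0 < eps / 2 by lra.
apply: filterS (filterI (hu _ e2) (hv _ e2)) => N [h1 h2].
rewrite big_split/= (_ : _ - _ = (\sum_(0 <= n < N) u n - l * N%:R) +
  (\sum_(0 <= n < N) v n - m * N%:R)); last by ring.
apply: le_trans (ler_normD _ _) _; lra.
Qed.

Lemma avg_to_scale u l (c : R) : avg_to u l -> avg_to (fun n => c * u n) (c * l).
Proof.
move=> hu eps eps0; have c0 : 0 < `|c| + 1 by rewrite ltr_wpDl.
have e' : 0 < eps / (`|c| + 1) by rewrite divr_gt0.
apply: filterS (hu _ e') => N h.
rewrite -mulr_sumr -mulrA -mulrBr normrM.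
apply: (@le_trans _ _ ((`|c| + 1) * (eps / (`|c| + 1) * N%:R))).
  by rewrite ler_pM// lerDl.
by rewrite mulrA mulrCA mulfV ?mulr1// gt_eqF.
Qed.

Lemma avg_to_sum (I : Type) (r : seq I) (F : I -> nat -> R) (l : I -> R) :
  (forall i, avg_to (F i) (l i)) ->
  avg_to (fun n => \sum_(i <- r) F i n) (\sum_(i <- r) l i).
Proof.
move=> h; elim: r => [|i r IH].
  rewrite big_nil (_ : (fun n => _) = (fun=> 0)); first exact: avg_to_cst.
  by apply/funext => n; rewrite big_nil.
rewrite big_cons (_ : (fun n => _) = (fun n => F i n + \sum_(i <- r) F i n)).
  exact: avg_to_add.
by apply/funext => n; rewrite big_cons.
Qed.

Lemma avg_to_ext u v l : u =1 v -> avg_to u l -> avg_to v l.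
Proof. by move=> /funext ->. Qed.

Lemma cos_avg0P (X : nat -> R) : cos_avg0 X -> avg_to (fun n => cos (X n)) 0.
Proof. by move=> h eps /h; apply: filterS => N; rewrite mul0r subr0. Qed.

End Averages.

(** * Products of trigonometric polynomials in several sequences *)

Section WeylProduct.
Variables (R : realType) (T : finType) (c : T -> R) (b : T -> int).

Definition trig_eval (phi : T -> R) (y : R) : R :=
  \sum_(l : T) c l * cos ((b l)%:~R * y + phi l).

(** The mean over a period, to which only zero frequencies contribute. *)
Definition trig_mean (phi : T -> R) : R :=
  \sum_(l : T) c l * (if b l == 0 then cos (phi l) else 0).

Variables (k : nat) (x : 'I_k -> nat -> R) (phi : 'I_k -> T -> R).
Hypothesis weyl : forall (a : 'I_k -> int) (s : R), (exists i, a i != 0) ->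
  cos_avg0 (fun n => \sum_i (a i)%:~R * x i n + s).

(** The extra cosine makes the induction close: by [cos u cos v = (cos (u + v) + cos (u - v)) / 2],
    one more factor only changes the frequency vector [a] at a coordinate that was still 0. The new
    vector therefore vanishes only if both the old one and the added frequency do. *)
Lemma weyl_product_step m (a : 'I_k -> int) (s : R) : (m <= k)%N ->
  (forall i : 'I_k, (i < m)%N -> a i = 0) ->
  avg_to (fun n => (\prod_(i < k | (i < m)%N) trig_eval (phi i) (x i n)) *
                   cos (\sum_i (a i)%:~R * x i n + s))
   ((\prod_(i < k | (i < m)%N) trig_mean (phi i)) *
    (if [forall i, a i == 0] then cos s else 0)).
Proof.
elim: m a s => [|m IH] a s mk am.
  rewrite big_pred0; last by move=> i; rewrite ltn0.
  rewrite mul1r; apply: (@avg_to_ext _ (fun n => cos (\sum_i (a i)%:~R * x i n + s))).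
    by move=> n; rewrite [X in _ = X * _]big_pred0 ?mul1r// => i; rewrite ltn0.
  case: ifPn => [/forallP a0|].
    apply: avg_to_ext (avg_to_cst (cos s)) => n.
    by rewrite big1 ?add0r// => i _; rewrite (eqP (a0 i)) mul0r.
  rewrite negb_forall => /existsP a0; exact/cos_avg0P/weyl.
pose i0 := Ordinal mk.
have E (F : 'I_k -> R) : \prod_(i < k | (i < m.+1)%N) F i =
    F i0 * \prod_(i < k | (i < m)%N) F i.
  rewrite (bigD1 i0) ?ltnSn//=; congr (_ * _); apply: eq_bigl => i.
  rewrite ltnS [in RHS]ltn_neqAle andbC.
  by congr (~~ _ && _).
rewrite E.
pose ap (sg : int) l (i : 'I_k) : int := if i == i0 then sg * b l else a i.
have a0 : a i0 = 0 by apply: am; rewrite /= ltnSn.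
have sumap (sg : int) l n : \sum_i (ap sg l i)%:~R * x i n =
    \sum_i (a i)%:~R * x i n + sg%:~R * (b l)%:~R * x i0 n.
  rewrite (bigD1 i0)//= [in RHS](bigD1 i0)//= a0 mul0r add0r /ap eqxx intrM addrC.
  by congr (_ + _); apply: eq_bigr => i /negbTE ->.
have apm sg l (i : 'I_k) : (i < m)%N -> ap sg l i = 0.
  move=> im; rewrite /ap; case: eqP => [e|_]; last by apply: am; lia.
  by move: im; rewrite e /= ltnn.
have forallap sg l : sg != 0 -> [forall i, ap sg l i == 0] = (b l == 0) && [forall i, a i == 0].
  move=> sg0; apply/forallP/andP => [h|[/eqP bl /forallP h] i].
    split; first by have := h i0; rewrite /ap eqxx mulf_eq0 (negbTE sg0).
    apply/forallP => i; have := h i; rewrite /ap.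
    by case: (i =P i0) => [-> _|//]; rewrite a0.
  by rewrite /ap; case: (i =P i0) => [_|_]; [rewrite bl mulr0|exact: h].
pose P n := \prod_(i < k | (i < m)%N) trig_eval (phi i) (x i n).
pose PM := \prod_(i < k | (i < m)%N) trig_mean (phi i).
have h l : avg_to (fun n => c l / 2 * (P n * cos (\sum_i (ap 1 l i)%:~R * x i n + (s + phi i0 l))
      + P n * cos (\sum_i (ap (-1) l i)%:~R * x i n + (s - phi i0 l))))
   (c l / 2 * (PM * (if [forall i, ap 1 l i == 0] then cos (s + phi i0 l) else 0) +
      PM * (if [forall i, ap (-1) l i == 0] then cos (s - phi i0 l) else 0))).
  apply: avg_to_scale; apply: avg_to_add; apply: IH; (try exact: ltnW); exact: apm.
have := avg_to_sum (index_enum T) h.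
rewrite (_ : \sum_(_ <- _) _ = trig_mean (phi i0) * PM *
   (if [forall i, a i == 0] then cos s else 0)); last first.
  rewrite /trig_mean !mulr_suml; apply: eq_bigr => l _.
  rewrite !forallap//; case: (b l == 0); rewrite /= ?(mulr0, addr0, mul0r)//.
  case: ifP => _; rewrite ?(mulr0, addr0)//.
  by rewrite cosD cosB; field.
apply: avg_to_ext => n; rewrite E -/(P n) /trig_eval !mulr_suml.
apply: eq_bigr => l _.
rewrite !sumap !mulr1z mulrN1z !mul1r mulN1r.
set th := \sum_i _.
rewrite (_ : th + (b l)%:~R * x i0 n + (s + phi i0 l) =
  (th + s) + ((b l)%:~R * x i0 n + phi i0 l)); last by ring.
rewrite (_ : th + - (b l)%:~R * x i0 n + (s - phi i0 l) =
  (th + s) - ((b l)%:~R * x i0 n + phi i0 l)); last by ring.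
by rewrite cosD cosB; field.
Qed.

Lemma weyl_product : avg_to (fun n => \prod_(i < k) trig_eval (phi i) (x i n))
  (\prod_(i < k) trig_mean (phi i)).
Proof.
have := @weyl_product_step k (fun=> 0) 0 (leqnn k) (fun _ _ => erefl).
have -> : [forall i : 'I_k, (0 : int) == 0] by apply/forallP.
rewrite cos0 mulr1 (eq_bigl (fun=> true)); last by move=> i; rewrite ltn_ord.
apply: avg_to_ext => n.
rewrite [X in cos (X + _)]big1 ?add0r ?cos0 ?mulr1; last by move=> i _; rewrite mul0r.
by apply: eq_bigl => i; rewrite ltn_ord.
Qed.

End WeylProduct.

(** * Fejer kernels and majorants of residue intervals *)

Section FejerMajorant.
Variable R : realType.

(** The Fejer kernel of mean value 1, written as a sum of cosines so that averages of its translates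
    have the form [trig_eval]. *)
Definition fejer (m : nat) (y : R) : R :=
  m%:R^-1 * \sum_(j < m) \sum_(j' < m) cos ((j%:Z - j'%:Z)%:~R * y).

Lemma fejerE m y : fejer m y = m%:R^-1 *
  ((\sum_(0 <= j < m) cos (j%:R * y)) ^+ 2 + (\sum_(0 <= j < m) sin (j%:R * y)) ^+ 2).
Proof.
rewrite /fejer; congr (_ * _).
rewrite !big_mkord !expr2 !mulr_suml -big_split; apply: eq_bigr => j _ /=.
rewrite !mulr_sumr -big_split; apply: eq_bigr => j' _ /=.
by rewrite -cosB intrD intrN -!pmulrn mulrBl.
Qed.

Lemma fejer_ge0 m y : 0 <= fejer m y.
Proof. by rewrite fejerE mulr_ge0 ?invr_ge0// addr_ge0 ?sqr_ge0. Qed.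

(** Real and imaginary parts of [(1 - e^(iy)) sum_j e^(ijy) = 1 - e^(imy)]. *)
Lemma geometric_cos_sin m (y : R) :
  (1 - cos y) * (\sum_(0 <= j < m) cos (j%:R * y)) + sin y * (\sum_(0 <= j < m) sin (j%:R * y))
    = 1 - cos (m%:R * y) /\
  (1 - cos y) * (\sum_(0 <= j < m) sin (j%:R * y)) - sin y * (\sum_(0 <= j < m) cos (j%:R * y))
    = - sin (m%:R * y).
Proof.
elim: m => [|m [IH1 IH2]].
  by split; rewrite !big_geq// mul0r ?cos0 ?sin0; ring.
rewrite !big_nat_recr//= -natr1 (_ : (m%:R + 1) * y = m%:R * y + y); last by ring.
rewrite cosD sinD; split; [move: IH1 | move: IH2]; lra.
Qed.

Lemma geometric_sqr m (y : R) : 2 * (1 - cos y) *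
  ((\sum_(0 <= j < m) cos (j%:R * y)) ^+ 2 + (\sum_(0 <= j < m) sin (j%:R * y)) ^+ 2)
   = 2 * (1 - cos (m%:R * y)).
Proof.
have [] := geometric_cos_sin m y.
set C := \sum_(0 <= j < m) cos _; set S := \sum_(0 <= j < m) sin _ => h1 h2.
have e1 := cos2Dsin2 y; have e2 := cos2Dsin2 (m%:R * y).
transitivity (((1 - cos y) * C + sin y * S) ^+ 2 + ((1 - cos y) * S - sin y * C) ^+ 2).
  transitivity ((1 - 2 * cos y + 1) * (C ^+ 2 + S ^+ 2)); first by ring.
  by rewrite -[X in _ + X]e1; ring.
rewrite h1 h2.
transitivity (1 - 2 * cos (m%:R * y) + (cos (m%:R * y) ^+ 2 + sin (m%:R * y) ^+ 2)).
  by ring.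
by rewrite e2; ring.
Qed.

Lemma fejer_le m (y : R) : cos y < 1 -> fejer m y <= 2 / (m%:R * (1 - cos y)).
Proof.
move=> y1; rewrite fejerE.
have h := geometric_sqr m y; have c1 : -1 <= cos (m%:R * y) by exact: cos_geN1.
set Q := _ ^+ 2 + _ in h *.
rewrite invfM mulrCA ler_wpM2l ?invr_ge0// ler_pdivlMr ?subr_gt0//; lra.
Qed.

Lemma one_subr_cos (y : R) : 1 - cos y = 2 * sin (y / 2) ^+ 2.
Proof.
rewrite [in LHS](_ : y = (y / 2) *+ 2); last by rewrite -mulr_natr; field.
by rewrite cos_mulr2n cos2sin2; ring.
Qed.

(** The angle [be] is not a multiple of [2 pi] but [m be] is, so [geometric_sqr] forces both the
    cosine and the sine sum to vanish. *)
Lemma root_of_unity_sum (m : nat) (h : int) (al : R) : h != 0 -> (`|h| < m)%N ->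
  \sum_(q < m) cos (al - h%:~R * (2 * pi) / m%:R * q%:R) = 0.
Proof.
move=> h0 hm; have m0 : 0 < m%:R :> R by rewrite ltr0n; lia.
set be := h%:~R * (2 * pi) / m%:R.
have be1 : cos be < 1.
  rewrite -subr_gt0 one_subr_cos mulr_gt0// exprn_even_gt0//=.
  rewrite /be (_ : _ / 2 = h%:~R / m%:R * pi); last by field; rewrite gt_eqF.
  have pos (z : int) : 0 < z -> (`|z| < m)%N -> sin (z%:~R / m%:R * pi) != 0 :> R.
    move=> z0 zm; rewrite gt_eqF// sin_gt0_pi//.
    have pi0 := pi_gt0 R.
    rewrite mulr_gt0 ?divr_gt0 ?ltr0z//= -[ltRHS]mul1r ltr_pM2r// ltr_pdivrMr// mul1r.
    by rewrite -[z]gtz0_abs// -pmulrn ltr_nat.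
  have [hp|hn|e] := ltgtP 0 h; last by rewrite -e eqxx in h0.
    exact: pos.
  have := pos (- h); rewrite oppr_gt0 abszN => /(_ hn hm).
  by rewrite intrN !mulNr sinN oppr_eq0.
have := geometric_sqr m be.
have -> : cos (m%:R * be) = 1.
  rewrite /be (_ : m%:R * _ = 0 + h%:~R * (2 * pi)); last by field; rewrite gt_eqF.
  by rewrite cosD2pi_int cos0.
rewrite subrr mulr0 => /eqP; rewrite mulf_eq0 gt_eqF/=; last by lra.
rewrite paddr_eq0 ?sqr_ge0// !sqrf_eq0 => /andP[/eqP C0 /eqP S0].
transitivity (cos al * (\sum_(0 <= j < m) cos (j%:R * be)) +
  sin al * (\sum_(0 <= j < m) sin (j%:R * be))).
  rewrite !big_mkord !mulr_sumr -big_split; apply: eq_bigr => q _ /=.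
  by rewrite -cosB mulrC.
by rewrite C0 S0 !mulr0 addr0.
Qed.

(** All frequencies of the kernel are below [m] in absolute value, so the nonzero ones cancel over
    [m] equally spaced translates. *)
Lemma fejer_total (m : nat) (y : R) (q0 : int) : (0 < m)%N ->
  \sum_(q < m) fejer m (y - (q%:Z + q0)%:~R * (2 * pi) / m%:R) = m%:R.
Proof.
move=> m0; have m0' : m%:R != 0 :> R by rewrite pnatr_eq0 -lt0n.
rewrite /fejer -mulr_sumr exchange_big/=.
transitivity (m%:R^-1 * \sum_(j < m) (m%:R : R)).
  congr (_ * _); apply: eq_bigr => j _; rewrite exchange_big/= (bigD1 j)//=.
  rewrite [X in _ + X]big1 ?addr0; last first.
    move=> j' jj'; pose h := j%:Z - j'%:Z.
    rewrite -[RHS](@root_of_unity_sum m h (h%:~R * (y - q0%:~R * (2 * pi) / m%:R))).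
    - by apply: eq_bigr => q _; congr cos; rewrite -/h intrD -pmulrn; field.
    - apply: contraNneq jj'; rewrite /h => /eqP; rewrite subr_eq0 eqz_nat => /eqP e.
      exact/eqP/val_inj/esym.
    - by rewrite /h; have := ltn_ord j; have := ltn_ord j'; lia.
  under eq_bigr do rewrite subrr mul0r cos0.
  by rewrite sum_const_ord mulr1.
by rewrite sum_const_ord mulrA mulVf ?mul1r.
Qed.

(* Majorant of the indicator of [[r / d, (r + 1) / d[] modulo 1, where
   [m = d * M]: the average of the translates of the Fejer kernel by [q / m] with
   [r * M - e <= q < (r + 1) * M + e]. *)
Definition box_index (M e m : nat) : finType := ('I_(M + 2 * e) * ('I_m * 'I_m))%type.
Definition box_coef M e m (l : box_index M e m) : R := m%:R ^- 2.
Definition box_freq M e m (l : box_index M e m) : int := l.2.1%:Z - l.2.2%:Z.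
Definition box_phase M e m (q0 : int) (l : box_index M e m) : R :=
  - ((l.2.1%:Z - l.2.2%:Z)%:~R * ((l.1%:Z + q0)%:~R * (2 * pi) / m%:R)).

Lemma box_trig_evalE M e m q0 y :
  trig_eval (@box_coef M e m) (@box_freq M e m) (@box_phase M e m q0) y =
   m%:R^-1 * \sum_(q < M + 2 * e) fejer m (y - (q%:Z + q0)%:~R * (2 * pi) / m%:R).
Proof.
rewrite /trig_eval mulr_sumr.
rewrite -(pair_bigA _ (fun q jj => @box_coef M e m (q, jj) *
  cos ((@box_freq M e m (q, jj))%:~R * y + @box_phase M e m q0 (q, jj))))/=.
apply: eq_bigr => q _; rewrite -(pair_bigA _ (fun j j' => @box_coef M e m (q, (j, j')) *
  cos ((@box_freq M e m (q, (j, j')))%:~R * y + @box_phase M e m q0 (q, (j, j')))))/=.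
rewrite /fejer mulrA -expr2 exprVn.
rewrite mulr_sumr; apply: eq_bigr => j _; rewrite mulr_sumr; apply: eq_bigr => j' _.
by rewrite /box_coef /box_freq /box_phase/= mulrBr.
Qed.

Lemma box_trig_mean M e m q0 : (0 < m)%N ->
  trig_mean (@box_coef M e m) (@box_freq M e m) (@box_phase M e m q0) = (M + 2 * e)%:R / m%:R.
Proof.
move=> m0; have m0' : m%:R != 0 :> R by rewrite pnatr_eq0 -lt0n.
rewrite /trig_mean.
rewrite -(pair_bigA _ (fun q jj => @box_coef M e m (q, jj) *
  (if @box_freq M e m (q, jj) == 0 then cos (@box_phase M e m q0 (q, jj)) else 0)))/=.
transitivity (\sum_(q < M + 2 * e) (m%:R^-1 : R)); last by rewrite sum_const_ord.
apply: eq_bigr => q _.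
rewrite -(pair_bigA _ (fun j j' => @box_coef M e m (q, (j, j')) *
  (if @box_freq M e m (q, (j, j')) == 0 then cos (@box_phase M e m q0 (q, (j, j'))) else 0)))/=.
transitivity (\sum_(j < m) (m%:R ^- 2 : R)).
  apply: eq_bigr => j _; rewrite (bigD1 j)//= big1 ?addr0.
    by rewrite /box_coef /box_freq /box_phase/= subrr eqxx mul0r oppr0 cos0 mulr1.
  move=> j' jj'; rewrite /box_freq/= subr_eq0 ifF ?mulr0//.
  by apply: contraNF jj' => /eqP[e0]; apply/eqP/val_inj.
by rewrite sum_const_ord -exprVn expr2 mulrA mulfV// mul1r.
Qed.

Lemma box_trig_ge0 M e m q0 y :
  0 <= trig_eval (@box_coef M e m) (@box_freq M e m) (@box_phase M e m q0) y.
Proof.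
by rewrite box_trig_evalE mulr_ge0 ?invr_ge0// sumr_ge0// => q _; exact: fejer_ge0.
Qed.

Lemma one_subr_cos_ge (del y : R) : 0 < del <= 1 -> 2 * del <= y <= 2 * pi - 2 * del ->
  del ^+ 2 / 2 <= 1 - cos y.
Proof.
move=> /andP[d0 d1] /andP[y1 y2]; rewrite one_subr_cos.
have h1 : del / 2 <= sin del by apply: sin_ge_half; rewrite d1 ltW.
have h2 : sin del <= sin (y / 2).
  by apply: sin_ge_al; [exact: ltW|apply/andP; split; lra].
have h3 : (del / 2) ^+ 2 <= sin (y / 2) ^+ 2 by apply: lerXn2r; rewrite ?nnegrE; lra.
by move: h3; rewrite exprMn; lra.
Qed.

(** All [m] translates together sum to [m]. Those left out are centred at least [e / m] of a turn
    away from [z], because of the [e] additional translates on either side of the box, so each of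
    them is at most [4 m / e ^ 2]. *)
Lemma box_trig_lower (d M e : nat) (r : nat) (y z : R) :
  (0 < d)%N -> (0 < e)%N -> (M + 2 * e <= d * M)%N ->
  r%:R / d%:R <= z < r.+1%:R / d%:R -> y = z * (2 * pi) ->
  1 - 4 * (d * M)%:R / (e%:R ^+ 2) <=
  trig_eval (@box_coef M e (d * M)) (@box_freq M e (d * M))
     (@box_phase M e (d * M) ((r * M)%:Z - e%:Z)) y.
Proof.
move=> d0 e0 Mm /andP[z1 z2] ->; set m := (d * M)%N; set q0 : int := (r * M)%:Z - e%:Z.
have m0 : (0 < m)%N by lia.
have mR : 0 < m%:R :> R by rewrite ltr0n.
have M0 : (0 < M)%N by lia.
have piR := pi_ge2 R.
rewrite box_trig_evalE.
have := @fejer_total m (z * (2 * pi)) q0 m0.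
set F := fun q : nat => fejer m (z * (2 * pi) - (q%:Z + q0)%:~R * (2 * pi) / m%:R).
rewrite -(big_mkord xpredT F) -(big_mkord xpredT F) (@big_cat_nat _ _ _ (M + 2 * e))//=.
set S1 := \sum_(0 <= q < _) F q; set S2 := \sum_(_ <= q < m) F q => tot.
have eR : 0 < e%:R :> R by rewrite ltr0n.
pose del' : R := e%:R / m%:R.
have em : e%:R <= m%:R :> R by rewrite ler_nat; lia.
have del0 : 0 < del' <= 1 by rewrite divr_gt0//= ler_pdivrMr// mul1r.
have S2le : S2 <= m%:R * (4 * m%:R / e%:R ^+ 2).
  apply: (@le_trans _ _ (\sum_(M + 2 * e <= q < m) (4 * m%:R / e%:R ^+ 2))); last first.
    rewrite sumr_const_nat -[leLHS]mulr_natl ler_wpM2r//.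
    by rewrite ler_nat leq_subr.
  apply: ler_sum_nat => q /andP[q1 q2].
  rewrite /F.
  pose Y : R := ((q%:Z + q0)%:~R / m%:R - z) * (2 * pi).
  have cY : cos (z * (2 * pi) - (q%:Z + q0)%:~R * (2 * pi) / m%:R) = cos Y.
    by rewrite -cosN; congr cos; rewrite /Y; field; rewrite gt_eqF.
  have qq : (q%:Z + q0)%:~R = q%:R + (r * M)%:R - e%:R :> R.
    by rewrite /q0 !intrD intrN -!pmulrn addrA.
  have dd : r%:R / d%:R = (r * M)%:R / m%:R :> R.
    by rewrite /m !natrM; field; rewrite !pnatr_eq0 -!lt0n d0 M0.
  have dd' : r.+1%:R / d%:R = (r * M + M)%:R / m%:R :> R.
    by rewrite /m -[(r * M + M)%N]mulSnr !natrM; field; rewrite !pnatr_eq0 -!lt0n d0 M0.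
  have yl : 2 * del' <= Y.
    have : del' <= (q%:Z + q0)%:~R / m%:R - z.
      rewrite lerBrDr; apply: (@le_trans _ _ (del' + (r * M + M)%:R / m%:R)).
        by rewrite lerD2l -dd' ltW.
      rewrite /del' -mulrDl ler_pM2r ?invr_gt0// qq.
      have : (M + 2 * e)%:R <= q%:R :> R by rewrite ler_nat.
      by rewrite !natrD natrM; lra.
    by rewrite /Y; have /andP[? ?] := del0; nra.
  have yr : Y <= 2 * pi - 2 * del'.
    have : (q%:Z + q0)%:~R / m%:R - z <= 1 - del'.
      rewrite lerBlDr; apply: (@le_trans _ _ (1 - del' + (r * M)%:R / m%:R)); last first.
        by rewrite lerD2l -dd.
      rewrite /del' -[X in X - _](@mulfV _ m%:R) ?gt_eqF// -mulNr -!mulrDl ler_pM2r ?invr_gt0// qq.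
      have : q%:R <= m%:R :> R by rewrite ler_nat ltnW.
      lra.
    by rewrite /Y; have /andP[? ?] := del0; nra.
  have low := @one_subr_cos_ge del' Y del0 ltac:(by rewrite yl yr).
  have pos : 0 < del' ^+ 2 / 2 by rewrite divr_gt0// exprn_gt0//; case/andP: del0.
  apply: le_trans (@fejer_le m _ _) _; first by rewrite cY; lra.
  rewrite cY; apply: (@le_trans _ _ (2 / (m%:R * (del' ^+ 2 / 2)))).
    have p1 : 0 < m%:R * (1 - cos Y) by rewrite mulr_gt0//; lra.
    have p2 : 0 < m%:R * (del' ^+ 2 / 2) by rewrite mulr_gt0.
    by rewrite ler_pM2l// lef_pV2 ?posrE// ler_pM2l.
  rewrite le_eqVlt; apply/orP; left; apply/eqP; rewrite /del'; field.
  by rewrite !gt_eqF.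
have -> : S1 = m%:R - S2 by rewrite -tot addrK.
rewrite mulrBr mulVf ?gt_eqF// lerD2l lerN2 mulrC ler_pdivrMr//.
by rewrite mulrC.
Qed.

End FejerMajorant.

(** * Density of a residue box *)

Section ResidueBoxes.
Variable R : realType.

Lemma trig_eval_periodic (T : finType) (c : T -> R) (b : T -> int) phi (y : R) (t : int) :
  trig_eval c b phi (y + t%:~R * (2 * pi)) = trig_eval c b phi y.
Proof.
apply: eq_bigr => l _; congr (_ * _).
rewrite (_ : _ + phi l = ((b l)%:~R * y + phi l) + (b l * t)%:~R * (2 * pi)).
  exact: cosD2pi_int.
by rewrite intrM; ring.
Qed.

Lemma expr1D_le (x : R) k : 0 <= x <= 1 -> (1 + x) ^+ k <= 1 + (2 ^+ k - 1) * x.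
Proof.
move=> /andP[x0 x1]; elim: k => [|k IH]; first by rewrite !expr0 subrr mul0r addr0.
rewrite exprS [in leRHS]exprS; have p0 : 0 <= (2 ^+ k : R) - 1.
  by rewrite subr_ge0 exprn_ege1// ler1n.
apply: (@le_trans _ _ ((1 + x) * (1 + (2 ^+ k - 1) * x))).
  by rewrite ler_wpM2l// addr_ge0.
move: p0; set K := 2 ^+ k => p0; have : 0 <= (K - 1) * (x * (1 - x)).
  by rewrite mulr_ge0// mulr_ge0// subr_ge0.
lra.
Qed.

Variables (k d : nat) (y : 'I_k -> nat -> R).
Hypothesis d2 : (2 <= d)%N.
Hypothesis weyl : forall (a : 'I_k -> int) (s : R), (exists i, a i != 0) ->
  cos_avg0 (fun n => \sum_i (a i)%:~R * (y i n / d%:R * (2 * pi)) + s).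

Definition in_box (r : {ffun 'I_k -> 'I_d}) (n : nat) : bool :=
  [forall i, (Num.floor (y i n) %% d)%Z == r i].

Lemma box_fraction (Y : R) (r : 'I_d) : (Num.floor Y %% d)%Z == r ->
  exists z : R, exists t : int,
    r%:R / d%:R <= z < r.+1%:R / d%:R /\ Y / d%:R = z + t%:~R.
Proof.
move=> /eqP fr; have dR : 0 < d%:R :> R by rewrite ltr0n; lia.
pose t := (Num.floor Y %/ d)%Z; exists (Y / d%:R - t%:~R), t; split; last by rewrite subrK.
have E : (Num.floor Y)%:~R = t%:~R * d%:R + r%:R :> R.
  by rewrite [in LHS](divz_eq (Num.floor Y) d) fr intrD intrM -!pmulrn.
have h1 : (Num.floor Y)%:~R <= Y by exact: floor_le_tmp.
have h2 : Y < (Num.floor Y + 1)%:~R by exact: floorD1_gt.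
rewrite intrD E in h2; rewrite E in h1.
rewrite lerBrDr ltrBlDr !ler_pdivlMr// ltr_pdivrMr// !mulrDl !divfK ?gt_eqF//.
by rewrite -natr1; apply/andP; split; lra.
Qed.

Lemma box_upper (r : {ffun 'I_k -> 'I_d}) (eps : R) : 0 < eps ->
  \forall N \near \oo, \sum_(0 <= n < N) (in_box r n)%:R <= (d%:R ^- k + eps) * N%:R.
Proof.
move=> eps0.
have dR : 0 < d%:R :> R by rewrite ltr0n; lia.
have k20 : 0 < 2 ^+ k :> R by rewrite exprn_gt0.
pose x : R := Num.min 1 (eps / 2 / 2 ^+ k).
have x0 : 0 < x by rewrite lt_min ltr01 !divr_gt0.
have x1 : x <= 1 by rewrite ge_min lexx.
have x2 : 2 ^+ k * x <= eps / 2.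
  by rewrite mulrC -ler_pdivlMr// ge_min lexx orbT.
(* With [M = e E] and [m = d M], the majorant has mean [(1 + 2 / E) / d] and is at least
   [1 - 4 d E / e] on its interval, so [E] is chosen first and [e] after it; each of the two errors
   is made at most [x / 4]. *)
have [E0 hE0] := nearP_nat (near_natr_ge (8 / x)).
pose E := maxn E0 2.
have hE : 8 / x <= E%:R by apply: hE0; exact: leq_maxl.
have ER : 0 < E%:R :> R by rewrite ltr0n; rewrite leq_max orbT.
have [e0 he0] := nearP_nat (near_natr_ge (16 * d%:R * E%:R / x)).
pose e := maxn e0 1.
have he : 16 * d%:R * E%:R / x <= e%:R by apply: he0; exact: leq_maxl.
have eR : 0 < e%:R :> R by rewrite ltr0n; rewrite leq_max orbT.
pose M := (e * E)%N; pose m := (d * M)%N.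
have e1 : (0 < e)%N by rewrite leq_max orbT.
have E2 : (2 <= E)%N by rewrite leq_max orbT.
have Mm : (M + 2 * e <= d * M)%N.
  apply: (@leq_trans (2 * M)); last by rewrite leq_mul2r d2 orbT.
  by rewrite [(2 * M)%N]mul2n -addnn leq_add2l /M mulnC leq_mul2l E2 orbT.
have m0 : (0 < m)%N by rewrite /m /M !muln_gt0 e1 (ltnW E2) ltnW.
pose om : R := 1 - 4 * m%:R / e%:R ^+ 2.
have omx : 1 - x / 4 <= om.
  rewrite /om lerD2l lerN2 /m /M !natrM.
  rewrite (_ : _ / _ = 4 * d%:R * E%:R / e%:R); last by field; rewrite gt_eqF.
  rewrite ler_pdivrMr//; move: he; rewrite ler_pdivrMr//; lra.
have om0 : 0 < om by lra.
pose mu : R := (M + 2 * e)%:R / m%:R.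
have mux : mu <= (1 + x / 4) / d%:R.
  rewrite /mu /m /M !natrD !natrM (_ : _ / _ = (1 + 2 / E%:R) / d%:R); last first.
    by field; rewrite !gt_eqF.
  rewrite ler_pM2r ?invr_gt0// lerD2l.
  by rewrite ler_pdivrMr//; move: hE; rewrite ler_pdivrMr//; lra.
have mu0 : 0 <= mu by rewrite divr_ge0.
have ratio : mu ^+ k <= om ^+ k * (d%:R ^- k + eps / 2).
  have h : mu <= om * ((1 + x) / d%:R).
    apply: le_trans mux _; rewrite mulrA ler_pM2r ?invr_gt0//; nra.
  apply: (@le_trans _ _ ((om * ((1 + x) / d%:R)) ^+ k)).
    apply: lerXn2r => //; rewrite nnegrE; exact: le_trans h.
  rewrite exprMn ler_pM2l ?exprn_gt0// expr_div_n.
  have := @expr1D_le x k; rewrite (ltW x0) x1 mulrBl mul1r => /(_ isT) h1.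
  apply: (@le_trans _ _ ((1 + eps / 2) * d%:R ^- k)).
    by rewrite ler_wpM2r ?invr_ge0 ?exprn_ge0//; lra.
  rewrite mulrDl mul1r lerD2l ler_piMr//; first by lra.
  by rewrite invf_le1 ?exprn_gt0// exprn_ege1// ler1n ltnW.
pose q0 (i : 'I_k) : int := (r i * M)%:Z - e%:Z.
pose X (i : 'I_k) n := y i n / d%:R * (2 * pi).
pose U i := trig_eval (@box_coef R M e m) (@box_freq M e m) (@box_phase R M e m (q0 i)).
have point n : (in_box r n)%:R * om ^+ k <= \prod_(i < k) U i (X i n).
  have [/forallP inb|_] := boolP (in_box r n); last first.
    by rewrite mul0r prodr_ge0// => i _; exact: box_trig_ge0.
  rewrite mul1r -[k in om ^+ k]card_ord -prodr_const.
  apply: ler_prod => i _; rewrite (ltW om0)/=.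
  have [z [t [zr zt]]] := box_fraction (inb i).
  rewrite /U /X zt mulrDl trig_eval_periodic.
  exact: (box_trig_lower (ltnW d2) e1 Mm zr erefl).
have W := @weyl_product R _ (@box_coef R M e m) (@box_freq M e m) k X
  (fun i => @box_phase R M e m (q0 i)) weyl.
have PM : \prod_(i < k) trig_mean (@box_coef R M e m) (@box_freq M e m)
    (@box_phase R M e m (q0 i)) = mu ^+ k.
  rewrite -[k in RHS]card_ord -prodr_const.
  by apply: eq_bigr => i _; rewrite box_trig_mean.
rewrite {}PM in W.
have omk : 0 < om ^+ k by rewrite exprn_gt0.
have e' : 0 < om ^+ k * (eps / 2) by rewrite mulr_gt0// divr_gt0.
apply: filterS (W _ e') => N.
move=> h.
rewrite -(ler_pM2l omk) mulr_sumr.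
apply: (@le_trans _ _ (\sum_(0 <= n < N) \prod_(i < k) U i (X i n))).
  by apply: ler_sum => n _; rewrite mulrC; exact: point.
have : \sum_(0 <= n < N) \prod_(i < k) U i (X i n) <= (mu ^+ k + om ^+ k * (eps / 2)) * N%:R.
  by move: h; rewrite ler_norml => /andP[_]; rewrite -/U mulrDl; lra.
move=> /le_trans; apply; rewrite [leRHS]mulrA ler_wpM2r//; lra.
Qed.

Lemma in_box_total n : \sum_(r : {ffun 'I_k -> 'I_d}) (in_box r n)%:R = 1 :> R.
Proof.
have d0 : (0 < d)%N by lia.
have lt (i : 'I_k) : (`|(Num.floor (y i n) %% d)%Z| < d)%N.
  have := ltz_pmod (Num.floor (y i n)) (d := d) ltac:(lia).
  have := modz_ge0 (Num.floor (y i n)) (d := d) ltac:(lia); lia.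
pose r0 := [ffun i => Ordinal (lt i)] : {ffun 'I_k -> 'I_d}.
have E r : in_box r n = (r == r0).
  apply/forallP/eqP => [h|-> i].
    apply/ffunP => i; rewrite ffunE; apply/val_inj => /=.
    by rewrite (eqP (h i)).
  rewrite ffunE/=; have := modz_ge0 (Num.floor (y i n)) (d := d) ltac:(lia).
  by move=> h; rewrite gez0_abs.
rewrite (bigD1 r0)//= E eqxx big1 ?addr0// => r /negbTE rr.
by rewrite E rr.
Qed.

(** The [D = d ^ k] boxes partition the integers, so upper bounds for the other boxes bound this one
    from below; allowing each an error [eps / D] keeps the total below [eps]. *)
Lemma box_density (r : {ffun 'I_k -> 'I_d}) :
  avg_to (fun n => (in_box r n)%:R) (d%:R ^- k : R).
Proof.
move=> eps eps0.
have dR : 0 < d%:R :> R by rewrite ltr0n; lia.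
pose D : R := #|{ffun 'I_k -> 'I_d}|%:R.
have DE : D = d%:R ^+ k by rewrite /D card_ffun !card_ord natrX.
have D1 : 1 <= D by rewrite DE exprn_ege1// ler1n; lia.
have e' : 0 < eps / D by rewrite divr_gt0//; lra.
have up : \forall N \near \oo, forall r : {ffun 'I_k -> 'I_d},
    \sum_(0 <= n < N) (in_box r n)%:R <= (d%:R ^- k + eps / D) * N%:R.
  by apply: filter_forall => s; exact: box_upper.
have De : eps / D <= eps by rewrite ler_pdivrMr ?ler_peMr//; lra.
have DV : d%:R ^- k = D^-1 by rewrite DE.
apply: filterS up => N h; rewrite ler_norml; apply/andP; split; last first.
  have := h r; have : eps / D * N%:R <= eps * N%:R by rewrite ler_wpM2r.
  rewrite mulrDl; lra.
have tot : \sum_(s : {ffun 'I_k -> 'I_d}) \sum_(0 <= n < N) (in_box s n)%:R = N%:R :> R.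
  rewrite exchange_big/= -[RHS]mulr1 -[N in RHS]subn0 mulr_natl -sumr_const_nat.
  by apply: eq_bigr => n _; rewrite in_box_total.
rewrite (bigD1 r)//= in tot.
have : \sum_(s : {ffun 'I_k -> 'I_d} | s != r) \sum_(0 <= n < N) (in_box s n)%:R <=
    (D - 1) * ((D^-1 + eps / D) * N%:R) :> R.
  apply: (@le_trans _ _ (\sum_(s : {ffun 'I_k -> 'I_d} | s != r) (D^-1 + eps / D) * N%:R)).
    by apply: ler_sum => s _; have := h s; rewrite DV.
  rewrite sumr_const -[leLHS]mulr_natl le_eqVlt; apply/orP; left; apply/eqP.
  have c0 : (0 < #|{ffun 'I_k -> 'I_d}|)%N by apply/card_gt0P; exists r.
  congr (_ * _); rewrite /D -[X in _ = X%:R - 1](prednK c0) -natr1 addrK.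
  by congr (_%:R); rewrite -(cardC1 r); apply: eq_card => s; rewrite !inE.
rewrite DV; move: tot; set S := \sum_(0 <= n < N) _; set T := \sum_(s | _) _ => tot hT.
have -> : S = N%:R - T by rewrite -tot addrK.
have : (D - 1) * ((D^-1 + eps / D) * N%:R) = (1 - D^-1 + eps - eps / D) * N%:R.
  by field; rewrite gt_eqF//; lra.
move=> E; rewrite E in hT.
have : 0 <= eps / D * N%:R by rewrite mulr_ge0// ltW.
lra.
Qed.

End ResidueBoxes.

(** * Large common prime factors *)

Section PrimeSums.

Lemma prod_primes_dvd (s : seq nat) m : uniq s -> all prime s ->
  all (fun p => p %| m)%N s -> (\prod_(p <- s) p %| m)%N.
Proof.
elim: s m => [|p s IH] m; first by rewrite big_nil dvd1n.
move=> /= /andP[ps us] /andP[pp sp] /andP[pm sm].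
rewrite big_cons Gauss_dvd ?pm ?IH//.
rewrite prime_coprime// Euclid_dvd_prod//.
rewrite big_has; apply/hasPn => q qs /=; rewrite dvdn_prime2//; last exact: (allP sp).
by apply: contraNneq ps => ->.
Qed.

Lemma prod_ge_pow (s : seq nat) b : all (fun p => b <= p)%N s ->
  (b ^ size s <= \prod_(p <- s) p)%N.
Proof.
elim: s => [|p s IH] /=; first by rewrite big_nil.
by move=> /andP[bp /IH h]; rewrite big_cons expnS leq_mul.
Qed.

Lemma prime_dvd_fact p n : prime p -> (p %| n`!)%N -> (p <= n)%N.
Proof.
move=> pp; elim: n => [|n IH]; first by rewrite fact0 dvdn1 => /eqP p1; move: pp; rewrite p1.
rewrite factS Euclid_dvdM// => /orP[/dvdn_leq -> //|/IH]; exact: leqW.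
Qed.

Lemma central_binomial_le n : ('C(n.*2, n) <= 4 ^ n)%N.
Proof.
have -> : (4 ^ n = (1 + 1) ^ n.*2)%N by rewrite -mul2n expnM.
rewrite expnDn.
have nn : (n < n.*2.+1)%N by rewrite ltnS -addnn leq_addr.
rewrite (bigD1 (Ordinal nn))//= !exp1n !muln1; exact: leq_addr.
Qed.

(** Chebyshev's argument: the primes in []n, 2 n]] divide the binomial coefficient [C(2 n, n)],
    which is at most [4 ^ n]. *)
Lemma count_primes_block n :
  (n ^ count prime (index_iota n.+1 n.*2.+1) <= 4 ^ n)%N.
Proof.
apply: leq_trans (central_binomial_le n).
rewrite -size_filter; set s := [seq p <- index_iota n.+1 n.*2.+1 | prime p].
have sP p : p \in s -> [/\ prime p, (n < p)%N & (p <= n.*2)%N].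
  by rewrite mem_filter mem_index_iota => /andP[-> /andP[-> ]]; rewrite ltnS => ->.
apply: (@leq_trans (\prod_(p <- s) p)).
  by apply: prod_ge_pow; apply/allP => p /sP[_ /ltnW].
apply: dvdn_leq; first by rewrite bin_gt0 -addnn leq_addr.
apply: prod_primes_dvd.
- exact/filter_uniq/iota_uniq.
- by apply/allP => p /sP[].
- apply/allP => p /sP[pp np pn].
  have := dvdn_fact (m := p) (n := n.*2); rewrite prime_gt0// pn => /(_ isT).
  have := @bin_fact n.*2 n; rewrite -addnn leq_addr addnK => /(_ isT) <-.
  rewrite !Euclid_dvdM// => /orP[//|/orP[]] /(prime_dvd_fact pp); lia.
Qed.

Variable R : realType.

Definition prime_sum (n : nat) : R := \sum_(0 <= p < n.+1 | prime p) p%:R^-1.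

(** For [n = 2 ^ j] the Chebyshev bound gives [j K <= 2 * 2 ^ j] for the number [K] of primes in the
    block, and each reciprocal is at most [2 ^ - j]. *)
Lemma prime_sum_block j : (0 < j)%N ->
  \sum_((2 ^ j).+1 <= p < (2 ^ j.+1).+1 | prime p) (p%:R^-1 : R) <= 2 / j%:R.
Proof.
move=> j0; have jR : 0 < j%:R :> R by rewrite ltr0n.
have pR : 0 < (2 ^ j)%:R :> R by rewrite ltr0n expn_gt0.
have c := count_primes_block (2 ^ j).
have E : (2 ^ j).*2 = (2 ^ j.+1)%N by rewrite expnS mul2n.
rewrite E in c; set K := count _ _ in c.
have {}c : (j * K <= 2 * 2 ^ j)%N.
  by move: c; rewrite -[4%N]/(2 ^ 2)%N -!expnM leq_exp2l.
apply: (@le_trans _ _ (\sum_((2 ^ j).+1 <= p < (2 ^ j.+1).+1 | prime p) (2 ^ j)%:R^-1)).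
  rewrite big_nat_cond [leRHS]big_nat_cond.
  apply: ler_sum => p /andP[/andP[p1 _] _].
  by rewrite lef_pV2 ?posrE ?ltr0n ?expn_gt0// ?ler_nat; lia.
rewrite big_const_seq iter_addr_0 -/K -[leLHS]mulr_natr mulrC.
rewrite ler_pdivrMr// mulrAC ler_pdivlMr// -!natrM ler_nat mulnC.
by [].
Qed.

Lemma harmonic_log n : \sum_(1 <= j < n.+2) (j%:R^-1 : R) <= 1 + ln n.+1%:R.
Proof.
elim: n => [|n IH]; first by rewrite big_nat1 invr1 ln1 addr0.
rewrite big_nat_recr//=; apply: (@le_trans _ _ (1 + ln n.+1%:R + n.+2%:R^-1)).
  by rewrite lerD2r.
rewrite -addrA lerD2l.
have h : ln (1 + - n.+2%:R^-1) <= - n.+2%:R^-1 :> R.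
  by apply: le_ln1Dx; rewrite ltrN2 invf_lt1// ltr1n.
have E : n.+1%:R = n.+2%:R * (1 + - n.+2%:R^-1) :> R.
  by rewrite mulrDr mulr1 mulrN mulfV ?pnatr_eq0// -[n.+2%:R]natr1 addrK.
have p0 : 0 < 1 + - n.+2%:R^-1 :> R by rewrite subr_gt0 invf_lt1// ltr1n.
have h2 : ln n.+1%:R = ln n.+2%:R + ln (1 + - n.+2%:R^-1) :> R.
  by rewrite -lnM ?posrE// -E.
by rewrite h2 -addrA gerDl -lerBrDr sub0r.
Qed.

(** The dyadic blocks cost [2 / j] each, so a harmonic sum in the exponent remains: a double
    logarithm. *)
Lemma prime_sum_pow2 n : prime_sum (2 ^ n.+1) <= 3 + 2 * ln n.+1%:R.
Proof.
suff h : prime_sum (2 ^ n.+1) <= 1 + 2 * \sum_(1 <= j < n.+1) (j%:R^-1 : R).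
  apply: le_trans h _; case: n => [|n].
    by rewrite big_geq// ln1; lra.
  have := harmonic_log n; have : ln n.+1%:R <= ln n.+2%:R :> R.
    by rewrite ler_ln ?posrE// ler_nat.
  lra.
elim: n => [|n IH].
  rewrite big_geq// /prime_sum expn1 big_mkcond/= !big_nat_recl//= big_geq//=.
  by rewrite !add0r addr0 mulr0 addr0 invf_le1// ler1n.
rewrite /prime_sum (@big_cat_nat _ _ _ (2 ^ n.+1).+1)//=; last by rewrite ltnS leq_exp2l.
have := @prime_sum_block n.+1 isT.
have -> : \sum_(1 <= j < n.+2) (j%:R^-1 : R) = \sum_(1 <= j < n.+1) j%:R^-1 + n.+1%:R^-1.
  by rewrite big_nat_recr.
by move: IH; rewrite /prime_sum; move: (n.+1%:R^-1) => c; lra.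
Qed.

Lemma prime_sum_ge0 n : 0 <= prime_sum n.
Proof. by apply: sumr_ge0 => p _; rewrite invr_ge0. Qed.

Lemma natr_count (T : Type) (P : pred T) (s : seq T) :
  (count P s)%:R = \sum_(n <- s) (P n)%:R :> R.
Proof. by elim: s => [|x s IH] /=; rewrite ?big_nil// big_cons natrD IH. Qed.

Lemma sum_range_mono (F : nat -> R) (P : pred nat) a b c : (a <= b)%N -> (b <= c)%N ->
  (forall n, 0 <= F n) -> \sum_(a <= n < b | P n) F n <= \sum_(a <= n < c | P n) F n.
Proof.
move=> ab bc F0; rewrite [leRHS](@big_cat_nat _ _ _ b)//= lerDl.
by apply: sumr_ge0.
Qed.

(** At most [L] prime divisors of [Q] exceed [y], since their product divides [Q <= 2 ^ L]; each
    contributes at most [1 / y]. *)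
Lemma recip_prime_divisors (Q X L y : nat) : (0 < Q <= 2 ^ L)%N -> (0 < y)%N ->
  \sum_(0 <= p < X | prime p && (p %| Q)%N) (p%:R^-1 : R) <= prime_sum y + L%:R / y%:R.
Proof.
move=> /andP[Q0 QL] y0; rewrite (bigID (fun p => (p <= y)%N))/=; apply: lerD.
  apply: (@le_trans _ _ (\sum_(0 <= p < maxn X y.+1 | prime p && (p <= y)%N) (p%:R^-1 : R))).
    apply: le_trans (sum_range_mono _ _ (leq_maxl X y.+1) _) _ => //.
    rewrite [leLHS]big_mkcond [leRHS]big_mkcond; apply: ler_sum => p _.
    case: (prime p); case: (p %| Q)%N; case: (p <= y)%N => //=.
  rewrite (@big_cat_nat _ _ _ y.+1)//= ?leq_maxr// [X in _ + X]big_nat_cond.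
  rewrite [X in _ + X]big_pred0; last first.
    by move=> p; apply/negbTE/negP => /andP[/andP[? _] /andP[_ ?]]; lia.
  rewrite addr0 /prime_sum big_nat_cond [leRHS]big_nat_cond le_eqVlt; apply/orP; left; apply/eqP.
  by apply: eq_bigl => p; case: (prime p); rewrite ?andbF//= andbT; lia.
pose s := [seq p <- index_iota 0 X | (prime p && (p %| Q)) && ~~ (p <= y)]%N.
have ss : (size s <= L)%N.
  rewrite -(@leq_exp2l 2)//; apply: leq_trans QL.
  apply: (@leq_trans (\prod_(p <- s) p)).
    by apply: prod_ge_pow; apply/allP => p; rewrite mem_filter => /andP[/andP[/andP[/prime_gt1]]].
  apply: dvdn_leq => //; apply: prod_primes_dvd.
  - exact/filter_uniq/iota_uniq.
  - by apply/allP => p; rewrite mem_filter => /andP[/andP[/andP[]]].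
  - by apply/allP => p; rewrite mem_filter => /andP[/andP[/andP[]]].
apply: (@le_trans _ _ (\sum_(0 <= p < X | (prime p && (p %| Q)%N) && ~~ (p <= y)%N) (y%:R^-1 : R))).
  apply: ler_sum => p /andP[_ py].
  by rewrite lef_pV2 ?posrE ?ltr0n// ?ler_nat; lia.
rewrite -big_filter -/s big_const_seq iter_addr_0 count_predT.
rewrite -[leLHS]mulr_natl ler_wpM2r ?invr_ge0//.
by rewrite ler_nat.
Qed.

Lemma recip_squares_tail D X : (0 < D)%N ->
  \sum_(D.+1 <= p < X) (p%:R ^- 2 : R) <= D%:R^-1.
Proof.
move=> D0; have DR : 0 < D%:R :> R by rewrite ltr0n.
have [XD|DX] := leqP X D.+1; first by rewrite big_geq// invr_ge0.
suff h m : \sum_(D.+1 <= p < D.+1 + m) (p%:R ^- 2 : R) <= D%:R^-1 - (D + m)%:R^-1.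
  have := h (X - D.+1)%N; rewrite subnKC ?(ltnW DX)// => /le_trans; apply.
  by rewrite gerBl invr_ge0.
elim: m => [|m IH]; first by rewrite !addn0 big_geq// subrr.
rewrite addnS big_nat_recr/=; last by lia.
have e1 : (D.+1 + m)%:R = (D + m)%:R + 1 :> R by rewrite addSn natr1.
have e2 : (D + m.+1)%:R = (D + m)%:R + 1 :> R by rewrite addnS natr1.
move: IH; rewrite e1 e2; set z := (D + m)%:R.
have z0 : 0 < z by rewrite /z ltr0n; lia.
have : (z + 1) ^- 2 <= z^-1 - (z + 1)^-1.
  rewrite (_ : z^-1 - _ = (z * (z + 1))^-1); last by field; rewrite !gt_eqF//; lra.
  rewrite lef_pV2 ?posrE ?mulr_gt0 ?exprn_gt0//; lra.
lra.
Qed.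

(** The quotients by [p] of the counted integers are distinct and lie within [del / p] of the first
    one. *)
Lemma count_spaced (P : pred nat) a b p (del : R) : (0 < p)%N -> 0 <= del ->
  (forall n, (a <= n < b)%N -> P n -> (p %| n)%N) ->
  (forall n n', (a <= n)%N -> (n <= n')%N -> (n' < b)%N -> P n -> P n' ->
     (n' - n)%:R <= del) ->
  (count P (index_iota a b))%:R <= del / p%:R + 1.
Proof.
move=> p0 del0 Pp Pd; have pR : 0 < p%:R :> R by rewrite ltr0n.
pose K := Num.truncn (del / p%:R).
have dp : 0 <= del / p%:R by rewrite divr_ge0.
suff h : (count P (index_iota a b) <= K.+1)%N.
  apply: (@le_trans _ _ (K.+1%:R)); first by rewrite ler_nat.
  by rewrite -natr1 lerD2r truncn_le.
rewrite -size_filter; case E : [seq n <- index_iota a b | P n] => [//|n0 s].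
rewrite -E; set t := [seq n <- index_iota a b | P n] in E *.
have tP n : n \in t -> [/\ P n, (a <= n)%N & (n < b)%N].
  by rewrite mem_filter mem_index_iota => /andP[-> /andP[-> ->]].
have n0t : n0 \in t by rewrite E mem_head.
have n0le n : n \in t -> (n0 <= n)%N.
  have : sorted ltn t by apply: sorted_filter; [exact: ltn_trans|exact: iota_ltn_sorted].
  rewrite E /= (path_sortedE ltn_trans) => /andP[/allP h _].
  by rewrite inE => /orP[/eqP->//|/h /ltnW].
have [P0 a0 b0] := tP _ n0t.
have div n : n \in t -> (p %| n)%N.
  by move=> /tP[h1 h2 h3]; apply: Pp => //; rewrite h2.
pose g n := (n %/ p - n0 %/ p)%N.
have ginj : {in t &, injective g}.
  move=> n n' nt n't; rewrite /g => e.
  have h1 : (n0 %/ p <= n %/ p)%N by apply: leq_div2r; exact: n0le.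
  have h2 : (n0 %/ p <= n' %/ p)%N by apply: leq_div2r; exact: n0le.
  have {}e : (n %/ p = n' %/ p)%N by lia.
  by rewrite -(divnK (div _ nt)) e divnK ?div.
rewrite -(size_map g) -(size_iota 0 K.+1); apply: uniq_leq_size.
  by rewrite map_inj_in_uniq// filter_uniq// iota_uniq.
move=> _ /mapP[n nt ->]; rewrite mem_iota add0n ltnS/=.
have [Pn an bn] := tP _ nt.
have := Pd n0 n a0 (n0le _ nt) bn P0 Pn.
have -> : (n - n0 = g n * p)%N by rewrite /g mulnBl !divnK ?div.
rewrite natrM -ler_pdivlMr// => h.
by rewrite /K truncn_ge_nat.
Qed.

End PrimeSums.

(** * Counting the n that share a large prime with their image *)

Section TailCount.
Variable R : realType.

Lemma natr_has_le (T : Type) (P : pred T) (s : seq T) :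
  (has P s)%:R <= \sum_(x <- s) (P x)%:R :> R.
Proof.
elim: s => [|x s IH] /=; first by rewrite big_nil.
rewrite big_cons; case: (P x) => /=; last by rewrite add0r.
by rewrite lerDl sumr_ge0.
Qed.

Lemma natr_bool_sum (F : nat -> bool) (c : bool) m a b : (a <= m < b)%N ->
  \sum_(a <= i < b | F i) ((m == i) && c)%:R = (c && F m)%:R :> R.
Proof.
move=> mab; rewrite big_mkcond (bigD1_seq m) ?mem_index_iota ?iota_uniq//=.
rewrite eqxx big1 ?addr0; first by case: (F m); rewrite ?andbT ?andbF.
by move=> i /negbTE im; rewrite eq_sym im; case: (F i).
Qed.

Variables (phi : nat -> nat) (a b m0 m1 : nat) (del : R).
Hypothesis phim : forall n, (a <= n < b)%N -> (m0 <= phi n <= m1)%N.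
Hypothesis m0_gt0 : (0 < m0)%N.
Hypothesis m01 : (m0 <= m1)%N.
Hypothesis del0 : 0 <= del.
Hypothesis spread : forall n n', (a <= n)%N -> (n <= n')%N -> (n' < b)%N ->
  phi n = phi n' -> (n' - n)%:R <= del.

Let mult p : R := (count (fun m => p %| m)%N (index_iota m0 m1.+1))%:R.

(** The [n] are sorted by the value [phi n], a multiple of [p]; by [spread] those with a common
    value lie within [del] of each other. *)
Lemma count_prime_le p : (0 < p)%N ->
  (count (fun n => (p %| n) && (p %| phi n))%N (index_iota a b))%:R <=
  mult p * (del / p%:R + 1).
Proof.
move=> p0; rewrite natr_count big_nat.
under eq_bigr => n nab do
  rewrite -(@natr_bool_sum (fun m => p %| m)%N (p %| n)%N (phi n) m0 m1.+1 (phim nab)).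
rewrite -big_nat exchange_big_nat/=.
apply: (@le_trans _ _ (\sum_(m0 <= i < m1.+1 | (p %| i)%N) (del / p%:R + 1))); last first.
  by rewrite big_const_seq iter_addr_0 -[leLHS]mulr_natl.
apply: ler_sum => i _; rewrite -natr_count; apply: count_spaced => //.
  by move=> n _ /andP[].
by move=> n n' an nn nb /andP[/eqP h1 _] /andP[/eqP h2 _]; apply: spread => //; rewrite h1 h2.
Qed.

Let Q := (\prod_(m0 <= m < m1.+1) m)%N.

Lemma mult_le_range p : (0 < p)%N -> prime p ->
  mult p <= (p %| Q)%N%:R * ((m1 - m0)%:R / p%:R + 1).
Proof.
move=> p0 pp; have [pQ|pQ] := boolP (p %| Q)%N.
  rewrite mul1r; apply: count_spaced => // n n' an nn nb _ _.
  by rewrite ler_nat; lia.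
rewrite mul0r /mult (_ : count _ _ = 0%N)//; apply/eqP; rewrite -leqn0 leqNgt -has_count.
apply: contra pQ => /hasP[m mm pm]; rewrite /Q Euclid_dvd_prod// big_has.
by apply/hasP; exists m.
Qed.

Lemma mult_le_quot p : (0 < p)%N -> mult p <= m1%:R / p%:R.
Proof.
move=> p0; have pR : 0 < p%:R :> R by rewrite ltr0n.
have [mp|pm] := ltnP m1 p.
  rewrite /mult (_ : count _ _ = 0%N) ?divr_ge0//; apply/eqP.
  rewrite -leqn0 leqNgt -has_count; apply/hasPn => m; rewrite mem_index_iota => /andP[h1 h2].
  by apply/negP => /dvdn_leq; lia.
rewrite (_ : m1%:R / p%:R = (m1 - p)%:R / p%:R + 1); last first.
  by rewrite natrB//; field; rewrite gt_eqF.
apply: count_spaced => // n n' an nn nb pn pn'.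
by rewrite ler_nat; have := dvdn_leq _ pn; lia.
Qed.

(** In [mult p * (del / p + 1)], the product with [del / p] is bounded by [mult_le_range] and splits
    into [T1], summed as a tail of inverse squares, and [T2], restricted to the prime divisors of
    [Q]; the product with 1 is bounded by [mult_le_quot] and gives [T3]. *)
Lemma tail_count (D L y : nat) : (0 < D)%N -> (0 < y)%N ->
  (m1 ^ (m1 - m0).+1 <= 2 ^ L)%N ->
  (count (fun n => has (fun p => [&& prime p, p %| n & p %| phi n]%N)
     (index_iota D.+1 m1.+1)) (index_iota a b))%:R <=
  del * (m1 - m0)%:R / D%:R + del * (prime_sum R y + L%:R / y%:R) +
  m1%:R * prime_sum R m1.
Proof.
move=> D0 y0 mL; rewrite natr_count.
apply: (@le_trans _ _ (\sum_(a <= n < b) \sum_(D.+1 <= p < m1.+1)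
    ([&& prime p, p %| n & p %| phi n]%N)%:R)).
  by apply: ler_sum => n _; exact: natr_has_le.
rewrite exchange_big_nat/=.
have Q0 : (0 < Q)%N.
  by rewrite /Q big_nat; apply: prodn_cond_gt0 => m; lia.
have QL : (Q <= 2 ^ L)%N.
  apply: leq_trans mL; rewrite -subSn// -prod_nat_const_nat /Q big_nat [leqRHS]big_nat.
  by apply: leq_prod => m; rewrite ltnS => /andP[].
pose T1 p : R := (m1 - m0)%:R * del * p%:R ^- 2.
pose T2 p : R := if prime p && (p %| Q)%N then del * p%:R^-1 else 0.
pose T3 p : R := if prime p then m1%:R * p%:R^-1 else 0.
have iv0 p : 0 <= p%:R^-1 :> R by rewrite invr_ge0.
apply: (@le_trans _ _ (\sum_(D.+1 <= p < m1.+1) (T1 p + (T2 p + T3 p)))).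
  apply: ler_sum_nat => p /andP[Dp pm].
  have p0 : (0 < p)%N by lia.
  have pR : 0 < p%:R :> R by rewrite ltr0n.
  have T10 : 0 <= T1 p by rewrite !mulr_ge0// invr_ge0 exprn_ge0.
  rewrite /T2 /T3; have [pp|npp] := boolP (prime p); last first.
    by rewrite big1//= ?addr0.
  have /= := count_prime_le p0; rewrite natr_count => /le_trans; apply.
  rewrite mulrDr mulr1 addrA; apply: lerD; last by rewrite -[_ * _^-1]/(_ / _) mult_le_quot.
  apply: (@le_trans _ _ ((p %| Q)%N%:R * ((m1 - m0)%:R / p%:R + 1) * (del / p%:R))).
    by rewrite ler_wpM2r ?mult_le_range// mulr_ge0.
  case: (p %| Q)%N; rewrite /= ?mul0r ?addr0//.
  rewrite mul1r le_eqVlt; apply/orP; left; apply/eqP; rewrite /T1; field.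
  by rewrite gt_eqF.
rewrite big_split/= big_split/= addrA.
have ext (F : nat -> R) : (forall n, 0 <= F n) ->
    \sum_(D.+1 <= p < m1.+1) F p <= \sum_(0 <= p < m1.+1) F p.
  move=> F0; have [Dm|mD] := leqP D.+1 m1.+1.
    by rewrite [leRHS](@big_cat_nat _ _ _ D.+1)//= lerDr sumr_ge0.
  by rewrite big_geq ?sumr_ge0// ltnW.
apply: lerD; first apply: lerD.
- rewrite -mulr_sumr [del * _]mulrC ler_wpM2l ?mulr_ge0//.
  exact: recip_squares_tail.
- apply: le_trans (ext _ _) _.
    by move=> p; rewrite /T2; case: ifP => // _; rewrite mulr_ge0.
  rewrite -big_mkcond -mulr_sumr ler_wpM2l//.
  by apply: recip_prime_divisors; rewrite ?Q0.
- apply: le_trans (ext _ _) _.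
    by move=> p; rewrite /T3; case: ifP => // _; rewrite mulr_ge0.
  by rewrite -big_mkcond -mulr_sumr.
Qed.

End TailCount.

(** * Large shared primes for the slowest function *)

Section SlowHardyFunction.
Variables (R : realType) (H : set (R -> R)) (hH : hardy_field H).

Lemma near_natr (P : R -> Prop) : (\forall t \near +oo_R, P t) ->
  \forall n \near \oo, P n%:R.
Proof.
move=> /(near_nat_pinfty (@ltr01 R)); apply: filterS => n h.
by apply: h; rewrite mul1r.
Qed.

Lemma is_derive_linear (c x : R) : is_derive x (1 : R) (fun x : R => c * x) c.
Proof.
have h := @is_deriveZ R R^o R^o id c x 1 1 (is_derive_id _ _).
by apply: is_derive_eq h _; rewrite /GRing.scale/= mulr1.
Qed.

(* The reciprocal [v] of [f'] is concave and positive, so [v t / (t - A)] is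
   nonincreasing. *)
Lemma hardy_slow_derivative (f : R -> R) : H f ->
  (forall c : R, 0 < c -> \forall t \near +oo_R, f t <= c * t ^+ 1) ->
  (forall C : R, \forall t \near +oo_R, C * ln t + C <= f t) ->
  exists2 A : R, 1 <= A &
    [/\ forall t, A <= t -> is_derive t (1 : R) f (der f t),
        forall t, A <= t -> 0 < der f t,
        forall s t, A <= s -> s <= t -> der f t <= der f s &
        forall s t, A <= s -> s <= t -> (s - A) * der f s <= (t - A) * der f t].
Proof.
move=> Hf up low.
have [|||w0 dw we wM] := hardy_top_derivative hH (j := 0) (p := 1) (Psi := @ln R) Hf up.
- by move=> t t1; rewrite expr1; apply: is_derive1_ln; lra.
- exact: near_ln_ge.
- exact: low.
rewrite /= in w0 dw we wM.
have Hw := hardy_derive1 hH Hf.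
have [v Hv vE] := hardy_inv_pos hH Hw w0.
have Hdv := hardy_derive1 hH Hv.
have voo (M : R) : \forall t \near +oo_R, M <= v t.
  have M1 : 0 < `|M| + 1 by rewrite ltr_wpDl.
  have i0 : 0 < (`|M| + 1)^-1 by rewrite invr_gt0.
  apply: filterS (filterI vE (filterI w0 (we _ i0))) => t [[_ ->] [wp wle]].
  apply: le_trans (ler_norm _) _; apply: (@le_trans _ _ (`|M| + 1)); first by rewrite lerDl.
  by rewrite -[leLHS]invrK lef_pV2 ?posrE.
(* The derivative of [v] tends to 0, since [v >= c' t] would keep [t f'] bounded, and it is positive
   because [v -> oo]. A positive germ of the field that tends to 0 is nonincreasing, so [v] is
   concave. *)
have dvs (eps : R) : 0 < eps -> \forall t \near +oo_R, der v t <= eps.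
  apply: (hardy_small hH) => // c c0 h.
  have [||c' c'0 {}h] := @deriv_lower R v c 0 c0; first exact: (hardy_derivable hH).
    by apply: filterS h => t; rewrite expr0 mulr1.
  have [B B1 hB] := near_pinftyP (filterI h (filterI vE (filterI w0 (wM (2 / c'))))).
  have [e1 [[vp ve] [wp e2]]] := hB B (lexx _).
  rewrite expr1 ler_pdivrMr// in e2; rewrite expr1 ve in e1.
  have : c' * B * der f B <= 1 by rewrite -ler_pdivlMr// mul1r.
  lra.
have dv0 : \forall t \near +oo_R, 0 < der v t.
  have [//|h] := hardy_cmp hH (hardy_cst0 hH) Hdv.
  have [B B1 hB] := near_pinftyP (filterI h (hardy_derivable hH Hv)).
  have [B' B'1 hB'] := near_pinftyP (voo (v B + 1)).
  pose t := Num.max B B'; have Bt : B <= t by rewrite le_max lexx.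
  have := @is_derive_compare R v (der v) (cst 0) (cst 0) B _ _ _ B t (lexx _) Bt.
  move=> /(_ _ _)K; have {K} : v t - v B <= cst 0 t - cst 0 B :> R.
    apply: K => //; first by move=> x /hB[_ dx]; exact: derive1_is_derive.
    by move=> x /hB[].
  have := hB' t; rewrite le_max lexx orbT => /(_ isT); rewrite /=; lra.
have ddv := hardy_nonincr hH Hdv dv0 dvs.
have [A A1 hA] := near_pinftyP (filterI (filterI w0 dw) (filterI vE (filterI ddv
  (filterI (hardy_derivable hH Hf) (filterI (hardy_derivable hH Hw)
  (filterI (hardy_derivable hH Hv) (hardy_derivable hH Hdv))))))).
exists A => //.
have df t : A <= t -> is_derive t (1 : R) f (der f t).
  by move=> /hA[_ [_ [_ [h _]]]]; exact: derive1_is_derive.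
have dfp t : A <= t -> is_derive t (1 : R) (der f) (der (der f) t).
  by move=> /hA[_ [_ [_ [_ [h _]]]]]; exact: derive1_is_derive.
have dv t : A <= t -> is_derive t (1 : R) v (der v t).
  by move=> /hA[_ [_ [_ [_ [_ [h _]]]]]]; exact: derive1_is_derive.
have dvp t : A <= t -> is_derive t (1 : R) (der v) (der (der v) t).
  by move=> /hA[_ [_ [_ [_ [_ [_ h]]]]]]; exact: derive1_is_derive.
have mono (g dg : R -> R) : (forall t, A <= t -> is_derive t (1 : R) g (dg t)) ->
    (forall t, A <= t -> dg t <= 0) -> forall s t, A <= s -> s <= t -> g t <= g s.
  move=> h1 h2 s t As st.
  have := @is_derive_compare R g dg (cst 0) (cst 0) A _ _ _ s t As st.
  move=> /(_ _ _)K; have {K} : g t - g s <= cst 0 t - cst 0 s :> R by apply: K.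
  rewrite /=; lra.
have wpos t : A <= t -> 0 < der f t by move=> /hA[[h _] _].
split=> //.
  by apply: mono dfp _ => t /hA[[_ h] _].
move=> s t As; rewrite le_eqVlt => /orP[/eqP-> //|st].
have ddvm : forall x y, A <= x -> x <= y -> der v y <= der v x.
  by apply: mono dvp _ => x /hA[_ [_ [h _]]].
have vpos x : A <= x -> 0 < v x by move=> /hA[_ [[h _] _]].
have vw x : A <= x -> v x = (der f x)^-1 by move=> /hA[_ [[_ h] _]].
have [x2 /andP[sx2 x2t] E2] := is_derive_mvt As st dv.
have key : (s - A) * v t <= (t - A) * v s.
  move: As; rewrite le_eqVlt => /orP[/eqP e|As].
    by rewrite -e subrr mul0r; apply: mulr_ge0; [rewrite subr_ge0; lra|apply/ltW/vpos].
  have [x1 /andP[Ax1 x1s] E1] := is_derive_mvt (lexx A) As dv.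
  have d12 : der v x2 <= der v x1 by apply: ddvm; lra.
  have vA := vpos A (lexx A).
  have : der v x2 * ((t - s) * (s - A)) <= der v x1 * ((t - s) * (s - A)).
    by rewrite ler_wpM2r// mulr_ge0; lra.
  rewrite !mulrA -E2 mulrAC -[X in X * (t - s)]E1.
  have : 0 <= v A * (t - s) by rewrite mulr_ge0//; lra.
  lra.
have At : A <= t by lra.
have ws := wpos s As; have wt := wpos t At.
move: key; rewrite (vw s As) (vw t At).
by rewrite ler_pdivrMr// mulrAC ler_pdivlMr.
Qed.

Lemma ln2_bounds : 2^-1 <= ln (2 : R) <= 1.
Proof.
apply/andP; split.
  have : ln (1 + - 2^-1) <= - 2^-1 :> R by apply: le_ln1Dx; lra.
  rewrite (_ : 1 + - 2^-1 = 2^-1); last by field.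
  by rewrite lnV ?posrE// lerN2.
by rewrite -[X in ln X](_ : 1 + 1 = 2)//; apply: le_ln1Dx; lra.
Qed.

(** With [z = exp (eps s / 16)], the left side is [O(exp (2 z))] and the right side is
    [exp (z ^ 2 / 2)]. *)
Lemma doubly_exponential_growth (eps : R) : 0 < eps -> exists S0 : R, forall s, S0 <= s ->
  (2 / eps * s + 2) * (2 * (1 + s + expR (expR (eps / 16 * s))) + 1) <=
  expR (expR (eps / 8 * s) / 2).
Proof.
move=> e0; pose c := 16 / eps; have c0 : 0 < c by rewrite divr_gt0.
have i0 : 0 < 2 / eps by rewrite divr_gt0.
pose K := 2 / eps * c + 2; pose K' := 2 * (1 + c + 1) + 1.
have Kp : 0 < K by rewrite addr_gt0// mulr_gt0.
have K'p : 0 < K' by rewrite /K'; lra.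
pose Z0 := Num.max 8 (ln (K * K')).
have Z8 : 8 <= Z0 by rewrite le_max lexx.
exists (Z0 * c) => s hs.
pose z := expR (eps / 16 * s).
have sz : eps / 16 * s <= z.
  by have := expR_ge1Dx (eps / 16 * s); rewrite /z; lra.
have zZ : Z0 <= z.
  apply: le_trans sz; rewrite mulrC -ler_pdivrMr ?divr_gt0//.
  by rewrite invf_div.
have scz : s <= c * z.
  by move: sz; rewrite mulrC -ler_pdivlMr ?divr_gt0// invf_div mulrC.
have -> : expR (eps / 8 * s) = z ^+ 2.
  by rewrite /z -expRM_natl; congr expR; field.
pose E := expR z.
have zE : z <= E by have := expR_ge1Dx z; rewrite /E; lra.
have E1 : 1 <= E by rewrite /E -expR0 ler_expR; lra.
have s0 : 0 <= s by apply: le_trans hs; rewrite mulr_ge0// ?(ltW c0)//; lra.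
have scE : s <= c * E by apply: le_trans scz _; rewrite ler_pM2l.
have h1 : 2 / eps * s + 2 <= K * E.
  have : 2 / eps * s <= 2 / eps * (c * E) by rewrite ler_pM2l.
  rewrite /K; lra.
have h2 : 2 * (1 + s + E) + 1 <= K' * E by rewrite /K'; lra.
rewrite -/z -/E; apply: (@le_trans _ _ ((K * E) * (K' * E))).
  by apply: ler_pM => //; [rewrite addr_ge0// mulr_ge0// ltW|lra].
have KK : 0 < K * K' by rewrite mulr_gt0.
rewrite (_ : _ * _ = (K * K') * (E * E)); last by ring.
rewrite -(lnK (_ : K * K' \in Num.pos)) ?posrE// /E -!expRD ler_expR.
have : ln (K * K') <= z by apply: le_trans zZ; rewrite le_max lexx orbT.
have : z * 8 <= z * z by rewrite ler_pM2l; lra.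
rewrite expr2; lra.
Qed.

Definition shares_prime (phi : nat -> nat) (D n : nat) : bool :=
  has (fun p => [&& prime p, p %| n & p %| phi n]%N) (index_iota D.+1 n.+1).

Lemma iter_log4_exp (t : R) : 0 < ln (ln t) -> 0 < ln (ln (ln t)) ->
  ln (ln t) = expR (expR (iter_log 4 t)).
Proof. by move=> h1 h2; rewrite /iter_log/= !lnK ?posrE. Qed.

Lemma near_ln_comp_ge (M : R) (g : R -> R) :
  (forall A : R, \forall t \near +oo_R, A <= g t) -> \forall t \near +oo_R, M <= ln (g t).
Proof.
move=> h; have [A A1 hA] := near_pinftyP (near_ln_ge M).
by apply: filterS (h A) => t; exact: hA.
Qed.

Lemma near_iter_log_ge n (M : R) : \forall t \near +oo_R, M <= iter_log n t.
Proof.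
elim: n M => [|n IH] M; first exact: near_pinfty_ge.
exact: near_ln_comp_ge.
Qed.

Lemma prime_sum_mono m n : (m <= n)%N -> prime_sum R m <= prime_sum R n.
Proof. by move=> mn; apply: sum_range_mono => // p; rewrite invr_ge0. Qed.

(** If [2 ^ n <= N < 2 ^ n.+1], then [n + 1 <= 3 ln N] as [ln 2 >= 1 / 2], and
    [3 + 2 (2 + ln ln N) <= 9 ln ln N]. *)
Lemma prime_sum_loglog (N : nat) : (0 < N)%N -> 1 <= ln (ln (N%:R : R)) ->
  prime_sum R N <= 9 * ln (ln N%:R).
Proof.
move=> N0 h; pose n := trunc_log 2 N.
have n1 : (2 ^ n <= N)%N by exact: trunc_logP.
have n2 : (N < 2 ^ n.+1)%N by exact: trunc_log_ltn.
have /andP[l2 l2'] := ln2_bounds.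
have l1 : 0 < ln (N%:R : R).
  by rewrite ltNge; apply/negP => h0; move: h; rewrite ln0//; lra.
have le3 : n.+1%:R <= 3 * ln (N%:R : R).
  have : ln (2 ^+ n) <= ln (N%:R : R) :> R.
    by rewrite ler_ln ?posrE ?exprn_gt0 ?ltr0n// -natrX ler_nat.
  rewrite lnXn// -[leLHS]mulr_natl => h1.
  have h2 : n%:R * 2^-1 <= n%:R * ln 2 :> R by rewrite ler_wpM2l.
  have : 1 <= ln (N%:R : R).
    rewrite -[leLHS]expR0; rewrite -[leRHS](lnK (_ : _ \in Num.pos)) ?posrE//.
    by rewrite ler_expR; lra.
  rewrite -natr1; lra.
have lle : ln n.+1%:R <= 2 + ln (ln (N%:R : R)).
  apply: (@le_trans _ _ (ln (3 * ln (N%:R : R)))).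
    by rewrite ler_ln ?posrE// mulr_gt0.
  rewrite lnM ?posrE// lerD2r.
  by have : ln (1 + 2) <= 2 :> R; [apply: le_ln1Dx; lra | rewrite (_ : 1 + 2 = 3)//; ring].
apply: le_trans (prime_sum_mono (ltnW n2)) _.
apply: le_trans (prime_sum_pow2 _ _) _; lra.
Qed.

(* With [s = N f'(N)], the cut-off [y = 2 ^ J.+1], [J ~ exp (eps s / 8)], is
   large enough to bound the number of prime divisors of the product of the
   integers in [[f a, f N]], while [prime_sum y = o(s)]; this is where
   [log log log log N = o(s)] is used. *)
Lemma window_tail (eps s x : R) (m0 m1 : nat) : 0 < eps ->
  8 / eps <= s -> 1 <= s -> (0 < m0 <= m1)%N ->
  (2 / eps * s + 2) * (2 * (1 + s + expR (expR (eps / 16 * s))) + 1) <=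
    expR (expR (eps / 8 * s) / 2) ->
  (m1 - m0)%:R <= 2 / eps * s + 1 -> 0 < x ->
  m1%:R <= 2 * s * x -> 0 <= ln x -> ln x <= expR (expR (eps / 16 * s)) ->
  exists L y : nat, [/\ (0 < y)%N, (m1 ^ (m1 - m0).+1 <= 2 ^ L)%N &
    prime_sum R y + L%:R / y%:R <= eps * s].
Proof.
move=> e0 es s1 /andP[m00 m01] grow m10 x0 m1x lx0 lxE.
have /andP[l2 l2'] := ln2_bounds.
have lp : 0 < ln (2 : R) by lra.
pose J := Num.truncn (expR (eps / 8 * s)).
pose y := (2 ^ J.+1)%N; have y0 : (0 < y)%N by rewrite expn_gt0.
(* The bound on the number of binary digits is taken equal to the cut-off, so that [L / y = 1]. *)
exists y, y; split=> //.
  pose l := (Num.truncn (2 * (1 + s + ln x))).+1.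
  have lx1 : 0 <= 2 * (1 + s + ln x) by lra.
  have ll : 2 * (1 + s + ln x) <= l%:R by apply: ltW; exact: truncnS_gt.
  have lu : l%:R <= 2 * (1 + s + ln x) + 1 by rewrite /l -natr1 lerD2r truncn_le.
  have m1l : (m1 <= 2 ^ l)%N.
    rewrite -(ler_nat R) natrX; apply: le_trans m1x _.
    have s0 : 0 < s by lra.
    rewrite -[leLHS](lnK (_ : _ \in Num.pos)) ?posrE ?mulr_gt0//.
    rewrite -[leRHS](lnK (_ : _ \in Num.pos)) ?posrE ?exprn_gt0// ler_expR.
    rewrite lnXn// -[leRHS]mulr_natl !lnM ?posrE ?mulr_gt0//.
    have : ln s < s by exact: ln_sublinear.
    have : 2 * (1 + s + ln x) * 2^-1 <= l%:R * ln 2 by rewrite ler_pM//; lra.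
    lra.
  apply: (@leq_trans ((2 ^ l) ^ (m1 - m0).+1)); first by rewrite leq_exp2r.
  rewrite -expnM leq_exp2l// -(ler_nat R) natrM.
  apply: (@le_trans _ _ ((2 / eps * s + 2) * (2 * (1 + s + expR (expR (eps / 16 * s))) + 1))).
    rewrite mulrC ler_pM//; first by rewrite -natr1; lra.
    by apply: le_trans lu _; lra.
  apply: le_trans grow _.
  rewrite natrX -[leRHS](lnK (_ : _ \in Num.pos)) ?posrE ?exprn_gt0// ler_expR.
  rewrite lnXn// -[leRHS]mulr_natl [leRHS]mulrC mulrC ler_pM// ?invr_ge0// ?expR_ge0//.
  by apply: ltW; exact: truncnS_gt.
have -> : y%:R / y%:R = 1 :> R by rewrite mulfV// pnatr_eq0 -lt0n.
(* The total is at most [3 + 2 (1 + eps s / 8) + 1], which is below [eps s] because [eps s >= 8]. *)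
have h1 := prime_sum_pow2 R J; rewrite -/y in h1.
have h2 : ln J.+1%:R <= 1 + eps / 8 * s.
  have e1 : 1 <= expR (eps / 8 * s) by rewrite -[leLHS]expR0 ler_expR mulr_ge0//; lra.
  apply: (@le_trans _ _ (ln (2 * expR (eps / 8 * s)))).
    rewrite ler_ln ?posrE ?mulr_gt0 ?expR_gt0// -natr1.
    have : J%:R <= expR (eps / 8 * s) by rewrite truncn_le// expR_ge0.
    lra.
  by rewrite lnM ?posrE ?expR_gt0// expRK lerD2r.
rewrite ler_pdivrMr// in es; lra.
Qed.

(** Here [w] stands for the derivative of [f]. The [n] up to [eps N] cost one [eps N], and each of
    the three terms of [tail_count], applied beyond [eps N] with [del = 1 / w N], costs another. *)
Lemma shared_primes_at (f w : R -> R) (A eps : R) (N D : nat)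
  (phi := fun n : nat => `|Num.floor (f n%:R)|%N) (s := N%:R * w N%:R) :
  1 <= A -> 0 < eps -> eps <= 2^-1 -> (2 / eps + 1) / eps <= D%:R -> (0 < D)%N ->
  (forall t, A <= t -> 0 < w t) ->
  (forall s t, A <= s -> s <= t -> w t <= w s) ->
  (forall s t, A <= s -> s <= t -> (s - A) * w s <= (t - A) * w t) ->
  (forall s t, A <= s -> s <= t -> f s <= f t) ->
  (forall s t, A <= s -> s <= t -> w t * (t - s) <= f t - f s) ->
  (forall s t, A <= s -> s <= t -> f t - f s <= w s * (t - s)) ->
  (forall t, eps * N%:R <= t -> 1 <= f t) ->
  A + 1 <= N%:R -> 2 * A <= eps * N%:R -> 1 <= s -> 8 / eps <= s ->
  (2 / eps * s + 2) * (2 * (1 + s + expR (expR (eps / 16 * s))) + 1) <=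
    expR (expR (eps / 8 * s) / 2) ->
  0 < ln (N%:R : R) -> f N%:R <= 2 * s * ln N%:R -> 1 <= ln (ln (N%:R : R)) ->
  ln (ln (N%:R : R)) <= expR (expR (eps / 16 * s)) ->
  9 * f N%:R * ln (ln (N%:R : R)) <= eps * N%:R ->
  (count (shares_prime phi D) (index_iota 1 N.+1))%:R <= 4 * (eps * N%:R).
Proof.
move=> A1 eps0 eps1 hD D0 w0 wdec Wmon fmono flow fhigh fge1 NA epsA s1 s8 grow ln0 fN2
  Nlnln lxE Nup.
have phiE n : 1 <= f n%:R -> (phi n)%:R <= f n%:R < (phi n)%:R + 1.
  move=> fn; have f0 : 0 <= Num.floor (f n%:R) by rewrite floor_ge0; lra.
  rewrite -[(phi n)%:R]/((phi n)%:~R) /phi (gez0_abs f0).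
  by rewrite floor_le_tmp -[1]/(1%:~R) -intrD floorD1_gt.
have N0 : (0 < N)%N by rewrite -(ltr_nat R); lra.
have NR : 0 < N%:R :> R by rewrite ltr0n.
have wN := w0 N%:R ltac:(lra).
have s0 : 0 < s by rewrite mulr_gt0.
pose a := (Num.truncn (eps * N%:R)).+1.
have ea : eps * N%:R <= a%:R by apply: ltW; exact: truncnS_gt.
have ae : a%:R <= eps * N%:R + 1.
  by rewrite /a -natr1 lerD2r truncn_le// mulr_ge0// ltW.
have epsN : eps * N%:R <= 2^-1 * N%:R by rewrite ler_wpM2r.
have aN : (a <= N)%N by rewrite -(ler_nat R); clear -ae epsN NA A1; lra.
have Aa : A <= a%:R by clear -epsA ea A1; lra.
have f1 n : (a <= n)%N -> 1 <= f n%:R.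
  rewrite -(ler_nat R) => an; apply: fge1; exact: le_trans ea an.
have fle n n' : (a <= n)%N -> (n <= n')%N -> f n%:R <= f n'%:R.
  move=> an nn; apply: fmono; last by rewrite ler_nat.
  by apply: le_trans Aa _; rewrite ler_nat.
have phile n n' : (a <= n)%N -> (n <= n')%N -> (phi n <= phi n')%N.
  move=> an nn; rewrite -ltnS -(ltr_nat R) -natr1.
  have /andP[h1 _] := phiE n (f1 n an).
  have /andP[_ h2] := phiE n' (f1 n' (leq_trans an nn)).
  by have := fle _ _ an nn; lra.
have /andP[ma1 ma2] := phiE a (f1 a (leqnn _)).
have /andP[mN1 mN2] := phiE N (f1 N aN).
have m0p : (0 < phi a)%N by rewrite -(ltr_nat R); have := f1 a (leqnn _); lra.
have m01 : (phi a <= phi N)%N by exact: phile.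
(* As [a - A >= eps N / 2], the monotonicity of [(t - A) w t] gives [w a <= 2 s / (eps N)]. *)
have m10 : (phi N - phi a)%:R <= 2 / eps * s + 1.
  rewrite natrB//.
  have wa := w0 a%:R Aa.
  have h1 := fhigh a%:R N%:R Aa ltac:(by rewrite ler_nat).
  have h2 := Wmon a%:R N%:R Aa ltac:(by rewrite ler_nat).
  have h3 : w a%:R * (N%:R - a%:R) <= w a%:R * N%:R.
    by rewrite ler_pM2l//; have : 0 <= a%:R :> R by []; lra.
  have h4 : eps * N%:R / 2 * w a%:R <= (a%:R - A) * w a%:R.
    by rewrite ler_pM2r//; lra.
  have h5 : (N%:R - A) * w N%:R <= s by rewrite /s ler_pM2r//; lra.
  have h6 : w a%:R * N%:R <= 2 / eps * s.
    rewrite mulrAC ler_pdivlMr//; lra.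
  lra.
have [|||||||L [y [y0 mL yb]]] := @window_tail eps s (ln N%:R) (phi a) (phi N) eps0 s8 s1.
- by rewrite m0p.
- exact: grow.
- exact: m10.
- by [].
- by apply: le_trans mN1 _.
- lra.
- exact: lxE.
(* When the floors agree, [f] moves by less than 1, at a rate of at least [w N]. *)
have spread n n' : (a <= n)%N -> (n <= n')%N -> (n' < N.+1)%N -> phi n = phi n' ->
    (n' - n)%:R <= (w N%:R)^-1.
  move=> an nn nN e.
  have Ann : A <= n%:R by apply: le_trans Aa _; rewrite ler_nat.
  have Ann' : A <= n'%:R by apply: le_trans Ann _; rewrite ler_nat.
  have h1 := flow n%:R n'%:R Ann ltac:(by rewrite ler_nat).
  have h2 := wdec n'%:R N%:R Ann' ltac:(by rewrite ler_nat -ltnS).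
  have /andP[h3 _] := phiE n (f1 n an).
  have /andP[_ h4] := phiE n' (f1 n' (leq_trans an nn)).
  rewrite -e in h4.
  rewrite -[leRHS]mul1r ler_pdivlMr// natrB//.
  have h5 : (n'%:R - n%:R) * w N%:R <= (n'%:R - n%:R) * w n'%:R.
    by rewrite ler_wpM2l// subr_ge0 ler_nat.
  lra.
have range n : (a <= n < N.+1)%N -> (phi a <= phi n <= phi N)%N.
  by move=> /andP[an nN]; rewrite !phile.
have iw0 : 0 <= (w N%:R)^-1 by rewrite invr_ge0 ltW.
have TC : (count (fun n => has (fun p => [&& prime p, p %| n & p %| phi n]%N)
     (index_iota D.+1 (phi N).+1)) (index_iota a N.+1))%:R <=
  (w N%:R)^-1 * (phi N - phi a)%:R / D%:R + (w N%:R)^-1 * (prime_sum R y + L%:R / y%:R) +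
  (phi N)%:R * prime_sum R (phi N).
  by apply: (@tail_count R phi a N.+1 (phi a) (phi N)).
have t1 : (w N%:R)^-1 * (phi N - phi a)%:R / D%:R <= eps * N%:R.
  rewrite ler_pdivrMr ?ltr0n// mulrC ler_pdivrMr//.
  apply: (le_trans m10).
  have h1 : 2 / eps + 1 <= eps * D%:R by rewrite ler_pdivrMr// in hD; lra.
  have h2 : (2 / eps + 1) * s <= eps * D%:R * s by rewrite ler_pM2r.
  rewrite mulrDl mul1r in h2; apply: (@le_trans _ _ (2 / eps * s + s)).
    by rewrite lerD2l.
  apply: (le_trans h2); rewrite le_eqVlt; apply/orP; left; apply/eqP; rewrite /s; ring.
have t2 : (w N%:R)^-1 * (prime_sum R y + L%:R / y%:R) <= eps * N%:R.
  by rewrite mulrC ler_pdivrMr//; move: yb; rewrite /s; lra.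
have fN1 := f1 N aN.
have t3 : (phi N)%:R * prime_sum R (phi N) <= eps * N%:R.
  apply: (le_trans _ Nup); rewrite mulrAC.
  have phiN : (phi N <= N)%N.
    have h1 : f N%:R <= f N%:R * ln (ln (N%:R : R)) by rewrite ler_peMr//; lra.
    have h2 : 9 * (f N%:R * ln (ln (N%:R : R))) <= eps * N%:R by rewrite mulrA.
    rewrite -(ler_nat R); apply: (le_trans mN1); apply: (le_trans h1).
    move: (f N%:R * _) h1 h2 => X h1 h2; lra.
  have h1 := prime_sum_loglog N0 Nlnln.
  have h2 := prime_sum_mono phiN.
  rewrite mulrC; apply: ler_pM => //; [exact: prime_sum_ge0|lra].
rewrite natr_count (@big_cat_nat _ _ _ a)/=; [|by []|exact: leqW].
have b1 : \sum_(1 <= n < a) (shares_prime phi D n)%:R <= eps * N%:R.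
  apply: (@le_trans _ _ (\sum_(1 <= n < a) (1 : R))).
    by apply: ler_sum => n _; case: shares_prime.
  by rewrite sumr_const_nat /a subSS subn0 truncn_le// mulr_ge0// ltW.
have b2 : \sum_(a <= n < N.+1) (shares_prime phi D n)%:R <= eps * N%:R + eps * N%:R + eps * N%:R.
  apply: (@le_trans _ _ ((count (fun n => has (fun p => [&& prime p, p %| n & p %| phi n]%N)
     (index_iota D.+1 (phi N).+1)) (index_iota a N.+1))%:R)); last first.
    by apply: (le_trans TC); apply: lerD => //; apply: lerD.
  rewrite natr_count; apply: ler_sum_nat => n /andP[an nN].
  rewrite ler_nat; case sp : (shares_prime phi D n) => //.
  move: sp => /hasP[p pI /and3P[pp pn pf]].
  suff -> : has (fun p => [&& prime p, p %| n & p %| phi n]%N) (index_iota D.+1 (phi N).+1) by [].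
  apply/hasP; exists p; last by rewrite pp pn.
  move: pI; rewrite !mem_index_iota => /andP[-> _] /=.
  rewrite ltnS; apply: leq_trans (phile n N an _) => //.
  apply: dvdn_leq => //; apply: leq_trans m0p _; exact: phile.
clear -b1 b2; lra.
Qed.

Lemma hardy_shared_primes (f : R -> R) : H f ->
  (forall C : R, \forall t \near +oo_R, C * (ln t * iter_log 4 t) <= f t) ->
  (forall c : R, 0 < c -> \forall t \near +oo_R, f t * iter_log 2 t <= c * t) ->
  forall eta : R, 0 < eta -> exists2 D : nat, (0 < D)%N &
  \forall N \near \oo,
    (count (shares_prime (fun n => `|Num.floor (f n%:R)|%N) D) (index_iota 1 N.+1))%:R
      <= eta * N%:R.
Proof.
move=> Hf hlog hup eta eta0.
have l1oo (M : R) : \forall t \near +oo_R, M <= ln t by exact: near_ln_ge.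
have l2oo (M : R) : \forall t \near +oo_R, M <= ln (ln t) by exact: (near_iter_log_ge 2).
have l3oo (M : R) : \forall t \near +oo_R, M <= ln (ln (ln t)).
  exact: (near_iter_log_ge 3).
have l4oo (M : R) : \forall t \near +oo_R, M <= iter_log 4 t by exact: near_iter_log_ge.
have low (C : R) : \forall t \near +oo_R, C * ln t + C <= f t.
  near=> t.
  have h1 : 2 * `|C| * (ln t * iter_log 4 t) <= f t by near: t; exact: hlog.
  have h2 : 1 <= iter_log 4 t by near: t; exact: l4oo.
  have h3 : 1 <= ln t by near: t; exact: l1oo.
  apply: le_trans h1; have := ler_norm C => hC.
  have : `|C| * ln t <= `|C| * (ln t * iter_log 4 t).
    by rewrite ler_wpM2l// ler_peMr//; lra.
  have : C * ln t <= `|C| * ln t by rewrite ler_wpM2r//; lra.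
  have : `|C| <= `|C| * ln t by rewrite ler_peMr.
  lra.
have up (c : R) : 0 < c -> \forall t \near +oo_R, f t <= c * t ^+ 1.
  move=> c0; near=> t.
  have h1 : f t * iter_log 2 t <= c * t by near: t; exact: hup.
  have h2 : 1 <= ln (ln t) by near: t; exact: l2oo.
  have h3 : 0 * ln t + 0 <= f t by near: t; exact: low.
  rewrite expr1; apply: le_trans h1.
  by rewrite ler_peMr//; move: h3; rewrite mul0r addr0.
have [A A1 [df w0 wdec Wmon]] := hardy_slow_derivative Hf up low.
pose eps := Num.min 2^-1 (eta / 8).
have eps0 : 0 < eps by rewrite lt_min invr_gt0 ltr0n divr_gt0.
have eps1 : eps <= 2^-1 by rewrite ge_min lexx.
have eps8 : eps <= eta / 8 by rewrite ge_min lexx orbT.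
have fmono s t : A <= s -> s <= t -> f s <= f t.
  move=> As st; rewrite -subr_ge0.
  have := @is_derive_compare_itv R (cst 0) (cst 0) f (der f) s t st.
  rewrite /= subrr; apply.
  - by move=> x /andP[sx _]; apply: df; lra.
  - by move=> x /andP[sx _]; apply/ltW/w0; lra.
have flow s t : A <= s -> s <= t -> der f t * (t - s) <= f t - f s.
  move=> As st; rewrite mulrBr.
  apply: (@is_derive_compare_itv R (fun x => der f t * x) (fun=> der f t) f (der f)) => //.
  - by move=> x _; exact: is_derive_linear.
  - by move=> x /andP[sx _]; apply: df; lra.
  - by move=> x /andP[sx xt]; apply: wdec => //; lra.
have fhigh s t : A <= s -> s <= t -> f t - f s <= der f s * (t - s).
  move=> As st; rewrite mulrBr.
  apply: (@is_derive_compare_itv R f (der f) (fun x => der f s * x) (fun=> der f s)) => //.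
  - by move=> x /andP[sx _]; apply: df; lra.
  - by move=> x _; exact: is_derive_linear.
  - by move=> x /andP[sx xt]; apply: wdec.
(* By monotonicity of [(x - A) f' x], the derivative of [f] is at most [W / (x - A)] up to [t]; this
   is integrated from [A + 1], where the logarithm vanishes. *)
have flog t : A + 1 <= t -> f t - f (A + 1) <= t * der f t * ln t.
  move=> At; pose W := (t - A) * der f t.
  have wt := w0 t ltac:(lra).
  have W0 : 0 <= W by rewrite mulr_ge0 ?(ltW wt)//; lra.
  have := @is_derive_compare_itv R f (der f) (fun x => W * ln (x - A)) (fun x => W * (x - A)^-1)
    (A + 1) t At.
  move=> /(_ _ _ _)K; have {K} : f t - f (A + 1) <= W * ln (t - A) - W * ln (A + 1 - A).
    apply: K.
    - by move=> x /andP[sx _]; apply: df; lra.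
    - move=> x /andP[sx _]; apply: is_deriveZ.
      apply: (@is_derive_translate R (@ln R) (- A)).
      by apply: is_derive1_ln; lra.
    - move=> x /andP[sx xt]; rewrite ler_pdivlMr; last by lra.
      by rewrite mulrC; apply: Wmon => //; lra.
  rewrite (_ : A + 1 - A = 1); last by ring.
  rewrite ln1 mulr0 subr0 => /le_trans; apply.
  apply: ler_pM => //; first by rewrite ln_ge0//; lra.
    by rewrite /W ler_pM2r//; lra.
  by rewrite ler_ln ?posrE; lra.
have [A0 A01 hA0] : exists2 A0 : R, 1 <= A0 & forall t, A0 <= t -> 1 <= f t.
  apply: near_pinftyP; apply: filterS (filterI (low 1) (l1oo 1)) => t [h1 h2]; lra.
pose phi n := `|Num.floor (f n%:R)|%N; rewrite -/phi.
pose D := (Num.truncn ((2 / eps + 1) / eps)).+1.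
have hD : (2 / eps + 1) / eps <= D%:R by apply: ltW; exact: truncnS_gt.
exists D => //.
have [S0 hS0] := doubly_exponential_growth eps0.
pose S1 := Num.max S0 (Num.max 1 (8 / eps)).
have e9 : 0 < eps / 9 by rewrite divr_gt0.
near=> N.
pose s := N%:R * der f N%:R.
have NA : A + 1 <= N%:R by near: N; exact: near_natr_ge.
have NA2 : 2 * A / eps + 1 <= N%:R by near: N; exact: near_natr_ge.
have Nln : 1 + `|f (A + 1)| <= ln (N%:R : R) by near: N; exact: (near_natr (l1oo _)).
have Nlnln : 1 <= ln (ln (N%:R : R)) by near: N; exact: (near_natr (l2oo _)).
have Nlll : 1 <= ln (ln (ln (N%:R : R))) by near: N; exact: (near_natr (l3oo _)).
have N4 : Num.max 1 S1 <= iter_log 4 (N%:R : R) by near: N; exact: (near_natr (l4oo _)).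
(* The summand 1 absorbs the term [ln N] of [fN], which leaves [16 / eps * log_4 N <= s]. *)
have Nlow : (16 / eps + 1) * (ln (N%:R : R) * iter_log 4 N%:R) <= f N%:R.
  by near: N; exact: (near_natr (hlog _)).
have Nup : 9 * f N%:R * ln (ln (N%:R : R)) <= eps * N%:R.
  suff : f N%:R * iter_log 2 (N%:R : R) <= eps / 9 * N%:R by rewrite /iter_log/=; lra.
  by near: N; exact: (near_natr (hup _ e9)).
have NA0 : A0 / eps <= N%:R by near: N; exact: near_natr_ge.
have N0 : (0 < N)%N by rewrite -(ltr_nat R); lra.
have NR : 0 < N%:R :> R by rewrite ltr0n.
have wN := w0 N%:R ltac:(lra).
have s0 : 0 < s by rewrite mulr_gt0.
have e16 : 1 <= 16 / eps by rewrite ler_pdivlMr//; lra.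
have [N4a N4b] : 1 <= iter_log 4 (N%:R : R) /\ S1 <= iter_log 4 (N%:R : R).
  by move: N4; rewrite ge_max => /andP[].
have ln0 : 0 < ln (N%:R : R) by have := normr_ge0 (f (A + 1)); lra.
have fA1 : f (A + 1) <= ln (N%:R : R) by have := ler_norm (f (A + 1)); lra.
have fN : f N%:R <= ln N%:R + s * ln N%:R by have := flog N%:R NA; rewrite /s; lra.
have s4 : 16 / eps * iter_log 4 (N%:R : R) <= s.
  have : ln (N%:R : R) <= ln (N%:R : R) * iter_log 4 (N%:R : R) by rewrite ler_peMr// ltW.
  rewrite -(ler_pM2r ln0); lra.
have sL4 : iter_log 4 (N%:R : R) <= s by apply: le_trans s4; rewrite ler_peMl//; lra.
have sS1 : S1 <= s by exact: le_trans N4b sL4.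
move: sS1; rewrite !ge_max => /and3P[sS0 s1 s8].
have fN2 : f N%:R <= 2 * s * ln (N%:R : R).
  have : ln (N%:R : R) <= s * ln (N%:R : R) by rewrite ler_peMl// ltW.
  lra.
have epsA : 2 * A <= eps * N%:R.
  have h : 2 * A / eps <= N%:R by lra.
  by rewrite ler_pdivrMr// in h; lra.
apply: (@le_trans _ _ (4 * (eps * N%:R))).
  apply: (@shared_primes_at f (der f) A) => //.
  - move=> t Nt; apply: hA0; rewrite ler_pdivrMr// in NA0.
    by apply: le_trans NA0 _; rewrite mulrC.
  - exact: hS0.
  - rewrite iter_log4_exp; [|lra|lra].
    rewrite !ler_expR -/s.
    have e160 : 0 < eps / 16 by rewrite divr_gt0.
    move: s4; rewrite -(ler_pM2l e160) mulrA (_ : eps / 16 * (16 / eps) = 1) ?mul1r//.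
    by field; rewrite gt_eqF.
have : eps * N%:R <= eta / 8 * N%:R by rewrite ler_wpM2r.
have : 0 <= eta * N%:R by rewrite mulr_ge0// ltW.
lra.
Unshelve. all: by end_near. Qed.

End SlowHardyFunction.

(** * Sieving by small primes *)

Section Sieve.
Variable R : realType.

(** Excluding the multiples of one more prime [p] subtracts the same sieve with [m] replaced by
    [m p]. The functional [T] is a proportion with [g] the gcd in one application, and a weighted
    sum with [g = id] in the other. *)
Lemma sieve_cvg (T : nat -> pred nat -> R) (g : nat -> nat) (c : R) (s : nat) :
  (forall N P Q, T N (fun n => P n && ~~ Q n) = T N P - T N (fun n => P n && Q n)) ->
  (forall N P Q, P =1 Q -> T N P = T N Q) ->
  (forall m, (0 < m)%N -> T N (fun n => m %| g n)%N @[N --> \oo] --> c * m%:R ^- s) ->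
  forall ps m, uniq ps -> all prime ps -> (0 < m)%N -> all (coprime m) ps ->
  T N (fun n => (m %| g n) && all (fun p => ~~ (p %| g n)) ps)%N @[N --> \oo] -->
   c * m%:R ^- s * \prod_(p <- ps) (1 - p%:R ^- s).
Proof.
move=> Tsub Text Tm; elim=> [|p ps IH] m.
  move=> _ _ m0 _; rewrite big_nil mulr1; apply: cvg_trans (Tm m m0).
  apply: near_eq_cvg; apply: nearW => N; apply: Text => n; by rewrite /= andbT.
move=> /= /andP[pps ups] /andP[pp prs] m0 /andP[mp mps].
have p0 := prime_gt0 pp.
have h1 := IH m ups prs m0 mps.
have pmps : all (coprime (m * p)) ps.
  apply/allP => q qps; rewrite coprimeMl (allP mps)//= prime_coprime// dvdn_prime2//.
    by apply: contraNneq pps => ->.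
  exact: (allP prs).
have mp0 : (0 < m * p)%N by rewrite muln_gt0 m0.
have h2 := IH (m * p)%N ups prs mp0 pmps.
rewrite big_cons.
have -> : c * m%:R ^- s * ((1 - p%:R ^- s) * \prod_(q <- ps) (1 - q%:R ^- s)) =
   c * m%:R ^- s * \prod_(q <- ps) (1 - q%:R ^- s) -
   c * (m * p)%:R ^- s * \prod_(q <- ps) (1 - q%:R ^- s).
  by rewrite natrM exprMn invfM; ring.
apply: cvg_trans (cvgB h1 h2); apply: near_eq_cvg; apply: nearW => N /=.
set P1 := (fun n => _ && _); set P2 := (fun n => _ && _).
have E : T N P2 = T N (fun n => P1 n && (p %| g n)%N).
  by apply: Text => n; rewrite /P1 /P2 Gauss_dvd// andbAC.
rewrite -[LHS]/(T N P1 - T N P2) E -Tsub; apply: Text => n; rewrite /P1.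
by case: (m %| g n)%N; case: (p %| g n)%N; rewrite //= ?andbT ?andbF.
Qed.

Lemma sum_multiples (m : nat) (B : nat -> bool) N : (0 < m)%N ->
  \sum_(1 <= n < N.+1) ((m %| n) && B (n %/ m))%N%:R =
  \sum_(1 <= n < (N %/ m).+1) (B n)%:R :> R.
Proof.
move=> m0; elim: N => [|N IH]; first by rewrite div0n !big_geq.
rewrite big_nat_recr//= IH divnS//; case: (m %| N.+1)%N => /=.
  by rewrite add1n [RHS]big_nat_recr.
by rewrite add0n addr0.
Qed.

Definition rate (N : nat) (P : pred nat) : R := (count P (index_iota 1 N.+1))%:R / N%:R.

Lemma count_diff (P Q : pred nat) (s : seq nat) :
  (count (fun n => P n && ~~ Q n) s)%:R = (count P s)%:R - (count (fun n => P n && Q n) s)%:R :> R.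
Proof.
rewrite !natr_count -sumrB; apply: eq_bigr => n _.
by case: (P n); case: (Q n); rewrite /= ?subrr ?subr0.
Qed.

(** There are about [N / m] multiples of [m] up to [N], and [B] selects a proportion [m ^ - k] of
    them; [avg_to] also counts the index 0, which costs at most 1. *)
Lemma avg_multiples_cvg (m k : nat) (B : nat -> bool) : (0 < m)%N ->
  avg_to (fun n => (B n)%:R) (m%:R ^- k : R) ->
  rate N (fun n => (m %| n) && B (n %/ m))%N @[N --> \oo] --> (m%:R ^- k.+1 : R).
Proof.
move=> m0 hB; apply/cvgrPdist_le => eps eps0.
have mR : 1 <= m%:R :> R by rewrite ler1n.
have mR0 : 0 < m%:R :> R by rewrite ltr0n.
have mk1 : 0 <= (m%:R ^- k : R) <= 1.
  by rewrite invr_ge0 exprn_ge0//= invf_le1 ?exprn_gt0// exprn_ege1.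
have e4 : 0 < eps / 4 by rewrite divr_gt0.
have [n0 hn0] := nearP_nat (hB _ e4).
near=> N.
have N1 : 1 <= N%:R :> R by near: N; exact: near_natr_ge.
have Ne : 8 / eps <= N%:R by near: N; exact: near_natr_ge.
have Nn0 : (n0 * m <= N)%N by near: N; exact: nbhs_infty_ge.
have N0 : 0 < N%:R :> R by lra.
rewrite distrC /rate natr_count sum_multiples//.
pose M := (N %/ m)%N.
have Mn0 : (n0 <= M.+1)%N by rewrite leqW// /M leq_divRL.
have := hn0 M.+1 Mn0; rewrite -/M.
rewrite big_ltn//; set S := \sum_(1 <= n < M.+1) _ => h.
have MN : M%:R <= N%:R / m%:R :> R by rewrite ler_pdivlMr// -natrM ler_nat leq_trunc_div.
have NM : N%:R / m%:R <= M%:R + 1 :> R.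
  by rewrite ler_pdivrMr// natr1 -natrM ler_nat; apply: ltnW; exact: ltn_ceil.
have MN' : N%:R / m%:R <= N%:R :> R by rewrite ler_pdivrMr// ler_peMr// ltW.
have b0 : 0 <= (B 0%N)%:R :> R by exact: ler0n.
have b1 : (B 0%N)%:R <= 1 :> R by case: (B 0%N).
have E : S / N%:R - m%:R ^- k.+1 = (S - m%:R ^- k * (N%:R / m%:R)) / N%:R.
  by rewrite exprSr; field; rewrite !gt_eqF// exprn_gt0.
rewrite E normrM normfV (gtr0_norm N0) ler_pdivrMr//.
rewrite ler_pdivrMr// in Ne.
move: h; rewrite -natr1; move: mk1; set a := m%:R ^- k => /andP[a0 a1].
have p1 : 0 <= a * (M%:R + 1 - N%:R / m%:R) by rewrite mulr_ge0// subr_ge0.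
have p2 : a * (M%:R + 1 - N%:R / m%:R) <= 1 * 1.
  by apply: ler_pM => //; [rewrite subr_ge0|rewrite lerBlDr; lra].
have p3 : eps / 4 * (M%:R + 1) <= eps / 4 * (N%:R + 1) by rewrite ler_pM2l// lerD2r; lra.
have p4 : eps * 1 <= eps * N%:R by rewrite ler_pM2l.
move: (N%:R / m%:R) p1 p2 => z p1 p2.
rewrite !ler_norml; lra.
Unshelve. all: by end_near. Qed.

(** * Partial sums of zeta and the Euler product *)

Section ZetaSums.
Variable s : nat.
Hypothesis s2 : (2 <= s)%N.

Definition zsum (N : nat) (P : pred nat) : R :=
  \sum_(1 <= n < N.+1) (P n)%:R * n%:R ^- s.

Lemma inv_pow_ge0 n : 0 <= (n%:R ^- s : R).
Proof. by rewrite invr_ge0 exprn_ge0. Qed.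

Lemma inv_pow_le n : (0 < n)%N -> n%:R ^- s <= n%:R ^- 2 :> R.
Proof.
move=> n0; rewrite lef_pV2 ?posrE ?exprn_gt0 ?ltr0n//.
by apply: ler_weXn2l; rewrite ?ler1n.
Qed.

Lemma zsum_le P N : zsum N P <= 2.
Proof.
case: N => [|N]; first by rewrite /zsum big_geq.
rewrite /zsum big_ltn//; have h := @recip_squares_tail R 1 N.+2 isT.
have : (P 1%N)%:R * 1%:R ^- s <= 1 :> R.
  by rewrite expr1n invr1 mulr1; case: (P 1%N).
have : \sum_(2 <= n < N.+2) (P n)%:R * n%:R ^- s <= \sum_(2 <= n < N.+2) (n%:R ^- 2 : R).
  apply: ler_sum_nat => n /andP[n2 _]; apply: le_trans (inv_pow_le _); last by lia.
  by rewrite ler_piMl ?inv_pow_ge0//; case: (P n).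
rewrite invr1 in h; lra.
Qed.

Definition zeta_sum : R := limn (fun N => zsum N xpredT).

Lemma zsum_cvg : zsum N xpredT @[N --> \oo] --> zeta_sum.
Proof.
apply: nondecreasing_is_cvgn.
  apply/nondecreasing_seqP => N; rewrite /zsum [leRHS]big_nat_recr//= lerDl.
  by rewrite mul1r inv_pow_ge0.
by exists 2 => _ [N _ <-]; exact: zsum_le.
Qed.

Lemma zsum_multiples m : (0 < m)%N ->
  zsum N (fun n => m %| id n)%N @[N --> \oo] --> zeta_sum * m%:R ^- s.
Proof.
move=> m0.
have E N : zsum N (fun n => m %| id n)%N = zsum (N %/ m) xpredT * m%:R ^- s.
  rewrite /zsum; elim: N => [|N IH]; first by rewrite div0n !big_geq// mul0r.
  rewrite big_nat_recr//= IH divnS//; case: (boolP (m %| N.+1)%N) => [d|] /=; last first.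
    by rewrite add0n mul0r addr0.
  rewrite add1n [in RHS]big_nat_recr//= mulrDl; congr (_ + _); rewrite !mul1r.
  have e : (N %/ m).+1 = (N.+1 %/ m)%N by rewrite divnS// d.
  by rewrite e -invfM -exprMn -natrM divnK.
apply: cvg_trans (_ : (zsum (N %/ m) xpredT * m%:R ^- s @[N --> \oo] --> _)).
  by apply: near_eq_cvg; apply: nearW => N; rewrite E.
apply: cvgMl.
apply: (@cvg_comp _ _ _ (fun N => N %/ m)%N (fun N => zsum N xpredT) _ \oo);
  last exact: zsum_cvg.
move=> A [n0 _ hA]; exists (n0 * m)%N => // N /= hN; apply: hA => /=.
by rewrite leq_divRL.
Qed.

Lemma zeta_sum_ge1 : 1 <= zeta_sum.
Proof.
apply: (cvgr_to_ge zsum_cvg); near=> N.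
have N0 : (0 < N)%N by near: N; exact: nbhs_infty_ge.
rewrite /zsum big_ltn//= expr1n invr1 mulr1 lerDl sumr_ge0.
Unshelve. all: by end_near. Qed.

Definition small_primes (D : nat) : seq nat := [seq p <- index_iota 0 D.+1 | prime p].

(** By the sieve, the product is the sum of [n ^ - s] over the [n] without prime factors up to [D]:
    1 contributes 1, the integers from 2 to [D] nothing, and the larger ones at most the tail of
    [n ^ - 2]. *)
Lemma euler_product_bounds D : (0 < D)%N ->
  1 <= zeta_sum * \prod_(p <- small_primes D) (1 - p%:R ^- s) <= 1 + D%:R^-1.
Proof.
move=> D0.
have := @sieve_cvg zsum id zeta_sum s _ _ zsum_multiples (small_primes D) 1 _ _ isT _.
move=> /(_ _ _ _ _ _)H.
have {H} : zsum N (fun n => (1 %| id n) && all (fun p => ~~ (p %| id n)) (small_primes D))%N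
   @[N --> \oo] --> zeta_sum * 1%:R ^- s * \prod_(p <- small_primes D) (1 - p%:R ^- s).
  apply: H.
  - move=> N P Q; rewrite /zsum -sumrB; apply: eq_bigr => n _.
    by case: (P n); case: (Q n); rewrite /= ?mul0r ?mul1r ?subrr ?subr0.
  - by move=> N P Q PQ; apply: eq_bigr => n _; rewrite PQ.
  - exact/filter_uniq/iota_uniq.
  - by apply/allP => p; rewrite mem_filter => /andP[].
  - by apply/allP => p _; rewrite coprime1n.
rewrite expr1n invr1 mulr1 => cv.
apply/andP; split.
  apply: (cvgr_to_ge cv); near=> N.
  have N0 : (0 < N)%N by near: N; exact: nbhs_infty_ge.
  rewrite /zsum big_ltn//= expr1n invr1 mulr1.
  have -> : all (fun p => ~~ (p %| 1)%N) (small_primes D).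
    apply/allP => p; rewrite mem_filter dvdn1 => /andP[/prime_gt1 + _].
    by case: eqP => // ->.
  by rewrite /= lerDl sumr_ge0// => n _; rewrite mulr_ge0 ?inv_pow_ge0.
apply: (cvgr_to_le cv); near=> N.
have ND : (D < N)%N by near: N; exact: nbhs_infty_ge.
rewrite /zsum (@big_cat_nat _ _ _ D.+1)//=; last by lia.
rewrite big_ltn//= big1_seq ?addr0; last first.
  move=> n /andP[_]; rewrite mem_index_iota => /andP[n2 nD].
  have -> : all (fun p => ~~ (p %| n)%N) (small_primes D) = false.
    apply/negbTE/allPn; exists (pdiv n); last by rewrite negbK pdiv_dvd.
    rewrite mem_filter mem_index_iota pdiv_prime//=.
    by apply: leq_ltn_trans nD; apply: dvdn_leq; [lia|exact: pdiv_dvd].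
  by rewrite andbF mul0r.
apply: lerD; first by rewrite expr1n invr1 mulr1; case: all.
apply: le_trans (@recip_squares_tail R D N.+1 D0).
apply: ler_sum_nat => n /andP[n2 _]; apply: le_trans (inv_pow_le _); last by lia.
by rewrite ler_piMl ?inv_pow_ge0//; case: (_ && _).
Unshelve. all: by end_near. Qed.

End ZetaSums.

Lemma zetaE k : zeta (k.+1%:R : R) = zeta_sum k.+1.
Proof.
rewrite /zeta /zeta_sum; congr (limn _); apply/funext => N.
apply: eq_bigr => n _; rewrite mul1r powRN; congr (_^-1).
by rewrite powR_mulrn.
Qed.

End Sieve.

(** * Density of coprimality *)

Section CoprimeDensity.
Variable R : realType.

Variables (H : set (R -> R)) (hH : hardy_field H) (k : nat) (f : 'I_k -> R -> R).
Hypothesis hf : forall i, H (f i).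
Hypothesis fpos : forall i, \forall t \near +oo_R, 0 < f i t.
Hypothesis fln : forall i (C : R), \forall t \near +oo_R, C * ln t <= f i t.
Hypothesis fpow : forall i, exists j : nat,
  (forall C : R, \forall t \near +oo_R, C * t ^+ j <= f i t) /\
  (forall c : R, 0 < c -> \forall t \near +oo_R, f i t <= c * t ^+ j.+1).
Hypothesis fsucc : forall i i' : 'I_k, i' = i.+1 :> nat ->
  forall M : R, \forall t \near +oo_R, M * f i t <= f i' t.

Lemma dvdn_gcd_floors m n : (0 < m)%N -> (m %| gcd_floors f n)%N =
  (m %| n)%N && [forall i, (Num.floor (f i (m%:R * (n %/ m)%:R)) %% m)%Z == 0].
Proof.
move=> m0; rewrite /gcd_floors dvdn_gcd; case: (boolP (m %| n)%N) => //= mn.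
have e : m%:R * (n %/ m)%:R = n%:R :> R by rewrite -natrM mulnC divnK.
rewrite e; apply/dvdn_biggcdP/forallP => h i.
  by apply/eqP/dvdz_mod0P; rewrite dvdzE; exact: h.
by move=> _; have := h i => /eqP/dvdz_mod0P; rewrite dvdzE.
Qed.

Lemma rate_multiples m : (0 < m)%N ->
  rate R N (fun n => m %| gcd_floors f n)%N @[N --> \oo] --> (1 * m%:R ^- k.+1 : R).
Proof.
(* Modulus 1 is treated apart, as [box_density] requires a modulus of at least 2. *)
move=> m0; rewrite mul1r; have [m1|m1] := eqVneq m 1%N.
  rewrite m1 expr1n invr1; apply/cvgrPdist_le => eps eps0; near=> N.
  have N0 : (0 < N)%N by near: N; exact: nbhs_infty_gt.
  rewrite /rate (eq_count (a2 := predT)); last by move=> n; rewrite dvd1n.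
  rewrite count_predT size_iota subSS subn0 mulfV ?pnatr_eq0 -?lt0n//.
  by rewrite subrr normr0 ltW.
have m2 : (2 <= m)%N by lia.
pose y i n := f i (m%:R * n%:R).
have mR : 0 < m%:R :> R by rewrite ltr0n.
have weyl (a : 'I_k -> int) (s : R) : (exists i, a i != 0) ->
    cos_avg0 (fun n => \sum_i (a i)%:~R * (y i n / m%:R * (2 * pi)) + s).
  move=> a0.
  have sp : 0 < 2 * pi / m%:R :> R by rewrite divr_gt0// mulr_gt0// pi_gt0.
  have h := combination_cos_avg0 hH hf fpos fln fpow fsucc s mR sp a0.
  move=> eps eps0; apply: filterS (h eps eps0) => N.
  set S1 := \sum_(_ <= n < _) _; set S2 := \sum_(_ <= n < _) _.
  rewrite (_ : S1 = S2)//; apply: eq_bigr => n _; congr (cos (_ + _)).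
  by rewrite mulr_sumr; apply: eq_bigr => i _; rewrite /y; field; rewrite gt_eqF.
pose r0 : {ffun 'I_k -> 'I_m} := [ffun=> Ordinal m0].
have := avg_multiples_cvg m0 (box_density m2 weyl r0).
apply: cvg_trans; apply: near_eq_cvg; apply: nearW => N.
rewrite /rate; congr (_%:R / _); apply: eq_count => n.
rewrite dvdn_gcd_floors//; congr (_ && _).
by apply: eq_forallb => i; rewrite /y ffunE.
Unshelve. all: by end_near. Qed.

Lemma rate_coprime_small D :
  rate R N (fun n => all (fun p => ~~ (p %| gcd_floors f n))%N (small_primes D))
   @[N --> \oo] --> (\prod_(p <- small_primes D) (1 - p%:R ^- k.+1) : R).
Proof.
have K : rate R N (fun n => (1 %| gcd_floors f n) &&
      all (fun p => ~~ (p %| gcd_floors f n)) (small_primes D))%N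
   @[N --> \oo] --> 1 * 1%:R ^- k.+1 * (\prod_(p <- small_primes D) (1 - p%:R ^- k.+1) : R).
  apply: sieve_cvg => //.
  - by move=> N P Q; rewrite /rate count_diff mulrBl.
  - by move=> N P Q PQ; rewrite /rate (eq_count PQ).
  - exact: rate_multiples.
  - exact/filter_uniq/iota_uniq.
  - by apply/allP => p; rewrite mem_filter => /andP[].
  - by apply/allP => p _; rewrite coprime1n.
move: K; rewrite expr1n invr1 !mul1r; apply: cvg_trans.
apply: near_eq_cvg; apply: nearW => N; rewrite /rate; congr (_%:R / _).
by apply: eq_count => n /=; rewrite dvd1n.
Qed.

(** The witness is the least prime factor of the gcd. *)
Lemma coprime_small_not_coprime (i : 'I_k) D n : (0 < n)%N ->
  all (fun p => ~~ (p %| gcd_floors f n))%N (small_primes D) -> gcd_floors f n != 1%N ->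
  shares_prime (fun n => `|Num.floor (f i n%:R)|%N) D n.
Proof.
move=> n0 /allP h G1.
have Gn : (gcd_floors f n %| n)%N by exact: dvdn_gcdl.
have G0 : (0 < gcd_floors f n)%N by exact: dvdn_gt0 Gn.
have pp : prime (pdiv (gcd_floors f n)) by apply: pdiv_prime; lia.
have pG := pdiv_dvd (gcd_floors f n).
apply/hasP; exists (pdiv (gcd_floors f n)).
  rewrite mem_index_iota ltnS (dvdn_leq n0) ?andbT; last exact: dvdn_trans pG Gn.
  rewrite ltnNge; apply/negP => pD.
  have := h (pdiv (gcd_floors f n)); rewrite mem_filter pp mem_index_iota ltnS pD => /(_ isT).
  by rewrite pG.
rewrite pp (dvdn_trans pG Gn) /=; apply: dvdn_trans pG _.
apply: dvdn_trans (dvdn_gcdr _ _) _.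
exact: (@biggcdn_inf _ i).
Qed.

End CoprimeDensity.

Unset Implicit Arguments.

Theorem theorem6p6 (R : realType) (H : set (R -> R)) (hH : hardy_field H)
  (k : nat) (hk : (0 < k)%N) (f : 'I_k -> R -> R)
  (hf : forall i, H (f i))
  (hf_log : forall i,
     growth_lt (fun t => ln t * iter_log 4 t) (f i))
  (hf_pow : forall i, exists j : nat,
     [/\ (0 < j)%N, growth_lt (fun t => t ^+ j.-1) (f i)
       & growth_lt (f i) (fun t => t ^+ j)])
  (hf_first : growth_lt (f (Ordinal hk)) (fun t => t / iter_log 2 t))
  (hf_succ : forall i i' : 'I_k, i' = i.+1 :> nat ->
     growth_lt (fun=> 1) (fun t => f i' t / f i t)) :
  has_natural_density (fun n => gcd_floors f n == 1%N)
    (1 / zeta (k.+1%:R : R)).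
Proof.
have fL i (C : R) : \forall t \near +oo_R, C * (ln t * iter_log 4 t) <= f i t.
  have h := (growth_ltP _ _).1 (hf_log i) C.
  near=> t.
  have h1 : C <= f i t / (ln t * iter_log 4 t) by near: t; exact: h.
  have l1 : 1 <= ln t by near: t; exact: near_ln_ge.
  have l4 : 1 <= iter_log 4 t by near: t; exact: near_iter_log_ge.
  by rewrite ler_pdivlMr// in h1; rewrite mulr_gt0//; lra.
have fln i (C : R) : \forall t \near +oo_R, C * ln t <= f i t.
  near=> t.
  have h1 : `|C| * (ln t * iter_log 4 t) <= f i t by near: t; exact: fL.
  have l1 : 1 <= ln t by near: t; exact: near_ln_ge.
  have l4 : 1 <= iter_log 4 t by near: t; exact: near_iter_log_ge.
  apply: le_trans h1; apply: (@le_trans _ _ (`|C| * ln t)).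
    by rewrite ler_wpM2r ?ler_norm//; lra.
  by rewrite ler_wpM2l// ler_peMr//; lra.
have fpos i : \forall t \near +oo_R, 0 < f i t.
  near=> t.
  have h1 : 1 * ln t <= f i t by near: t; exact: fln.
  have l1 : 1 <= ln t by near: t; exact: near_ln_ge.
  lra.
have fpow i : exists j : nat,
  (forall C : R, \forall t \near +oo_R, C * t ^+ j <= f i t) /\
  (forall c : R, 0 < c -> \forall t \near +oo_R, f i t <= c * t ^+ j.+1).
  have [[|j] [j0 lo up]] := hf_pow i; first by [].
  exists j; split.
    move=> C; have h := (growth_ltP _ _).1 lo C.
    near=> t.
    have h1 : C <= f i t / t ^+ j by near: t; exact: h.
    have t1 : 1 <= t by near: t; exact: near_pinfty_ge.
    by rewrite ler_pdivlMr// in h1; rewrite exprn_gt0//; lra.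
  move=> c c0; have h := (growth_ltP _ _).1 up c^-1.
  near=> t.
  have h1 : c^-1 <= t ^+ j.+1 / f i t by near: t; exact: h.
  have f0 : 0 < f i t by near: t; exact: fpos.
  by rewrite ler_pdivlMr// mulrC ler_pdivrMr// mulrC in h1.
have fsucc (i i' : 'I_k) : i' = i.+1 :> nat ->
    forall M : R, \forall t \near +oo_R, M * f i t <= f i' t.
  move=> ii M; have h := (growth_ltP _ _).1 (hf_succ i i' ii) M.
  near=> t.
  have h1 : M <= f i' t / f i t / 1 by near: t; exact: h.
  have f0 : 0 < f i t by near: t; exact: fpos.
  by rewrite divr1 ler_pdivlMr// in h1.
have fup (c : R) : 0 < c ->
    \forall t \near +oo_R, f (Ordinal hk) t * iter_log 2 t <= c * t.
  move=> c0; have h := (growth_ltP _ _).1 hf_first c^-1.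
  near=> t.
  have h1 : c^-1 <= t / iter_log 2 t / f (Ordinal hk) t by near: t; exact: h.
  have f0 : 0 < f (Ordinal hk) t by near: t; exact: fpos.
  have l2 : 1 <= iter_log 2 t by near: t; exact: near_iter_log_ge.
  have l20 : 0 < iter_log 2 t by lra.
  rewrite ler_pdivlMr// ler_pdivlMr// in h1.
  by rewrite -ler_pdivrMl// mulrA.
have tail := hardy_shared_primes hH (hf _) (fL (Ordinal hk)) fup.
(* By computation [hk] is also a proof of [2 <= k.+1], the condition on the exponent. *)
have Z1 := @zeta_sum_ge1 R k.+1 hk.
rewrite /has_natural_density zetaE.
apply/cvgrPdist_le => eps eps0.
have e4 : 0 < eps / 4 by rewrite divr_gt0.
have [D0 D00 hD0] := tail _ e4.
have [D1 hD1] := nearP_nat (near_natr_ge (4 / eps)).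
(* [D0] makes the tail at most [eps / 4] and [D1] brings the product within [eps / 4] of [1 / zeta];
   the limit in [N] costs a third [eps / 4]. *)
pose D := maxn D0 (maxn D1 1).
have DD1 : 4 / eps <= D%:R by apply: hD1; rewrite /D; lia.
have Dp : (0 < D)%N by rewrite /D; lia.
have DR : 0 < D%:R :> R by rewrite ltr0n.
have dens : \forall N \near \oo, `|\prod_(p <- small_primes D) (1 - p%:R ^- k.+1)
    - rate R N (fun n => all (fun p => ~~ (p %| gcd_floors f n))%N (small_primes D))|
    <= eps / 4.
  have /cvgrPdist_le := rate_coprime_small hH hf fpos fln fpow fsucc (D := D); exact.
have /andP[E1 E2] := @euler_product_bounds R k.+1 hk _ Dp.
set Z := zeta_sum R k.+1 in Z1 E1 E2 *.
set P := \prod_(p <- _) _ in E1 E2 dens.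
have Zp : 0 < Z by exact: lt_le_trans Z1.
have {Z1} PZ : 0 <= P - 1 / Z <= eps / 4.
  have -> : P - 1 / Z = (Z * P - 1) / Z by field; rewrite gt_eqF.
  rewrite divr_ge0 ?subr_ge0 ?(ltW Zp)//= ler_pdivrMr//.
  apply: (@le_trans _ _ (eps / 4 * 1)); last by rewrite ler_pM2l.
  rewrite mulr1; apply: (@le_trans _ _ D%:R^-1); first by rewrite lerBlDl.
  by rewrite -[leRHS]invf_div lef_pV2 ?posrE ?divr_gt0.
near=> N.
have N1 : 1 <= N%:R :> R by near: N; exact: near_natr_ge.
have N0 : 0 < N%:R :> R by exact: lt_le_trans N1.
have dN : `|P - rate R N (fun n => all (fun p => ~~ (p %| gcd_floors f n))%N
    (small_primes D))| <= eps / 4 by near: N; exact: dens.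
have tN : (count (shares_prime (fun n => `|Num.floor (f (Ordinal hk) n%:R)|%N) D0)
    (index_iota 1 N.+1))%:R <= eps / 4 * N%:R by near: N; exact: hD0.
rewrite -[X in _ - X]/(rate R N (fun n => gcd_floors f n == 1%N)).
move: dN; rewrite /rate !natr_count.
set S1 := \sum_(n <- _) _ ; set S2 := \sum_(n <- _) _ => dN.
rewrite natr_count in tN; set S3 := \sum_(n <- _) _ in tN.
(* [S2] counts the [n] with gcd 1, [S1] those whose gcd has no prime factor up to [D], and [S3]
   those sharing a prime beyond [D0 <= D] with the floor of the first function. *)
have S21 : S2 <= S1.
  apply: ler_sum => n _; rewrite ler_nat.
  case: eqP => // ->; rewrite (_ : all _ _)//.
  apply/allP => p; rewrite mem_filter dvdn1 => /andP[/prime_gt1 + _].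
  by case: eqP => // ->.
have S123 : S1 <= S2 + S3.
  rewrite -big_split/=; apply: ler_sum_nat => n /andP[n0 _].
  rewrite -natrD ler_nat.
  case al : (all _ _) => //; have [//|G1] := eqVneq (gcd_floors f n) 1%N.
  rewrite (_ : shares_prime _ _ _)//.
  have /hasP[p pI hp] := coprime_small_not_coprime (Ordinal hk) n0 al G1.
  apply/hasP; exists p => //; move: pI; rewrite !mem_index_iota => /andP[Dl ->].
  by rewrite andbT; apply: leq_ltn_trans Dl; rewrite /D leq_maxl.
have T1 : S2 / N%:R <= S1 / N%:R by rewrite ler_pM2r ?invr_gt0.
have T2 : S1 / N%:R <= S2 / N%:R + eps / 4.
  by rewrite ler_pdivrMr// mulrDl divfK ?gt_eqF//; apply: le_trans S123 _; rewrite lerD2l.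
move: PZ dN T1 T2 => /andP[].
move: (S1 / _) (S2 / _) (1 / Z) => r1 r2 z h1 h2; rewrite !ler_norml; lra.
Unshelve. all: by end_near. Qed.
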